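(* Let $n\geq 2$ and let $f=(f_1,\dots,f_n)\in S^0(\mathbb{D}^n)$ with power series expansion $f_1(z)=z_1+\sum_{|\alpha|\geq 2}A_\alpha z^\alpha$ of its first component. Then the following statements hold. a) $|A_\alpha|\leq 2$ for all multiindices $\alpha\in\mathbb{N}_0^n$ with $|\alpha|=2$ and $\alpha_1\neq 0$. This estimate is sharp for every such $\alpha$ (i.e. for every such $\alpha$ equality is attained by some element of $S^0(\mathbb{D}^n)$). In particular, the following mappings belong to $S^0(\mathbb{D}^n)$ and attain equality for the indicated $\alpha$: $$F_1(z)=\left(\frac{z_1}{(1-z_1)^2},z_2,\dots,z_n\right)\quad\text{for }\alpha=(2,0,\dots,0),$$ $$F_2(z)=\left(z_1(1+z_2)^2,z_2,\dots,z_n\right)\quad\text{and}\quad F_3(z)=\left(\frac{z_1(1+z_2)}{1-z_2},\frac{z_2}{1-z_2},z_3,\dots,z_n\right)\quad\text{for }\alpha=(1,1,0,\dots,0).$$ b) $|A_\alpha|\leq 1$ for all multiindices $\alpha\in\mathbb{N}_0^n$ with $|\alpha|=2$ and $\alpha_1=0$. This estimate is sharp for every such $\alpha$. In particular, the following mappings belong to $S^0(\mathbb{D}^n)$ and attain equality for the indicated $\alpha$: $$F_4(z)=\left(z_1+z_2^2,z_2,\dots,z_n\right)\quad\text{and}\quad F_5(z)=\left(\frac{z_1-z_1z_2+z_2^2}{1-z_2},\frac{z_2}{1-z_2},z_3,\dots,z_n\right)\quad\text{for }\alpha=(0,2,0,\dots,0),$$ and, when $n\geq 3$, $$F_6(z)=\left(z_1+z_2z_3,z_2,\dots,z_n\right)\quad\text{and}$$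 $$F_7(z)=\left(z_1+\frac{z_2z_3\left(\log(1+z_2)-\log(1+z_3)\right)}{z_2-z_3},\frac{z_2}{1+z_2},\frac{z_3}{1+z_3},z_4,\dots,z_n\right)\quad\text{for }\alpha=(0,1,1,0,\dots,0),$$ where $\log$ is the principal branch and the quotient in $F_7$ is extended holomorphically across $z_2=z_3$.
   Context: $\mathbb{D}\subset\mathbb{C}$ is the open unit disc, $\mathbb{D}^n$ the polydisc, $\|z\|_\infty=\max_j|z_j|$. For multiindices $\alpha\in\mathbb{N}_0^n$: $|\alpha|=\alpha_1+\dots+\alpha_n$, $z^\alpha=z_1^{\alpha_1}\cdots z_n^{\alpha_n}$. $\mathcal{H}(\mathbb{D}^n,\mathbb{C}^n)$ is the set of holomorphic mappings $\mathbb{D}^n\to\mathbb{C}^n$. $S(\mathbb{D}^n)$ is the set of univalent (injective holomorphic) $f:\mathbb{D}^n\to\mathbb{C}^n$ with $f(0)=0$, $Df(0)=I_n$. $\mathcal{M}(\mathbb{D}^n)$ is the set of $h\in\mathcal{H}(\mathbb{D}^n,\mathbb{C}^n)$ with $h(0)=0$, $Dh(0)=-I_n$ and $\operatorname{Re}(h_j(z)/z_j)\leq 0$ whenever $z\in\mathbb{D}^n$ and $\|z\|_\infty=|z_j|>0$. A Herglotz vector field is a mapping $G:\mathbb{D}^n\times[0,\infty)\to\mathbb{C}^n$ with $G(\cdot,t)\in\mathcal{M}(\mathbb{D}^n)$ for all $t\geq 0$ and $G(z,\cdot)$ measurable for all $z\in\mathbb{D}^n$. Its Loewner equation is $\frac{\partial}{\partial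 t}\varphi_{s,t}(z)=G(\varphi_{s,t}(z),t)$ for almost all $t\geq s$, $\varphi_{s,s}(z)=z$; its solutions are univalent maps $\varphi_{s,t}:\mathbb{D}^n\to\mathbb{D}^n$ ($0\le s\le t$), and the limit $\lim_{t\to\infty}e^t\varphi_{0,t}$ exists locally uniformly on $\mathbb{D}^n$ and lies in $S(\mathbb{D}^n)$. $S^0(\mathbb{D}^n)$ is the set of all $f\in S(\mathbb{D}^n)$ having parametric representation, i.e. $f=\lim_{t\to\infty}e^t\varphi_{0,t}$ for some Herglotz vector field $G$. *)

(* Defs.v *)
From HB Require Import structures.
From mathcomp Require Import all_boot all_order all_algebra finmap.
From mathcomp Require Import all_classical all_reals all_analysis.
From mathcomp Require Import complex.
From mathcomp.analysis.showcase Require Import summability.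

Set Implicit Arguments.
Unset Strict Implicit.
Unset Printing Implicit Defensive.

Import Order.TTheory GRing.Theory Num.Theory.
Import numFieldNormedType.Exports.

Local Open Scope classical_set_scope.
Local Open Scope ring_scope.
Local Open Scope complex_scope.

HB.instance Definition _ (R : realType) := PseudoPointedMetric.copy R[i] R[i]^o.
HB.instance Definition _ (R : realType) := GRing.ComAlgebra.copy R[i] R[i]^o.
HB.instance Definition _ (R : realType) := Vector.copy R[i] R[i]^o.
HB.instance Definition _ (R : realType) := NormedModule.copy R[i] R[i]^o.

(* C^n is 'rV[R[i]]_n, whose library norm is the sup norm.  That norm and     *)
(* complex moduli are elements of R[i] (with zero imaginary part), ordered by *)
(* x <= y iff y - x is a nonnegative real number.                             *)
(* Mappings of the polydisc are represented by total functions; none of the   *)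
(* predicates below depends on their values outside the polydisc.             *)

(* R equipped with the sigma-algebra of Lebesgue measurable sets. *)
Definition lebesgueR (R : realType) : Type :=
  caratheodory_type (wlength (@idfun R))^*%mu.
HB.instance Definition _ (R : realType) := Measurable.on (lebesgueR R).

Section Polydisc.
Context {R : realType} {n : nat}.
Local Notation C := R[i].
Local Notation Cn := 'rV[R[i]]_n.

Definition polydisc : set Cn := [set z | `|z| < 1].

Definition holomorphic (f : Cn -> Cn) : Prop :=
  forall z, polydisc z -> differentiable f z.

Definition univalent (f : Cn -> Cn) : Prop :=
  holomorphic f /\ {in polydisc &, injective f}.

Definition classS (f : Cn -> Cn) : Prop :=
  [/\ univalent f, f 0 = 0 & 'J f 0 = 1%:M].

Definition classM (h : Cn -> Cn) : Prop :=
  [/\ holomorphic h, h 0 = 0, 'J h 0 = - 1%:M &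
      forall (z : Cn) (j : 'I_n), polydisc z ->
        `|z| = `|z 0 j| -> 0 < `|z 0 j| -> complex.Re (h z 0 j / z 0 j) <= 0].

Definition herglotz (G : Cn -> R -> Cn) : Prop :=
  (forall t, 0 <= t -> classM (G ^~ t)) /\
  (forall z (j : 'I_n), polydisc z ->
    measurable_fun (`[0, +oo[%classic : set (lebesgueR R))
      (fun t => complex.Re (G z t 0 j)) /\
    measurable_fun (`[0, +oo[%classic : set (lebesgueR R))
      (fun t => complex.Im (G z t 0 j))).

Definition abs_continuous_on (a b : R) (u : R -> Cn) : Prop :=
  forall e : R, 0 < e -> exists2 d : R, 0 < d &
    forall (m : nat) (x y : 'I_m -> R),
      (forall i, a <= x i /\ x i <= y i /\ y i <= b) ->
      (forall i j, i != j -> y i <= x j \/ y j <= x i) ->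
      \sum_i (y i - x i) < d -> \sum_i `|u (y i) - u (x i)| < e%:C.

(* phi s t stands for $\varphi_{s,t}$ and is only constrained for 0 <= s <= t. *)
(* As usual for an equation required only at almost every t, solutions are    *)
(* locally absolutely continuous in t.                                        *)
Definition loewner_solution (G : Cn -> R -> Cn) (phi : R -> R -> Cn -> Cn)
    : Prop :=
  (forall s t, 0 <= s -> s <= t ->
    univalent (phi s t) /\ (forall z, polydisc z -> polydisc (phi s t z))) /\
  (forall s z, 0 <= s -> polydisc z ->
    [/\ phi s s z = z,
        forall T, s <= T -> abs_continuous_on s T (fun t => phi s t z) &
        {ae lebesgue_measure, forall t : R, s <= t ->
          (h^-1)%:C *: (phi s (t + h) z - phi s t z) @[h --> (0 : R)^']
            --> G (phi s t z) t}]).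

Definition locally_uniform_limit (F : R -> Cn -> Cn) (f : Cn -> Cn) : Prop :=
  forall z, polydisc z ->
    exists2 U : set Cn, nbhs z U & {uniform U, F @ +oo%R --> f}.

Definition classS0 (f : Cn -> Cn) : Prop :=
  classS f /\ exists G phi,
    [/\ herglotz G, loewner_solution G phi &
        locally_uniform_limit (fun t z => (expR t)%:C *: phi 0 t z) f].

Definition mdeg (a : {ffun 'I_n -> nat}) : nat := (\sum_j a j)%N.

Definition monom (z : Cn) (a : {ffun 'I_n -> nat}) : C := \prod_j z 0 j ^+ a j.

(* $f_k(z) = z_k + \sum_{|\alpha| \ge 2} A_\alpha z^\alpha$ on the polydisc, as *)
(* an unconditionally (equivalently, absolutely) convergent series.           *)
Definition expansion (k : 'I_n) (f : Cn -> Cn) (A : {ffun 'I_n -> nat} -> C)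
    : Prop :=
  forall z, polydisc z ->
    ((\sum_(a <- enum_fset J | (2 <= mdeg a)%N) A a * monom z a)
      @[J --> totally]) --> (f z 0 k - z 0 k).

Definition attained (k : 'I_n) (f : Cn -> Cn) (a : {ffun 'I_n -> nat})
    (c : C) : Prop :=
  classS0 f /\ exists2 A, expansion k f A & `|A a| = c.

End Polydisc.

(* The multiindex (s_1, ..., s_k, 0, ..., 0). *)
Definition mindex (n : nat) (s : seq nat) : {ffun 'I_n -> nat} :=
  [ffun j : 'I_n => nth 0%N s j].

Section Log.
Context {R : realType}.
Implicit Types w : R[i].

(* Principal argument, with values in ]-pi, pi] for w != 0. *)
Definition carg w : R :=
  let x := acos (complex.Re w / complex.Re `|w|) in
  if 0 <= complex.Im w then x else - x.

Definition clog w : R[i] := ln (complex.Re `|w|) +i* carg w.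

(* (log(1+a) - log(1+b)) / (a - b), extended by its limit at a = b. *)
Definition log_quotient (a b : R[i]) : R[i] :=
  if a == b then (1 + a)^-1 else (clog (1 + a) - clog (1 + b)) / (a - b).

End Log.

Section Examples.
Context {R : realType} {n : nat}.
Local Notation Cn := 'rV[R[i]]_n.

Definition with_prefix (s : seq R[i]) (z : Cn) : Cn :=
  \row_j nth (z 0 j) s j.

Section TwoVariables.
Variable hn : (2 <= n)%N.
Local Notation z1 z := ((z : Cn) 0 (Ordinal (ltnW hn))).
Local Notation z2 z := ((z : Cn) 0 (Ordinal hn)).

Definition F1 z := with_prefix [:: z1 z / (1 - z1 z) ^+ 2] z.
Definition F2 z := with_prefix [:: z1 z * (1 + z2 z) ^+ 2] z.
Definition F3 z := with_prefix
  [:: z1 z * (1 + z2 z) / (1 - z2 z); z2 z / (1 - z2 z)] z.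
Definition F4 z := with_prefix [:: z1 z + z2 z ^+ 2] z.
Definition F5 z := with_prefix
  [:: (z1 z - z1 z * z2 z + z2 z ^+ 2) / (1 - z2 z); z2 z / (1 - z2 z)] z.

End TwoVariables.

Section ThreeVariables.
Variable hn : (3 <= n)%N.
Local Notation z1 z := ((z : Cn) 0 (Ordinal (ltnW (ltnW hn)))).
Local Notation z2 z := ((z : Cn) 0 (Ordinal (ltnW hn))).
Local Notation z3 z := ((z : Cn) 0 (Ordinal hn)).

Definition F6 z := with_prefix [:: z1 z + z2 z * z3 z] z.
Definition F7 z := with_prefix
  [:: z1 z + z2 z * z3 z * log_quotient (z2 z) (z3 z);
      z2 z / (1 + z2 z); z3 z / (1 + z3 z)] z.

End ThreeVariables.
End Examples.

(* Main.v *)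
Require Import Defs.
From mathcomp Require Import all_boot all_order all_algebra finmap.
From mathcomp Require Import all_classical all_reals all_analysis.
From mathcomp Require Import complex ring lra.
From mathcomp.analysis.showcase Require Import summability.

Set Implicit Arguments.
Unset Strict Implicit.
Unset Printing Implicit Defensive.
Import Order.TTheory GRing.Theory Num.Theory.
Import numFieldNormedType.Exports.
Local Open Scope classical_set_scope.
Local Open Scope ring_scope.
Local Open Scope complex_scope.

(* Upper bounds. Along a Loewner flow, e^t phi_{0,t}(z) has derivative e^t (G(phi, t) + phi)
   with phi = phi_{0,t}(z). The average of f(z) - z over points z whose coordinates are r times
   cube roots of unity, with suitable weights, isolates A_alpha r^2 up to O(r^3), so |A_alpha| is
   at most the supremum of |h_1(z) + z_1| / r^2 over h in M and over these points, as r tends to 0.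
   If alpha_1 <> 0, then z_1 is a coordinate of maximal modulus, -h_1 / z_1 restricted to the disc
   through z has nonnegative real part, and Caratheodory's inequality gives the bound 2. If
   alpha_1 = 0, the averaging points can be taken with z_1 = 0, and the condition
   Re (h_1 / z_1) <= 0 on a nearby disc, tangent to the hyperplane z_1 = 0 at 0, gives the bound 1.

   Examples. Each one is Psi(0, .) for an explicit family Psi(x, .), 0 <= x <= 1, with
   Psi(1, z) = z, such that phi_{s,t}(z) = x Psi(x, z) with x = e^(s - t) solves an autonomous
   Loewner equation. *)

(** Every estimate on holomorphic functions comes from the maximum modulus principle on a disc, in a
    form that tolerates isolated points where the function is merely continuous. Divided differences
    are of this kind, so orders of vanishing are exploited by dividing and comparing on a circle.
    The Loewner equation holds only for almost every t. A mean value inequality for absolutely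
    continuous paths replaces integration: a bound k e^-t on the derivative limits the whole
    displacement to k. Two replacements cost O(r^3): phi by e^-t z, since h + id has Lipschitz
    constant O(s) on the ball of radius s, and f_1 - z_1 by its terms of degree 2. The exponents in
    a multiindex of degree 2 lie in {0, 1, 2}, so residues modulo 3 separate them; this is why cube
    roots of unity suffice. For an extremal map f, the family is Psi(x, z) = f^-1(x f(z)) / x,
    simplified so that it makes sense at x = 0, where it equals f. The flow is then f^-1(e^(s - t)
    f(z)), generated by G = - (Df)^-1 f. *)

Section RealNorm.
Context {R : realType}.
Local Notation C := R[i].

(** The norm takes its values in [R[i]]; its real part lies in the ordered field [R], where [lra],
    [nra] and suprema apply. *)
Definition rnorm {V : normedModType C} (v : V) : R := complex.Re `|v|.

Section NormedModule.
Context {V : normedModType C}.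
Implicit Types (u v w : V) (r : R).

Lemma normE v : `|v| = (rnorm v)%:C.
Proof.
have := normr_ge0 v; rewrite /rnorm; case: (`|v|) => a b.
by rewrite lecE /= => /andP[/eqP -> _].
Qed.

Lemma rnorm_ge0 v : 0 <= rnorm v.
Proof. by rewrite -lecR -normE normr_ge0. Qed.

Lemma normlt v r : (`|v| < r%:C) = (rnorm v < r).
Proof. by rewrite normE ltcR. Qed.

Lemma normle v r : (`|v| <= r%:C) = (rnorm v <= r).
Proof. by rewrite normE lecR. Qed.

Lemma rnorm0 : rnorm (0 : V) = 0.
Proof. by apply: complexI; rewrite -normE normr0. Qed.

Lemma rnorm_eq0 v : (rnorm v == 0) = (v == 0).
Proof. by rewrite -[RHS]normr_eq0 normE -(rmorph0 (real_complex R)) (inj_eq (@complexI R)). Qed.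

Lemma rnorm_gt0 v : (0 < rnorm v) = (v != 0).
Proof. by rewrite lt_neqAle rnorm_ge0 andbT eq_sym rnorm_eq0. Qed.

Lemma rnormN v : rnorm (- v) = rnorm v.
Proof. by rewrite /rnorm normrN. Qed.

Lemma rnormD u v : rnorm (u + v) <= rnorm u + rnorm v.
Proof. by rewrite -lecR rmorphD /= -!normE ler_normD. Qed.

Lemma rnormB u v : rnorm (u - v) <= rnorm u + rnorm v.
Proof. by rewrite -[rnorm v]rnormN rnormD. Qed.

Lemma rdistC u v : rnorm (u - v) = rnorm (v - u).
Proof. by rewrite -rnormN opprB. Qed.

Lemma rdistD w u v : rnorm (u - v) <= rnorm (u - w) + rnorm (w - v).
Proof. by rewrite (le_trans _ (rnormD _ _))// addrA subrK. Qed.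

Lemma rnormZ (a : C) v : rnorm (a *: v) = rnorm a * rnorm v.
Proof. by apply: complexI; rewrite rmorphM /= -!normE normrZ. Qed.

Lemma rnorm_sum (I : Type) (s : seq I) (P : pred I) (F : I -> V) :
  rnorm (\sum_(i <- s | P i) F i) <= \sum_(i <- s | P i) rnorm (F i).
Proof.
elim/big_ind2: _ => //; first by rewrite rnorm0.
by move=> x1 x2 y1 y2 h1 h2; rewrite (le_trans (rnormD _ _)) ?lerD.
Qed.

Lemma rnbhsP v (P : set V) :
  nbhs v P <-> exists2 d : R, 0 < d & forall w, rnorm (w - v) < d -> P w.
Proof.
split=> [/nbhs_normP[d /= d0 hd]|[d d0 hd]].
  have dE : d = (complex.Re d)%:C.
    by move: d0; case: (d) => a b; rewrite ltcE /= => /andP[/eqP -> _].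
  exists (complex.Re d); first by rewrite -ltcR -dE.
  by move=> w hw; apply: hd => /=; rewrite distrC dE normlt.
apply/nbhs_normP; exists d%:C; first by rewrite /= ltcR.
by move=> w /=; rewrite distrC normlt; apply: hd.
Qed.

End NormedModule.

Implicit Types x y : C.

Lemma rnorm_normc x : rnorm x = ComplexField.Normc.normc x.
Proof. by []. Qed.

Lemma rnormM x y : rnorm (x * y) = rnorm x * rnorm y.
Proof. by rewrite !rnorm_normc ComplexField.Normc.normcM. Qed.

Lemma rnorm1 : rnorm (1 : C) = 1.
Proof. by rewrite rnorm_normc ComplexField.Normc.normc1. Qed.

Lemma rnormV x : rnorm x^-1 = (rnorm x)^-1.
Proof. by rewrite !rnorm_normc ComplexField.Normc.normcV. Qed.

Lemma rnormf_div x y : rnorm (x / y) = rnorm x / rnorm y.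
Proof. by rewrite rnormM rnormV. Qed.

Lemma rnormX x n : rnorm (x ^+ n) = rnorm x ^+ n.
Proof. by elim: n => [|n ih]; rewrite ?expr0 ?rnorm1// !exprS rnormM ih. Qed.

Lemma rnormC (r : R) : rnorm (r%:C : C) = `|r|.
Proof. by rewrite rnorm_normc /= expr0n addr0 sqrtr_sqr. Qed.

Lemma rnorm_sqr x : rnorm x ^+ 2 = complex.Re x ^+ 2 + complex.Im x ^+ 2.
Proof. by rewrite rnorm_normc; case: x => a b /=; rewrite sqr_sqrtr// addr_ge0 ?sqr_ge0. Qed.

Lemma Re_le_rnorm x : `|complex.Re x| <= rnorm x.
Proof.
rewrite -(@ler_pXn2r _ 2) ?nnegrE ?rnorm_ge0// rnorm_sqr real_normK ?num_real//.
by rewrite lerDl sqr_ge0.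
Qed.

Lemma Im_le_rnorm x : `|complex.Im x| <= rnorm x.
Proof.
rewrite -(@ler_pXn2r _ 2) ?nnegrE ?rnorm_ge0// rnorm_sqr real_normK ?num_real//.
by rewrite lerDr sqr_ge0.
Qed.

Lemma rnorm_le_ReIm x : rnorm x <= `|complex.Re x| + `|complex.Im x|.
Proof.
rewrite -(@ler_pXn2r _ 2) ?nnegrE ?rnorm_ge0// ?addr_ge0// rnorm_sqr.
rewrite -(real_normK (num_real (complex.Re x))) -(real_normK (num_real (complex.Im x))).
have := normr_ge0 (complex.Re x); have := normr_ge0 (complex.Im x).
nra.
Qed.

Lemma ReD x y : complex.Re (x + y) = complex.Re x + complex.Re y.
Proof. by case: x y => a b []. Qed.
Lemma ImD x y : complex.Im (x + y) = complex.Im x + complex.Im y.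
Proof. by case: x y => a b []. Qed.
Lemma ReN x : complex.Re (- x) = - complex.Re x.
Proof. by case: x. Qed.
Lemma ImN x : complex.Im (- x) = - complex.Im x.
Proof. by case: x. Qed.
Lemma ReM x y : complex.Re (x * y) = complex.Re x * complex.Re y - complex.Im x * complex.Im y.
Proof. by case: x y => a b []. Qed.
Lemma ImM x y : complex.Im (x * y) = complex.Re x * complex.Im y + complex.Im x * complex.Re y.
Proof. by case: x y => a b []. Qed.

End RealNorm.

Section Epsilon.
Context {R : realType}.
Local Notation C := R[i].

Lemma continuous_rnormP (V W : normedModType C) (g : V -> W) (z : V) :
  {for z, continuous g} <->
  forall e : R, 0 < e -> exists2 d : R, 0 < d &
    forall w, rnorm (w - z) < d -> rnorm (g w - g z) < e.
Proof.
split=> [gz e e0|h].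
  have : nbhs (g z) [set w | rnorm (w - g z) < e] by apply/rnbhsP; exists e.
  by move/gz => /rnbhsP[d d0 hd]; exists d.
move=> A /= /rnbhsP[e e0 he].
have [d d0 hd] := h e e0.
by apply/rnbhsP; exists d => // w /hd /he.
Qed.

Lemma diff_rnorm (V W : normedModType C) (g : V -> W) (z : V) :
  differentiable g z -> forall e : R, 0 < e -> exists2 d : R, 0 < d &
    forall w, rnorm (w - z) < d ->
      rnorm (g w - g z - 'd g z (w - z)) <= e * rnorm (w - z).
Proof.
move=> h e e0; have := diff_locally h => /eqaddoP.
have e1 : 0 < e%:C by rewrite ltcR.
move=> /(_ _ e1) /rnbhsP[d d0 hd]; exists d => // w hw.
have := hd (w - z); rewrite subr0 => /(_ hw) /=.
by rewrite !fctE /= subrK !normE -rmorphM /= lecR opprD addrA.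
Qed.

End Epsilon.

(** * Goursat's theorem and the maximum principle *)

Lemma itv_dist (R : realDomainType) (a s x x' : R) : a <= x <= a + s -> a <= x' <= a + s ->
  `|x' - x| <= s.
Proof. by move=> /andP[? ?] /andP[? ?]; rewrite ler_norml; apply/andP; split; lra. Qed.

Section Goursat.
Context {R : realType}.
Implicit Types (F f : R -> R).

(** Integrals along the sides of a rectangle are represented by increments of primitives: additivity
    is then telescoping, and bounds come from the mean value theorem. *)
Definition primitive_on (M : R) F f :=
  forall x, - M < x < M -> is_derive x (1 : R) F (f x).

Lemma primitive_exists f (M : R) : continuous f -> exists F, primitive_on M F f.
Proof.
move=> cf; pose F x := (\int[lebesgue_measure]_(t in `[(- M - 1)%R, x]) f t)%R.
exists F => x /andP[x1 x2].
have xu : x < x + 1 by rewrite ltrDl.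
have int : lebesgue_measure.-integrable `[(- M - 1)%R, (x + 1)%R] (EFin \o f).
  apply: continuous_compact_integrable; first exact: segment_compact.
  exact: continuous_subspaceT.
have ax : - M - 1 < x by lra.
have [d1 d2] := continuous_FTC1_closed xu int ax (cf x).
by split; [exact: d1 | rewrite -derive1E d2].
Qed.

Lemma primitive_increment (M a b k e : R) F f : primitive_on M F f ->
  - M < a -> a <= b -> b < M -> (forall x, a <= x <= b -> `|f x - k| <= e) ->
  `|F b - F a - k * (b - a)| <= e * (b - a).
Proof.
move=> PF Ma ab bM fk.
have dF x : x \in `[a, b] -> is_derive x 1 F (f x).
  by rewrite in_itv /= => /andP[? ?]; apply: PF; lra.
have [|c] := @MVT_segment R F f a b ab (fun x hx => dF x (subset_itv_oo_cc hx)).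
  by apply: derivable_within_continuous => x /dF [].
rewrite in_itv /= => cab ->; rewrite -mulrBl normrM (ger0_norm (_ : 0 <= b - a)) ?subr_ge0//.
by rewrite ler_wpM2r ?subr_ge0// fk.
Qed.

Lemma primitiveB (M : R) F1 F2 f1 f2 : primitive_on M F1 f1 -> primitive_on M F2 f2 ->
  primitive_on M (F1 \- F2) (f1 \- f2).
Proof. by move=> h1 h2 x hx; have ? := h1 _ hx; have ? := h2 _ hx; apply: is_deriveB. Qed.

Section Rectangle.
Variables (M : R) (U V PU PV : R -> R -> R).
Hypothesis PUP : forall x, primitive_on M (PU x) (U x).
Hypothesis PVP : forall y, primitive_on M (PV y) (V ^~ y).

(* The integral of V dx + U dy around [a, a + s] x [c, c + t]. *)
Let I (a c s t : R) :=
  (PV c (a + s) - PV c a) - (PV (c + t) (a + s) - PV (c + t) a)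
  + ((PU (a + s) (c + t) - PU (a + s) c) - (PU a (c + t) - PU a c)).

(** Complex differentiability of f = U + iV at x + iy, with derivative A + iB. The form V dx + U dy
    is the imaginary part of f dz. *)
Definition cauchy_riemann_at (x y : R) := exists A B : R, forall e : R, 0 < e ->
  exists2 d : R, 0 < d & forall x' y' : R, `|x' - x| < d -> `|y' - y| < d ->
    `|U x' y' - U x y - A * (x' - x) + B * (y' - y)| <= e * (`|x' - x| + `|y' - y|) /\
    `|V x' y' - V x y - B * (x' - x) - A * (y' - y)| <= e * (`|x' - x| + `|y' - y|).

(** The affine parts of U and V contribute - A s t along the horizontal sides and A s t along the
    vertical ones, which cancel. The remainders are at most e (s + t) on each of the four sides. *)
Lemma goursat_local (x y e : R) : cauchy_riemann_at x y -> 0 < e ->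
  exists2 d : R, 0 < d & forall a c s t : R, a <= x <= a + s -> c <= y <= c + t ->
    - M < a -> a + s < M -> - M < c -> c + t < M ->
    s < d -> t < d -> `|I a c s t| <= 2 * e * (s + t) ^+ 2.
Proof.
move=> [A [B AB]] e0; have [d d0 hd] := AB e e0; exists d => //.
move=> a c s t /andP[ax xs] /andP[cy yt] Ma asM Mc ctM sd td.
have near1 x' y' : a <= x' <= a + s -> c <= y' <= c + t ->
    `|U x' y' - U x y - A * (x' - x) + B * (y' - y)| <= e * (s + t) /\
    `|V x' y' - V x y - B * (x' - x) - A * (y' - y)| <= e * (s + t).
  move=> /andP[h1 h2] /andP[h3 h4].
  have k1 : `|x' - x| <= s by apply: (@itv_dist _ a); apply/andP.
  have k2 : `|y' - y| <= t by apply: (@itv_dist _ c); apply/andP.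
  have [j1 j2] := hd x' y' (le_lt_trans k1 sd) (le_lt_trans k2 td).
  have : e * (`|x' - x| + `|y' - y|) <= e * (s + t) by rewrite ler_wpM2l ?lerD// ltW.
  by move=> /[dup] /(le_trans j1) ? /(le_trans j2).
have s0 : 0 <= s by rewrite -(lerDl a) (le_trans ax).
have t0 : 0 <= t by rewrite -(lerDl c) (le_trans cy).
have hc : c <= c <= c + t by rewrite lexx lerDl.
have hct : c <= c + t <= c + t by rewrite lexx lerDl t0.
have ha : a <= a <= a + s by rewrite lexx lerDl.
have has : a <= a + s <= a + s by rewrite lexx lerDl s0.
clear ax xs cy yt sd td.
have J1 : `|(PV c \- PV (c + t)) (a + s) - (PV c \- PV (c + t)) a - (- (A * t)) * (a + s - a)|
    <= 2 * e * (s + t) * (a + s - a).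
  apply: (primitive_increment (primitiveB (@PVP c) (@PVP (c + t)))) => //; first by rewrite lerDl.
  move=> x' hx' /=.
  have [_ +] := near1 x' c hx' hc; have [_ +] := near1 x' (c + t) hx' hct.
  rewrite !ler_norml => /andP[k1 k2] /andP[k3 k4]; clear -k1 k2 k3 k4; apply/andP; split; lra.
have J2 : `|(PU (a + s) \- PU a) (c + t) - (PU (a + s) \- PU a) c - A * s * (c + t - c)|
    <= 2 * e * (s + t) * (c + t - c).
  apply: (primitive_increment (primitiveB (@PUP (a + s)) (@PUP a))) => //; first by rewrite lerDl.
  move=> y' hy' /=.
  have [+ _] := near1 a y' ha hy'; have [+ _] := near1 (a + s) y' has hy'.
  rewrite !ler_norml => /andP[k1 k2] /andP[k3 k4]; clear -k1 k2 k3 k4; apply/andP; split; lra.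
have -> : I a c s t =
  ((PV c \- PV (c + t)) (a + s) - (PV c \- PV (c + t)) a - (- (A * t)) * (a + s - a))
  + ((PU (a + s) \- PU a) (c + t) - (PU (a + s) \- PU a) c - A * s * (c + t - c)).
  by rewrite /I /=; ring.
apply: (le_trans (ler_normD _ _)); apply: (le_trans (lerD J1 J2)).
by rewrite le_eqVlt; apply/orP; left; apply/eqP; ring.
Qed.

(** The integral is the sum of those over the four quarters, so one quarter carries at least a
    fourth of its modulus. The alternatives [s < 0] and [t < 0] let the statement hold for sides of
    any sign. *)
Lemma goursat_step (a c s t : R) : exists ac : R * R,
  [/\ (a <= ac.1 <= a + s / 2) || (s < 0), (c <= ac.2 <= c + t / 2) || (t < 0) &
      `|I a c s t| <= 4 * `|I ac.1 ac.2 (s / 2) (t / 2)|].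
Proof.
have IE : I a c s t = I a c (s / 2) (t / 2) + I (a + s / 2) c (s / 2) (t / 2)
    + I a (c + t / 2) (s / 2) (t / 2) + I (a + s / 2) (c + t / 2) (s / 2) (t / 2).
  have es : a + s / 2 + s / 2 = a + s by field.
  have et : c + t / 2 + t / 2 = c + t by field.
  by rewrite /I es et; ring.
have sides (u v : R) : (u <= u <= u + v / 2) || (v < 0) /\
    (u <= u + v / 2 <= u + v / 2) || (v < 0).
  by have [v0|v0] := ltP v 0; rewrite ?orbT// !orbF; split; apply/andP; split; lra.
have [sa1 sa2] := sides a s; have [sc1 sc2] := sides c t.
have : `|I a c s t| <= `|I a c (s / 2) (t / 2)| + `|I (a + s / 2) c (s / 2) (t / 2)|
   + `|I a (c + t / 2) (s / 2) (t / 2)| + `|I (a + s / 2) (c + t / 2) (s / 2) (t / 2)|.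
  by rewrite IE !(le_trans (ler_normD _ _))// lerD2r !(le_trans (ler_normD _ _))// lerD2r ler_normD.
set T := `|I a c s t|; set x1 := `|_|; set x2 := `|_|; set x3 := `|_|; set x4 := `|_| => h.
have [h1|h1] := leP T (4 * x1); first by exists (a, c).
have [h2|h2] := leP T (4 * x2); first by exists (a + s / 2, c).
have [h3|h3] := leP T (4 * x3); first by exists (a, c + t / 2).
exists (a + s / 2, c + t / 2); split=> //=; rewrite -/x4 -/T; lra.
Qed.

(** The intervals [u k, u k + s / 2^k] are nested, and the supremum of their left ends lies in all
    of them. *)
Lemma dyadic_nested (u : nat -> R) (s : R) : 0 <= s ->
  (forall k, u k <= u k.+1 <= u k + s / 2 ^+ k.+1) ->
  exists x, forall k, u k <= x <= u k + s / 2 ^+ k.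
Proof.
move=> s0 hu.
have mono k m : u k <= u (k + m)%N.
  elim: m => [|m ih]; rewrite ?addn0// addnS (le_trans ih)//.
  by have /andP[] := hu (k + m)%N.
have ub k m : u (k + m)%N <= u k + s / 2 ^+ k - s / 2 ^+ (k + m).
  elim: m => [|m ih]; first by rewrite addn0; lra.
  rewrite addnS; have /andP[_ h] := hu (k + m)%N; apply: (le_trans h).
  have e : s / 2 ^+ (k + m) = s / 2 ^+ (k + m).+1 + s / 2 ^+ (k + m).+1.
    by rewrite exprS; field; rewrite expf_neq0.
  by move: ih; rewrite {1}e; lra.
have ub' k m : u m <= u k + s / 2 ^+ k.
  have p j : 0 <= s / 2 ^+ j by rewrite divr_ge0// exprn_ge0.
  have [km|/ltnW mk] := leqP k m.
    by have := ub k (m - k)%N; rewrite subnKC//; have := p m; lra.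
  by have := mono m (k - m)%N; rewrite subnKC//; have := p k; lra.
have hs : has_sup (range u).
  split; first by exists (u 0%N); exists 0%N.
  by exists (u 0%N + s / 2 ^+ 0) => _ [m _ <-]; apply: ub'.
exists (sup (range u)) => k; apply/andP; split.
  by apply: (ub_le_sup hs.2); exists k.
by apply: (ge_sup hs.1) => _ [m _ <-]; apply: ub'.
Qed.

Lemma goursat (a b c d : R) : - M < a -> a <= b -> b < M -> - M < c -> c <= d -> d < M ->
  (forall x y, a <= x <= b -> c <= y <= d -> cauchy_riemann_at x y) ->
  (PV c b - PV c a) - (PV d b - PV d a) + ((PU b d - PU b c) - (PU a d - PU a c)) = 0.
Proof.
move=> Ma ab bM Mc cd dM CR; pose s := b - a; pose t := d - c.
have s0 : 0 <= s by rewrite subr_ge0.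
have t0 : 0 <= t by rewrite subr_ge0.
suff : I a c s t = 0 by rewrite /I /s /t !subrKC.
(* The bisection as a function of the current corner and level; iterating it gives the corners [q k]
   of the nested rectangles. *)
have /choice[g gP] : forall p : R * R * nat, exists ac : R * R,
  [/\ (p.1.1 <= ac.1 <= p.1.1 + s / 2 ^+ p.2.+1), (p.1.2 <= ac.2 <= p.1.2 + t / 2 ^+ p.2.+1) &
      `|I p.1.1 p.1.2 (s / 2 ^+ p.2) (t / 2 ^+ p.2)|
         <= 4 * `|I ac.1 ac.2 (s / 2 ^+ p.2.+1) (t / 2 ^+ p.2.+1)|].
  move=> [[a' c'] k] /=; have [ac] := goursat_step a' c' (s / 2 ^+ k) (t / 2 ^+ k).
  rewrite !(ltNge _ 0) !divr_ge0 ?exprn_ge0//= !orbF -!mulrA -!invfM -!exprSr => h.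
  by exists ac.
pose q := fix q k := if k is k'.+1 then g (q k', k') else (a, c).
have [x0 xP] : exists x, forall k, (q k).1 <= x <= (q k).1 + s / 2 ^+ k.
  by apply: (dyadic_nested (u := fun k => (q k).1)) => // k; have [] := gP (q k, k).
have [y0 yP] : exists x, forall k, (q k).2 <= x <= (q k).2 + t / 2 ^+ k.
  by apply: (dyadic_nested (u := fun k => (q k).2)) => // k; have [] := gP (q k, k).
have Ile k : `|I a c s t| <= 4 ^+ k * `|I (q k).1 (q k).2 (s / 2 ^+ k) (t / 2 ^+ k)|.
  elim: k => [|k ih]; first by rewrite !expr0 !divr1 mul1r.
  rewrite (le_trans ih)// exprSr -mulrA ler_wpM2l ?exprn_ge0//.
  by have [] := gP (q k, k).
have qin k : [/\ a <= (q k).1, (q k).1 + s / 2 ^+ k <= b, c <= (q k).2 & (q k).2 + t / 2 ^+ k <= d].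
  elim: k => [|k [h1 h2 h3 h4]]; first by rewrite !expr0 !divr1 /s /t !subrKC.
  have [/andP[g1 g2] /andP[g3 g4] _] := gP (q k, k); move: g1 g2 g3 g4; rewrite -/(q k.+1) /=.
  have es : s / 2 ^+ k = s / 2 ^+ k.+1 + s / 2 ^+ k.+1 by rewrite exprS; field; rewrite expf_neq0.
  have et : t / 2 ^+ k = t / 2 ^+ k.+1 + t / 2 ^+ k.+1 by rewrite exprS; field; rewrite expf_neq0.
  by move=> g1 g2 g3 g4; clear -g1 g2 g3 g4 h1 h2 h3 h4 es et; split; lra.
have x0ab : a <= x0 <= b.
  by have := xP 0%N; rewrite expr0 divr1 /= /s; lra.
have y0cd : c <= y0 <= d.
  by have := yP 0%N; rewrite expr0 divr1 /= /t; lra.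
apply/eqP; rewrite -normr_le0; apply/ler_addgt0Pr => e e0; rewrite add0r.
(* At level k the local estimate is 2 e' ((s + t) / 2^k)^2; multiplied by 4^k it becomes 2 e' (s +
   t)^2, which is at most e. *)
pose e' := e / (2 * (s + t) ^+ 2 + 1).
have D0 : 0 < 2 * (s + t) ^+ 2 + 1 by rewrite ltr_wpDl// mulr_ge0// sqr_ge0.
have e'0 : 0 < e' by rewrite divr_gt0.
have [del del0 loc] := goursat_local (CR _ _ x0ab y0cd) e'0.
have [k hk] : exists k : nat, (s + t) / 2 ^+ k < del.
  exists (Num.truncn ((s + t) / del)).+1.
  rewrite ltr_pdivrMr ?exprn_gt0// mulrC -ltr_pdivrMr//.
  apply: (lt_le_trans (truncnS_gt _)).
  by rewrite -natrX ler_nat ltnW// ltn_expl.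
have [q1 q2 q3 q4] := qin k.
have p0 : 0 < (2 : R) ^+ k by rewrite exprn_gt0.
have sk : 0 <= s / 2 ^+ k by rewrite divr_ge0// ltW.
have tk : 0 <= t / 2 ^+ k by rewrite divr_ge0// ltW.
rewrite mulrDl in hk.
have := loc (q k).1 (q k).2 (s / 2 ^+ k) (t / 2 ^+ k) (xP k) (yP k).
have hs1 : s / 2 ^+ k < del by lra.
have hs2 : t / 2 ^+ k < del by lra.
move=> /(_ (lt_le_trans Ma q1) (le_lt_trans q2 bM) (lt_le_trans Mc q3) (le_lt_trans q4 dM) hs1 hs2) h.
apply: (le_trans (Ile k)); rewrite (_ : 4 = 2 ^+ 2); last by ring.
rewrite -exprM mulnC exprM.
apply: (@le_trans _ _ ((2 ^+ k) ^+ 2 * (2 * e' * (s / 2 ^+ k + t / 2 ^+ k) ^+ 2))).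
  by rewrite ler_wpM2l// exprn_ge0// ltW.
rewrite -mulrDl expr_div_n.
have -> : (2 ^+ k) ^+ 2 * (2 * e' * ((s + t) ^+ 2 / (2 ^+ k) ^+ 2)) = e * (2 * (s + t) ^+ 2 / (2 * (s + t) ^+ 2 + 1)).
  by rewrite /e'; field; rewrite (gt_eqF p0) (gt_eqF D0).
by rewrite ler_piMr ?ltW// ltr_pdivrMr// mul1r ltrDl.
Qed.

End Rectangle.
End Goursat.

(** * Real scalars and rules of complex differentiation *)

Section RealScalars.
Context {R : realType}.
Local Notation C := R[i].
Implicit Types a b : R.

Lemma realcD a b : (a + b)%:C = a%:C + b%:C :> C. Proof. exact: rmorphD. Qed.
Lemma realcN a : (- a)%:C = - a%:C :> C. Proof. exact: rmorphN. Qed.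
Lemma realcB a b : (a - b)%:C = a%:C - b%:C :> C. Proof. exact: rmorphB. Qed.
Lemma realcM a b : (a * b)%:C = a%:C * b%:C :> C. Proof. exact: rmorphM. Qed.
Lemma realcV a : (a^-1)%:C = (a%:C)^-1 :> C. Proof. exact: fmorphV. Qed.
Lemma realcX a n : (a ^+ n)%:C = a%:C ^+ n :> C. Proof. exact: rmorphXn. Qed.
Lemma realc0 : 0%:C = 0 :> C. Proof. by []. Qed.
Lemma realc1 : 1%:C = 1 :> C. Proof. by []. Qed.
Lemma realc_nat n : n%:R%:C = n%:R :> C. Proof. exact: rmorph_nat. Qed.

Lemma realc_eq0 a : (a%:C == 0 :> C) = (a == 0).
Proof. exact: (inj_eq (@complexI R) a 0). Qed.

End RealScalars.

(* The library rules, restated with eta-expanded functions so that they can be applied. *)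
Section Differentiability.
Context {R : realType} {V : normedModType R[i]}.
Local Notation C := R[i].
Implicit Types (f g : V -> C) (z : V).

Lemma diffc_cst (c : C) z : differentiable (fun _ : V => c) z.
Proof. exact: differentiable_cst. Qed.

Lemma diffc_add f g z : differentiable f z -> differentiable g z ->
  differentiable (fun w => f w + g w) z.
Proof. exact: differentiableD. Qed.

Lemma diffc_opp f z : differentiable f z -> differentiable (fun w => - f w) z.
Proof. exact: differentiableN. Qed.

Lemma diffc_sub f g z : differentiable f z -> differentiable g z ->
  differentiable (fun w => f w - g w) z.
Proof. exact: differentiableB. Qed.

Lemma diffc_mul f g z : differentiable f z -> differentiable g z ->
  differentiable (fun w => f w * g w) z.
Proof. exact: differentiableM. Qed.

Lemma diffc_exp f n z : differentiable f z -> differentiable (fun w => f w ^+ n) z.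
Proof.
move=> df; elim: n => [|n ih]; first exact: diffc_cst.
have -> : (fun w => f w ^+ n.+1) = (fun w => f w * f w ^+ n).
  by apply/funext => w; rewrite exprS.
exact: diffc_mul.
Qed.

Lemma diffc_inv f z : f z != 0 -> differentiable f z -> differentiable (fun w => (f w)^-1) z.
Proof. by move=> fz df; apply: differentiableV. Qed.

Lemma diffc_div f g z : g z != 0 -> differentiable f z -> differentiable g z ->
  differentiable (fun w => f w / g w) z.
Proof. by move=> gz df dg; exact: diffc_mul df (diffc_inv gz dg). Qed.

Lemma diffc_comp (W : normedModType C) (f : V -> W) (g : W -> C) z :
  differentiable f z -> differentiable g (f z) -> differentiable (fun w => g (f w)) z.
Proof. by move=> df dg; exact: (differentiable_comp df dg). Qed.

End Differentiability.

Lemma diffc_id {R : realType} (z : R[i]) : differentiable (fun w : R[i] => w) z.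
Proof. by apply: ex_diff; exact: is_diff_id. Qed.

(** * Polar coordinates and the complex exponential *)

Section ComplexPaths.
Context {R : realType}.
Local Notation C := R[i].
Implicit Types (z w : C).

Lemma is_derive_epsilon (f : R -> R) (x l : R) : is_derive x (1 : R) f l ->
  forall e : R, 0 < e -> exists2 d : R, 0 < d & forall h : R, `|h| < d ->
    `|f (x + h) - f x - l * h| <= e * `|h|.
Proof.
move=> fl e e0; have df : derivable f x 1 by case: fl.
have ddf : differentiable f x by apply/derivable1_diffP.
have := diff_locally ddf => /eqaddoP /(_ e e0).
rewrite deriv1E// derive1E (@derive_val _ _ _ _ _ _ _ fl) => /nbhs_normP[d /= d0 hd].
exists d => // h hh; have := hd h; rewrite /ball_ /= sub0r normrN => /(_ hh).
by rewrite !fctE /= [h + x]addrC opprD addrA [X in _ - X]mulrC.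
Qed.

Lemma rcontinuousP (f : R -> R) (x : R) :
  {for x, continuous f} <->
  forall e : R, 0 < e -> exists2 d : R, 0 < d & forall y, `|y - x| < d -> `|f y - f x| < e.
Proof.
split=> [fx e e0|h].
  move/cvgrPdist_lt : fx => /(_ e e0) /nbhs_normP[d /= d0 hd].
  by exists d => // y hy; rewrite distrC; apply: hd => /=; rewrite /ball_ /= distrC.
apply/cvgrPdist_lt => e e0; have [d d0 hd] := h e e0.
apply/nbhs_normP; exists d => // y; rewrite /ball_ /= distrC => /hd.
by rewrite distrC.
Qed.

Lemma Re_continuous : continuous (@complex.Re R : C -> R).
Proof.
move=> z A /= /nbhs_normP[e /= e0 he]; apply/rnbhsP; exists e => // w hw; apply: he.
by rewrite /ball_ /=; apply: le_lt_trans hw; rewrite distrC -ReN -ReD Re_le_rnorm.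
Qed.

Lemma Im_continuous : continuous (@complex.Im R : C -> R).
Proof.
move=> z A /= /nbhs_normP[e /= e0 he]; apply/rnbhsP; exists e => // w hw; apply: he.
by rewrite /ball_ /=; apply: le_lt_trans hw; rewrite distrC -ImN -ImD Im_le_rnorm.
Qed.

Lemma complex_cvg (T : Type) (F : set_system T) (FF : Filter F) (p q : T -> R) (a b : R) :
  p @ F --> a -> q @ F --> b -> (fun t => p t +i* q t : C) @ F --> (a +i* b : C).
Proof.
move=> /cvgrPdist_lt pa /cvgrPdist_lt qb A /= /rnbhsP[e e0 he].
have e2 : 0 < e / 2 by rewrite divr_gt0.
near=> t; apply: he; rewrite (le_lt_trans (rnorm_le_ReIm _))// (splitr e) ltrD//.
  by rewrite ReD ReN /= distrC; near: t; apply: pa.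
by rewrite ImD ImN /= distrC; near: t; apply: qb.
Unshelve. all: by end_near. Qed.

Definition cis (y : R) : C := cos y +i* sin y.
(** The exponential e^(x + iy) as a function of two real variables: for fixed x, it runs through the
    circle of radius e^x as y goes from 0 to 2 pi. *)
Definition cexp (x y : R) : C := (expR x)%:C * cis y.

Lemma rnorm_cis y : rnorm (cis y) = 1.
Proof. by rewrite rnorm_normc /= cos2Dsin2 sqrtr1. Qed.

Lemma rnorm_cexp (x y : R) : rnorm (cexp x y) = expR x.
Proof. by rewrite rnormM rnorm_cis mulr1 rnormC ger0_norm ?expR_ge0. Qed.

Lemma cexpD (x y h k : R) : cexp (x + h) (y + k) = cexp x y * cexp h k.
Proof.
rewrite /cexp expRD rmorphM /= mulrACA; congr (_ * _).
by rewrite /cis cosD sinD; apply/eqP; rewrite eq_complex /= [X in _ && (X == _)]addrC !eqxx.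
Qed.

Lemma cexp_continuous (a b : R -> R) (t : R) : {for t, continuous a} -> {for t, continuous b} ->
  {for t, continuous (fun t => cexp (a t) (b t))}.
Proof.
move=> ca cb.
have -> : (fun t => cexp (a t) (b t)) =
    (fun t => (expR (a t) * cos (b t)) +i* (expR (a t) * sin (b t))).
  by apply/funext => s; rewrite /cexp /cis; simpc.
have e1 : expR (a s) @[s --> t] --> expR (a t).
  by apply: (continuous_comp ca); exact: continuous_expR.
have e2 : cos (b s) @[s --> t] --> cos (b t).
  by apply: (continuous_comp cb); exact: continuous_cos.
have e3 : sin (b s) @[s --> t] --> sin (b t).
  by apply: (continuous_comp cb); exact: continuous_sin.
by apply: complex_cvg; apply: cvgM.
Qed.

Lemma cexp_expansion0 (e : R) : 0 < e -> exists2 d : R, 0 < d & forall h k : R, `|h| < d -> `|k| < d ->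
  rnorm (cexp h k - 1 - (h +i* k)) <= e * (`|h| + `|k|).
Proof.
(* The four error terms below add up to at most 5 e1 |k| + e1 |h|, whence the division by 5; the cap
   at 1 serves to bound exp h by 2. *)
move=> e0; pose e1 := Num.min (e / 5) 1.
have e10 : 0 < e1 by rewrite lt_min divr_gt0 ?ltr01.
have [d1 d10 H1] := is_derive_epsilon (is_derive_expR (0 : R)) e10.
have [d2 d20 H2] := is_derive_epsilon (is_derive_cos (0 : R)) e10.
have [d3 d30 H3] := is_derive_epsilon (is_derive_sin (0 : R)) e10.
exists (Num.min (Num.min d1 (Num.min d2 d3)) (e1 / 2)).
  by rewrite !lt_min d10 d20 d30 divr_gt0.
move=> h k; rewrite !lt_min => /andP[/and3P[h1 _ _] he] /andP[/and3P[_ k2 k3] ke].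
have := H1 h h1; have := H2 k k2; have := H3 k k3.
rewrite !add0r expR0 cos0 sin0 oppr0 mul0r !subr0 !addr0 !mul1r => S1 C1 X1.
have -> : cexp h k - 1 - (h +i* k) =
   (expR h * (cos k - 1) + (expR h - 1 - h)) +i* (expR h * (sin k - k) + (expR h - 1) * k).
  by rewrite /cexp /cis; simpc; apply/eqP; rewrite eq_complex /=; apply/andP; split; apply/eqP; ring.
apply: (le_trans (rnorm_le_ReIm _)) => /=.
have e1e : 5 * e1 <= e by rewrite mulrC -ler_pdivlMr// ge_min lexx.
have e11 : e1 <= 1 by rewrite ge_min lexx orbT.
have X2 : `|expR h - 1| <= e1.
  have -> : expR h - 1 = (expR h - 1 - h) + h by ring.
  have := ler_normD (expR h - 1 - h) h; have := normr_ge0 h; nra.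
have X3 : `|expR h| <= 2.
  have -> : expR h = (expR h - 1) + 1 by ring.
  by have := ler_normD (expR h - 1) 1; rewrite normr1; lra.
apply: (le_trans (lerD (ler_normD _ _) (ler_normD _ _))); rewrite !normrM.
have Y1 : `|expR h| * `|cos k - 1| <= 2 * (e1 * `|k|) by apply: ler_pM.
have Y2 : `|expR h| * `|sin k - k| <= 2 * (e1 * `|k|) by apply: ler_pM.
have Y3 : `|expR h - 1| * `|k| <= e1 * `|k| by rewrite ler_wpM2r.
have := normr_ge0 h; have := normr_ge0 k.
clear H1 H2 H3 S1 C1 X2 X3 h1 he k2 k3 ke.
nra.
Qed.

Lemma cexp_expansion (x y e : R) : 0 < e -> exists2 d : R, 0 < d & forall x' y' : R,
  `|x' - x| < d -> `|y' - y| < d ->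
  rnorm (cexp x' y' - cexp x y - cexp x y * ((x' - x) +i* (y' - y))) <= e * (`|x' - x| + `|y' - y|).
Proof.
move=> e0; have ex := expR_gt0 x.
have [d d0 hd] := cexp_expansion0 (divr_gt0 e0 ex).
exists d => // x' y' hx hy.
have -> : cexp x' y' = cexp x y * cexp (x' - x) (y' - y) by rewrite -cexpD !subrKC.
rewrite -{2}[cexp x y]mulr1 -!mulrBr rnormM rnorm_cexp.
have := hd _ _ hx hy; rewrite -(ler_pM2l ex); move=> /le_trans; apply.
by rewrite mulrA mulrCA divff ?gt_eqF// mulr1.
Qed.

Lemma diff_C (g : C -> C) z w : differentiable g z -> 'd g z w = 'd g z 1 * w.
Proof.
move=> _; have {1}-> : w = w *: (1 : C) by rewrite [RHS]mulr1.
by rewrite linearZ /= mulrC.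
Qed.

Lemma Re_cst_mul (a : R) z : complex.Re (a%:C * z) = a * complex.Re z.
Proof. by rewrite ReM /= mul0r subr0. Qed.

(** Chain rule for g(e^(x + iy)), whose derivative is g'(w) w at w = e^(x + iy). Cutting the
    abscissa off at X gives functions defined through values of g on a fixed disc only, so that they
    can be continuous on the whole plane; to the left of X nothing changes. *)
Lemma polar_cauchy_riemann (g : C -> C) (X x y : R) : x < X -> differentiable g (cexp x y) ->
  cauchy_riemann_at (fun x y => complex.Re (g (cexp (Num.min x X) y)))
    (fun x y => complex.Im (g (cexp (Num.min x X) y))) x y.
Proof.
move=> xX dg; pose c := 'd g (cexp x y) 1 * cexp x y.
exists (complex.Re c), (complex.Im c) => e e0.
pose K := rnorm (cexp x y) + 1; pose L := rnorm ('d g (cexp x y) 1).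
have K0 : 0 < K by rewrite ltr_wpDl// rnorm_ge0.
have L0 : 0 <= L by apply: rnorm_ge0.
have [d1 d10 H1] := diff_rnorm dg (divr_gt0 e0 (mulr_gt0 (ltr0n _ 2) K0)).
have L1' : 0 < L + 1 by lra.
have L1 : 0 < 2 * (L + 1) by rewrite mulr_gt0.
have [d2 d20 H2] := cexp_expansion x y (divr_gt0 e0 L1).
have [d3 d30 H3] := cexp_expansion x y ltr01.
exists (Num.min (Num.min d2 d3) (Num.min (X - x) (d1 / (2 * K)))).
  by rewrite !lt_min d20 d30 subr_gt0 xX divr_gt0// mulr_gt0.
move=> x' y'; rewrite !lt_min => /andP[/andP[hx2 hx3] /andP[hxX hx1]].
move=> /andP[/andP[hy2 hy3] /andP[_ hy1]].
have x'X : x' < X by move: hxX; rewrite ltr_norml => /andP[_]; rewrite ltrD2r.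
rewrite (min_idPl (ltW xX)) (min_idPl (ltW x'X)).
set h := x' - x in hx2 hx3 hx1 *; set k := y' - y in hy2 hy3 hy1 *.
pose D := cexp x' y' - cexp x y.
have D1 : rnorm D <= K * (`|h| + `|k|).
  have -> : D = (D - cexp x y * (h +i* k)) + cexp x y * (h +i* k) by rewrite subrK.
  apply: (le_trans (rnormD _ _)); rewrite mulrDl addrC mul1r.
  rewrite rnormM lerD ?ler_wpM2l ?rnorm_ge0//.
    by rewrite (le_trans (rnorm_le_ReIm _)).
  by have := H3 x' y' hx3 hy3; rewrite mul1r.
have D1' : rnorm D < d1.
  apply: (le_lt_trans D1); rewrite mulrC -ltr_pdivlMr//.
  move: hx1 hy1; rewrite invfM mulrCA mulrC => hx1 hy1; lra.
have G1 := H1 _ D1'.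
have G2 : rnorm (g (cexp x' y') - g (cexp x y) - c * (h +i* k)) <= e * (`|h| + `|k|).
  have -> : g (cexp x' y') - g (cexp x y) - c * (h +i* k) =
    (g (cexp x' y') - g (cexp x y) - 'd g (cexp x y) D) +
     'd g (cexp x y) 1 * (D - cexp x y * (h +i* k)).
    by rewrite [_ D]diff_C// /c; ring.
  apply: (le_trans (rnormD _ _)); rewrite rnormM -/L.
  have E1 := H2 x' y' hx2 hy2.
  have hk0 : 0 <= `|h| + `|k| by rewrite addr_ge0.
  have A1 : e / (2 * K) * rnorm D <= e / 2 * (`|h| + `|k|).
    have -> : e / 2 * (`|h| + `|k|) = e / (2 * K) * (K * (`|h| + `|k|)).
      by field; rewrite gt_eqF.
    by rewrite ler_wpM2l// divr_ge0 ?mulr_ge0 ?ltW.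
  have A2 : L * (e / (2 * (L + 1)) * (`|h| + `|k|)) <= e / 2 * (`|h| + `|k|).
    rewrite mulrA ler_wpM2r//.
    have -> : L * (e / (2 * (L + 1))) = (e / 2) * (L / (L + 1)) by field; rewrite (gt_eqF L1').
    by rewrite ler_piMr ?divr_ge0 ?(ltW e0)// ler_pdivrMr// mul1r lerDl.
  apply: (le_trans (lerD G1 (le_trans (ler_wpM2l L0 E1) A2))).
  apply: (le_trans (lerD A1 (lexx _))).
  by rewrite -mulrDl -splitr.
split; apply: le_trans G2.
  apply: le_trans (Re_le_rnorm _); rewrite !(ReD, ReN).
  have -> : complex.Re (c * (h +i* k)) = complex.Re c * h - complex.Im c * k by rewrite ReM.
  by rewrite opprD opprK addrA.
apply: le_trans (Im_le_rnorm _); rewrite !(ImD, ImN).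
have -> : complex.Im (c * (h +i* k)) = complex.Re c * k + complex.Im c * h by rewrite ImM.
by rewrite opprD [X in _ <= `|_ + X|]addrC addrA.
Qed.

End ComplexPaths.

Section Continuity.
Context {R : realType} {V : normedModType R[i]}.
Local Notation C := R[i].
Implicit Types (f g : V -> C) (z : V).

Lemma contc_cst (c : C) z : {for z, continuous (fun _ : V => c)}.
Proof. exact: cvg_cst. Qed.

Lemma contc_add f g z : {for z, continuous f} -> {for z, continuous g} ->
  {for z, continuous (fun w => f w + g w)}.
Proof. by move=> cf cg; exact: (cvgD cf cg). Qed.

Lemma contc_mul f g z : {for z, continuous f} -> {for z, continuous g} ->
  {for z, continuous (fun w => f w * g w)}.
Proof. by move=> cf cg; exact: (cvgM cf cg). Qed.

Lemma contc_exp f n z : {for z, continuous f} -> {for z, continuous (fun w => f w ^+ n)}.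
Proof.
move=> df; elim: n => [|n ih]; first exact: contc_cst.
have -> : (fun w => f w ^+ n.+1) = (fun w => f w * f w ^+ n).
  by apply/funext => w; rewrite exprS.
exact: (contc_mul df ih).
Qed.

Lemma contc_inv f z : f z != 0 -> {for z, continuous f} ->
  {for z, continuous (fun w => (f w)^-1)}.
Proof. by move=> fz cf; exact: (cvgV fz cf). Qed.

Lemma contc_diff f z : differentiable f z -> {for z, continuous f}.
Proof. exact: differentiable_continuous. Qed.

End Continuity.

(** * Means over circles and the maximum modulus principle *)

Section MaximumPrinciple.
Context {R : realType}.
Local Notation C := R[i].

Lemma primitive_mean (M a b : R) (F f : R -> R) : primitive_on M F f ->
  - M < a -> a <= b -> b < M ->
  exists2 c : R, a <= c <= b & F b - F a = f c * (b - a).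
Proof.
move=> PF Ma ab bM.
have dF x : x \in `[a, b] -> is_derive x 1 F (f x).
  rewrite in_itv /= => /andP[h1 h2]; apply: PF.
  by rewrite (lt_le_trans Ma h1) (le_lt_trans h2 bM).
have [|c] := @MVT_segment R F f a b ab (fun x hx => dF x (subset_itv_oo_cc hx)).
  by apply: derivable_within_continuous => x /dF [].
by rewrite in_itv /=; exists c.
Qed.

Lemma cexp_circle (g : C -> C) (d X x y : R) : x < X -> expR X < d ->
  (forall z : C, 0 < rnorm z < d -> differentiable g z) ->
  differentiable g (cexp x y).
Proof.
move=> xX Xd; apply; rewrite rnorm_cexp expR_gt0/=.
by apply: lt_trans Xd; rewrite ltr_expR.
Qed.

Lemma ReIm_polar_continuous (g : C -> C) (d X : R) : expR X < d ->
  (forall z : C, 0 < rnorm z < d -> differentiable g z) ->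
  (forall x, continuous (fun y => complex.Re (g (cexp (Num.min x X) y)))) /\
  (forall y, continuous (fun x => complex.Im (g (cexp (Num.min x X) y)))).
Proof.
move=> Xd dg.
have cg x y : {for cexp (Num.min x X) y, continuous g}.
  apply: differentiable_continuous; apply: dg; rewrite rnorm_cexp expR_gt0/=.
  by apply: le_lt_trans Xd; rewrite ler_expR ge_min lexx orbT.
split=> [x y|y x].
  have h : {for y, continuous (fun y => cexp (Num.min x X) y)}.
    by apply: cexp_continuous => //; exact: cst_continuous.
  have h2 := continuous_comp h (cg x y).
  exact: (continuous_comp h2 (@Re_continuous R _)).
have h : {for x, continuous (fun x => cexp (Num.min x X) y)}.
  apply: cexp_continuous; last exact: cst_continuous.
  by apply: continuous_min => //; exact: cst_continuous.
have h2 := continuous_comp h (cg x y).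
exact: (continuous_comp h2 (@Im_continuous R _)).
Qed.

(** Quantified over every f, so that choosing F yields a map on functions: equal functions then
    receive equal primitives, which is how opposite horizontal sides cancel. *)
Let primI (M : R) (f : R -> R) : exists F, continuous f -> primitive_on M F f.
Proof.
have [cf|cf] := pselect (continuous f); last by exists f => /cf.
by have [F PF] := primitive_exists M cf; exists F.
Qed.

Lemma pi2_gt0 : 0 < (pi *+ 2 : R).
Proof. by rewrite mulrn_wgt0// pi_gt0. Qed.

(* By Goursat on the rectangle [a, b] x [0, 2 pi] in the variable log z, where the
   horizontal sides cancel, the mean of Re g over a circle does not depend on its radius. *)
Lemma circle_means_eq (g : C -> C) (d X a b : R) : expR X < d ->
  (forall z : C, 0 < rnorm z < d -> differentiable g z) -> a <= b -> b < X ->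
  exists M P, [/\ pi *+ 2 < M, primitive_on M (P a) (fun y => complex.Re (g (cexp a y))),
     primitive_on M (P b) (fun y => complex.Re (g (cexp b y))) &
     P b (pi *+ 2) - P b 0 = P a (pi *+ 2) - P a 0].
Proof.
move=> Xd dg ab bX.
pose M : R := `|a| + `|b| + pi *+ 2 + 1.
have pi2 := pi2_gt0.
pose U x y := complex.Re (g (cexp (Num.min x X) y)).
pose V x y := complex.Im (g (cexp (Num.min x X) y)).
have [cU cV] := ReIm_polar_continuous Xd dg.
pose prim f := projT1 (cid (primI M f)).
have primP f : continuous f -> primitive_on M (prim f) f by rewrite /prim; case: cid.
pose PU x := prim (U x); pose PV y := prim (V ^~ y).
have PUP x : primitive_on M (PU x) (U x) by apply: primP; exact: cU.
have PVP y : primitive_on M (PV y) (V ^~ y) by apply: primP; exact: cV.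
have [na nb] : `|a| < M /\ `|b| < M.
  by rewrite /M; have := normr_ge0 a; have := normr_ge0 b; split; lra.
move: na nb; rewrite !ltr_norml => /andP[a1 a2] /andP[b1 b2].
have M2 : pi *+ 2 < M by rewrite /M; have := normr_ge0 a; have := normr_ge0 b; lra.
have M0 : - M < 0 by rewrite oppr_lt0 (lt_trans pi2).
have CR x y : a <= x <= b -> 0 <= y <= pi *+ 2 -> cauchy_riemann_at U V x y.
  move=> /andP[_ xb] _; have xX := le_lt_trans xb bX.
  exact: (polar_cauchy_riemann xX (cexp_circle y xX Xd dg)).
have := goursat PUP PVP a1 ab b2 M0 (ltW pi2) M2 CR.
have -> : PV 0 = PV (pi *+ 2).
  congr prim; apply/funext => x; rewrite /V; congr (complex.Im (g _)).
  by rewrite /cexp /cis cos2pi sin2pi cos0 sin0.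
rewrite subrr add0r => /eqP; rewrite subr_eq0 => /eqP E.
have UE x : x <= X -> U x = fun y => complex.Re (g (cexp x y)).
  by move=> xX; apply/funext => y; rewrite /U (min_idPl xX).
exists M, PU; split=> //; rewrite -?UE//; first exact: ltW (le_lt_trans ab bX).
exact: ltW.
Qed.

(** If Re g were smaller than m = Re g(0) at - r, it would be at most m - eta on an arc of
    half-width t around the angle pi, and the mean over that circle would be at most m - t eta / pi.
    By continuity at 0, means over small circles are at least m - t eta / (2 pi), and all means
    agree. The point - r is singled out because its angle pi is interior to [0, 2 pi]; other points
    are reached by rotation. *)
Lemma mean_max_principle (g : C -> C) (d : R) : {for 0, continuous g} ->
  (forall z : C, 0 < rnorm z < d -> differentiable g z) ->
  (forall z : C, rnorm z < d -> complex.Re (g z) <= complex.Re (g 0)) ->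
  forall r : R, 0 < r < d -> complex.Re (g (- r%:C)) = complex.Re (g 0).
Proof.
move=> cg dg gm r /andP[r0 rd]; set m := complex.Re (g 0).
apply/eqP; rewrite eq_le gm ?rnormN ?rnormC ?gtr0_norm//=.
rewrite leNgt; apply/negP => lt.
pose b := ln r; pose X := ln ((r + d) / 2).
have rd2 : r < (r + d) / 2 < d by rewrite -[X in X < _]divr1; apply/andP; split; lra.
have [rd3 rd4] := andP rd2.
have rd0 : 0 < (r + d) / 2 by apply: lt_trans rd3.
have bX : b < X by rewrite ltr_ln.
have Xd : expR X < d by rewrite lnK ?posrE.
have eb : expR b = r by rewrite lnK ?posrE.
have cpi : cexp b pi = - r%:C.
  rewrite /cexp eb /cis cospi sinpi (_ : -1 +i* 0 = -1) ?mulrN1//.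
  by apply/eqP; rewrite eq_complex /= oppr0 !eqxx.
pose eta := (m - complex.Re (g (- r%:C))) / 2.
have eta0 : 0 < eta by rewrite divr_gt0 ?subr_gt0.
have cUb : continuous (fun y => complex.Re (g (cexp b y))).
  have [cU _] := ReIm_polar_continuous Xd dg.
  by have := cU b; rewrite (min_idPl (ltW bX)).
have [t0 t00 ht0] := (rcontinuousP _ _).1 (cUb pi) eta eta0.
pose t := Num.min (t0 / 2) (pi / 2).
have pi0 := @pi_gt0 R; have pi2 := pi2_gt0.
have t_gt0 : 0 < t by rewrite lt_min !divr_gt0.
have t_lt : t < t0 by rewrite gt_min; apply/orP; left; lra.
have t_pi : t < pi by rewrite gt_min; apply/orP; right; lra.
have Ub y : pi - t <= y <= pi + t -> complex.Re (g (cexp b y)) <= m - eta.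
  move=> yt; have : `|y - pi| < t0 by apply: le_lt_trans t_lt; rewrite ler_distl.
  move/ht0; rewrite cpi ltr_norml => /andP[_]; rewrite /eta; lra.
have Um x y : x < X -> complex.Re (g (cexp x y)) <= m.
  by move=> xX; apply: gm; rewrite rnorm_cexp (lt_trans _ Xd)// ltr_expR.
(* Half of what the arc of half-width t takes away from the mean over the circle of radius r. *)
pose e := t * eta / (pi *+ 2).
have e0 : 0 < e by rewrite divr_gt0// mulr_gt0.
have [s s0 hs] := (continuous_rnormP _ _).1 cg e e0.
pose a := Num.min b (ln s - 1).
have ab : a <= b by rewrite ge_min lexx.
have ea : expR a < s.
  rewrite -[ltRHS]lnK ?posrE// ltr_expR gt_min; apply/orP; right.
  by rewrite ltrBlDr ltrDl.
have Ua y : m - e <= complex.Re (g (cexp a y)).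
  have : rnorm (cexp a y - 0) < s by rewrite subr0 rnorm_cexp.
  move/hs => /ltW /(le_trans (Re_le_rnorm _)); rewrite ReD ReN ler_norml => /andP[+ _].
  by rewrite /m; lra.
have [M [P [M2 Pa Pb E]]] := circle_means_eq Xd dg ab bX.
have M0 : - M < 0 by rewrite oppr_lt0 (lt_trans pi2).
have [ca _ Ea] := primitive_mean Pa M0 (ltW pi2) M2.
have q1 : 0 <= pi - t by rewrite subr_ge0 ltW.
have q2 : pi + t < M by apply: lt_trans M2; rewrite mulr2n ltrD2l.
have q3 : pi + t <= pi *+ 2 by rewrite mulr2n lerD2l ltW.
have q4 : pi - t <= pi + t by lra.
have [c1 _ E1] := primitive_mean Pb M0 q1 (le_lt_trans q4 q2).
have [c2 hc2 E2] := primitive_mean Pb (lt_le_trans M0 q1) q4 q2.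
have [c3 _ E3] := primitive_mean Pb (lt_le_trans M0 (le_trans q1 q4)) q3 M2.
have A := Ua ca.
have B1 := Um b c1 bX; have B3 := Um b c3 bX; have B2 := Ub c2 hc2.
have F1 : (m - e) * (pi *+ 2) <= P a (pi *+ 2) - P a 0.
  by rewrite Ea subr0 ler_wpM2r// ltW.
have F2 : P b (pi - t) - P b 0 <= m * (pi - t) by rewrite E1 subr0 ler_wpM2r.
have F3 : P b (pi + t) - P b (pi - t) <= (m - eta) * (2 * t).
  rewrite E2 (_ : pi + t - (pi - t) = 2 * t); last by ring.
  by rewrite ler_wpM2r// mulr_ge0// ltW.
have F4 : P b (pi *+ 2) - P b (pi + t) <= m * (pi - t).
  rewrite E3 (_ : pi *+ 2 - (pi + t) = pi - t); last by rewrite mulr2n; ring.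
  by rewrite ler_wpM2r.
have F5 : e * (pi *+ 2) = t * eta by rewrite /e divfK// gt_eqF.
have F6 : 0 < t * eta by rewrite mulr_gt0.
have : m * (pi *+ 2) - t * eta <= m * (pi *+ 2) - 2 * (t * eta).
  rewrite -{1}F5 -mulrBl (le_trans F1)// -E.
  have -> : P b (pi *+ 2) - P b 0 = (P b (pi *+ 2) - P b (pi + t)) + (P b (pi + t) - P b (pi - t)) + (P b (pi - t) - P b 0) by ring.
  apply: (le_trans (lerD (lerD F4 F3) F2)).
  by rewrite le_eqVlt; apply/orP; left; apply/eqP; rewrite mulr2n; ring.
by rewrite lerD2l lerN2 mulr2n mulrDl mul1r gerDl leNgt F6.
Qed.

(** Multiplying f by the conjugate of f z0 makes its value at the centre real and equal to |f z0|^2,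
    so the principle for real parts applies; the unit factor v turns the disc so that z corresponds
    to - r. *)
Lemma local_max_modulus (f : C -> C) (z0 : C) (d : R) : {for z0, continuous f} ->
  (forall z : C, 0 < rnorm (z - z0) < d -> differentiable f z) ->
  (forall z : C, rnorm (z - z0) < d -> rnorm (f z) <= rnorm (f z0)) ->
  forall z, rnorm (z - z0) < d -> rnorm (f z) = rnorm (f z0).
Proof.
move=> cf df fm z zd.
have [->//|zz0] := eqVneq z z0.
have r0 : 0 < rnorm (z - z0) by rewrite rnorm_gt0 subr_eq0.
set r := rnorm (z - z0) in r0 zd.
pose v : C := (z0 - z) / r%:C.
have rC0 : r%:C != 0 :> C by rewrite (inj_eq (@complexI R) r 0) gt_eqF.
have rv : rnorm v = 1 by rewrite rnormf_div rdistC rnormC gtr0_norm// divff// gt_eqF.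
have v0 : v != 0 by rewrite -rnorm_gt0 rv.
pose a := (f z0)^*; pose g (w : C) := a * f (v * w + z0).
have aE : a * f z0 = (rnorm (f z0) ^+ 2)%:C.
  by rewrite mulrC -sqr_normc normE rmorphXn.
have rw w : rnorm (v * w + z0 - z0) = rnorm w by rewrite addrK rnormM rv mul1r.
have dvw w : differentiable (fun w : C => v * w + z0) w.
  by apply: diffc_add; [apply: diffc_mul; [exact: diffc_cst | exact: diffc_id] | exact: diffc_cst].
have cg : {for 0, continuous g}.
  have ch : {for 0, continuous (fun w : C => v * w + z0)}.
    exact/differentiable_continuous.
  have cf' : {for (v * 0 + z0), continuous f} by (rewrite mulr0 add0r; exact: cf).
  have := continuous_comp ch cf' => ch'.
  by apply: contc_mul; [exact: contc_cst | exact: ch'].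
have g0 : g 0 = (rnorm (f z0) ^+ 2)%:C by rewrite /g mulr0 add0r aE.
have ra : rnorm a = rnorm (f z0) by rewrite /a; apply: complexI; rewrite -!normE normcJ.
have := mean_max_principle (g := g) (d := d) cg.
have : forall z : C, 0 < rnorm z < d -> differentiable g z.
  move=> w hw; apply: diffc_mul; first exact: diffc_cst.
  have dfw : differentiable f (v * w + z0) by apply: df; rewrite rw.
  exact: (diffc_comp (dvw w) dfw).
move=> /[swap] /[apply].
have : forall z : C, rnorm z < d -> complex.Re (g z) <= complex.Re (g 0).
  move=> w hw; rewrite g0 /=; apply: (le_trans (ler_norm _)).
  apply: (le_trans (Re_le_rnorm _)); rewrite /g rnormM ra expr2 ler_wpM2l ?rnorm_ge0//.
  by apply: fm; rewrite rw.
move=> /[swap] /[apply] /(_ r); rewrite r0 zd => /(_ isT).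
rewrite g0 /= /g (_ : v * - r%:C + z0 = z); last first.
  by rewrite /v mulrN divfK// opprB subrK.
move=> E; apply/eqP; rewrite eq_le fm//=.
have [->|f0] := eqVneq (f z0) 0; first by rewrite rnorm0 rnorm_ge0.
rewrite -(@ler_pM2l _ (rnorm (f z0))) ?rnorm_gt0// -expr2 -E -ra -rnormM.
exact: (le_trans (ler_norm _) (Re_le_rnorm _)).
Qed.

Lemma closed_disc_compact (r : R) : compact [set z : C | rnorm z <= r].
Proof.
pose D := [set z : C | rnorm z <= r].
pose S := (`[-r, r] `*` `[-r, r])%classic : set (R * R).
pose h (p : R * R) : C := p.1 +i* p.2.
have ch : continuous h.
  move=> p; apply: complex_cvg; [exact: cvg_fst|exact: cvg_snd].
have cS : compact S by apply: compact_setX; exact: segment_compact.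
have cI : compact (h @` S) by apply: continuous_compact => //; exact: continuous_subspaceT.
apply: (subclosed_compact _ cI).
  move=> z zc /=; rewrite leNgt; apply/negP => lt.
  have [] := zc [set w | rnorm (w - z) < rnorm z - r].
    by apply/rnbhsP; exists (rnorm z - r); rewrite ?subr_gt0.
  move=> w [/= h1 h2]; have := rdistD w z 0; rewrite !subr0 => h3.
  move: h2; rewrite rdistC ltrBrDr => h2.
  by have := lt_le_trans h2 h3; rewrite ltrD2l ltNge h1.
move=> z /= zr; exists (complex.Re z, complex.Im z); last by rewrite /h; case: (z).
by split=> /=; rewrite in_itv /= -ler_norml (le_trans _ zr) ?Re_le_rnorm ?Im_le_rnorm.
Qed.

Lemma rnorm_continuous : continuous (rnorm : C -> R).
Proof.
move=> w A /= /nbhs_normP[e /= e0 he]; apply/rnbhsP; exists e => // u hu; apply: he.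
rewrite /ball_ /=; apply: le_lt_trans hu; rewrite ler_norml.
have := rdistD u w 0; have := rdistD w u 0; rewrite !subr0 (rdistC w u).
by move=> h1 h2; apply/andP; split; lra.
Qed.

(* Isolated points of the disc at which f is merely continuous are allowed. *)
Lemma maximum_modulus (f : C -> C) (r M : R) :
  (forall z : C, rnorm z <= r -> {for z, continuous f}) ->
  (forall z0 : C, rnorm z0 < r -> exists2 d : R, 0 < d &
     forall z, 0 < rnorm (z - z0) < d -> differentiable f z) ->
  (forall z, rnorm z = r -> rnorm (f z) <= M) ->
  forall z, rnorm z <= r -> rnorm (f z) <= M.
Proof.
move=> cf df fM z zr; rewrite leNgt; apply/negP => Mf.
pose D := [set w : C | rnorm w <= r].
have cD : compact D := @closed_disc_compact r.
have cn := @rnorm_continuous.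
have cnf : {within D, continuous (fun w => rnorm (f w))}.
  apply: continuous_in_subspaceT => w; rewrite inE => Dw.
  exact: (continuous_comp (cf w Dw) (cn (f w))).
have D0 : D !=set0 by exists z.
have [z1 z1D z1max] : exists2 z1, z1 \in D & forall w, w \in D -> rnorm (f w) <= rnorm (f z1).
  by apply: compact_EVT_max.
have max_D w : D w -> rnorm (f w) <= rnorm (f z1) by move=> /mem_set; apply: z1max.
rewrite inE in z1D.
pose K := D `&` [set w | rnorm (f w) = rnorm (f z1)].
have cK : compact K.
  apply: (subclosed_compact _ cD); last by move=> w [].
  move=> w wc.
  have Dw : D w.
    by apply: (compact_closed _ cD) => //; move=> B /wc [u [[? ?] ?]]; exists u.
  split=> //=; apply/eqP; rewrite eq_le max_D//= leNgt; apply/negP => lt.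
  have [d d0 hd] := (continuous_rnormP _ _).1 (cf w Dw) (rnorm (f z1) - rnorm (f w)) ltac:(by rewrite subr_gt0).
  have [] := wc [set u | rnorm (u - w) < d]; first by apply/rnbhsP; exists d.
  move=> u [[_ /= h1] h2]; have := hd u h2; have := rdistD (f w) (f u) 0.
  by rewrite !subr0 h1 => h3; rewrite ltNge lerBlDr h3.
have K0 : K !=set0 by exists z1.
(* Among the points of maximal modulus of f, one farthest from the origin. If it were interior, the
   local principle would produce another one still farther out. *)
have [z2 + z2max] : exists2 z2, z2 \in K & forall w, w \in K -> rnorm w <= rnorm z2.
  apply: compact_EVT_max => //; apply: continuous_subspaceT => w; exact: cn.
rewrite inE => -[z2D /= z2f].
have [z2r|z2r] := eqVneq (rnorm z2) r.
  by have := max_D _ zr; rewrite -z2f leNgt (le_lt_trans (fM _ z2r) Mf).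
have {}z2r : rnorm z2 < r by rewrite lt_neqAle z2r.
have [d d0 hd] := df _ z2r.
pose d' := Num.min d (r - rnorm z2).
have d'0 : 0 < d' by rewrite lt_min d0 subr_gt0.
have inD w : rnorm (w - z2) < d' -> D w.
  rewrite lt_min => /andP[_ h]; have := rdistD z2 w 0; rewrite !subr0 /D /= => h2; lra.
have h1 w : 0 < rnorm (w - z2) < d' -> differentiable f w.
  by move=> /andP[w0]; rewrite lt_min => /andP[wd _]; apply: hd; rewrite w0.
have h2 w : rnorm (w - z2) < d' -> rnorm (f w) <= rnorm (f z2).
  by move=> /inD /max_D; rewrite z2f.
have eqm := local_max_modulus (cf _ z2D) h1 h2.
pose u : C := if z2 == 0 then 1 else z2 / (rnorm z2)%:C.
have u1 : rnorm u = 1.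
  rewrite /u; case: eqP => [_|/eqP z20]; first exact: rnorm1.
  by rewrite rnormf_div rnormC ger0_norm ?rnorm_ge0// divff// rnorm_eq0.
pose w := z2 + (d' / 2)%:C * u.
have wz : rnorm (w - z2) = d' / 2.
  by rewrite /w addrC addKr rnormM u1 mulr1 rnormC gtr0_norm// divr_gt0.
have wd' : rnorm (w - z2) < d' by rewrite wz; lra.
have wK : K w by split; [exact: inD | rewrite /= eqm].
have := z2max w (mem_set wK).
have -> : rnorm w = rnorm z2 + d' / 2.
  rewrite /w /u; case: eqP => [->|/eqP z20].
    by rewrite rnorm0 !add0r mulr1 rnormC gtr0_norm// divr_gt0.
  have rz : (rnorm z2)%:C != 0 :> C by rewrite (inj_eq (@complexI R) _ 0) rnorm_eq0.
  have -> : z2 + (d' / 2)%:C * (z2 / (rnorm z2)%:C) = ((rnorm z2 + d' / 2) / rnorm z2)%:C * z2.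
    by rewrite realcM realcD realcV; field.
  rewrite rnormM rnormC ger0_norm ?divr_ge0 ?rnorm_ge0 ?addr_ge0 ?rnorm_ge0 ?divr_ge0 ?ltW//.
  by rewrite divfK// rnorm_eq0.
rewrite gerDl; lra.
Qed.

End MaximumPrinciple.

(** * Divided differences, Schwarz's lemma and Caratheodory's inequality *)

Section DividedDifferences.
Context {R : realType}.
Local Notation C := R[i].
Implicit Types (f g : C -> C) (z w : C).

Lemma rnorm1B_ge z : 1 - rnorm z <= rnorm (1 - z).
Proof.
have := rnormD (1 - z) z; rewrite subrK rnorm1; lra.
Qed.

Lemma rnorm1D_ge z : 1 - rnorm z <= rnorm (1 + z).
Proof. by have := rnorm1B_ge (- z); rewrite rnormN opprK. Qed.

Definition divdiff f z w : C := if w == z then 'd f z 1 else (f w - f z) / (w - z).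

Lemma divdiffE f z w : w != z -> divdiff f z w = (f w - f z) / (w - z).
Proof. by move=> /negbTE wz; rewrite /divdiff wz. Qed.

Lemma divdiff_continuous_at f z : differentiable f z -> {for z, continuous (divdiff f z)}.
Proof.
move=> df; apply/continuous_rnormP => e e0.
have e2 : 0 < e / 2 by rewrite divr_gt0.
have [d d0 hd] := diff_rnorm df e2.
exists d => // w wd; have [->|wz] := eqVneq w z; first by rewrite subrr rnorm0.
have wz' : w - z != 0 by rewrite subr_eq0.
rewrite divdiffE// /divdiff eqxx.
have -> : (f w - f z) / (w - z) - 'd f z 1 = (f w - f z - 'd f z (w - z)) / (w - z).
  by rewrite (diff_C (w - z) df); field.
rewrite rnormf_div ltr_pdivrMr ?rnorm_gt0//.
apply: (le_lt_trans (hd w wd)); rewrite ltr_pM2r ?rnorm_gt0//; lra.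
Qed.

Lemma near_neq z w : w != z -> \forall u \near w, u != z.
Proof.
move=> wz; apply/rnbhsP; exists (rnorm (w - z)); first by rewrite rnorm_gt0 subr_eq0.
by move=> u; apply: contraTneq => ->; rewrite rdistC ltxx.
Qed.

Lemma divdiff_diff f z w : w != z -> differentiable f w -> differentiable (divdiff f z) w.
Proof.
move=> wz df; apply/derivable1_diffP.
pose g u : C := (f u - f z) / (u - z).
have dg : derivable g w 1.
  apply/derivable1_diffP; apply: diffc_div; first by rewrite subr_eq0.
    by apply: diffc_sub => //; exact: diffc_cst.
  by apply: diffc_sub; [exact: diffc_id | exact: diffc_cst].
apply: (near_eq_derivable _ dg).
apply: filterS (near_neq wz) => u uz.
by rewrite divdiffE.
Qed.

Lemma contc_near f g z : (\forall u \near z, f u = g u) ->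
  {for z, continuous f} -> {for z, continuous g}.
Proof.
move=> fg cf; have fz := nbhs_singleton fg.
move=> A gA; rewrite -fz in gA; have fA := cf A gA.
by apply: filterS2 fg fA => u fu; rewrite /= fu.
Qed.

Lemma divdiff_continuous f z w : w != z -> {for w, continuous f} ->
  {for w, continuous (divdiff f z)}.
Proof.
move=> wz cf.
have cg : {for w, continuous (fun u : C => (f u - f z) / (u - z))}.
  apply: contc_mul; first by apply: contc_add; [exact: cf | exact: contc_cst].
  apply: contc_inv; first by rewrite subr_eq0.
  by apply: contc_add; [exact: contc_diff (diffc_id w) | exact: contc_cst].
apply: contc_near cg; apply: filterS (near_neq wz) => u uz.
by rewrite divdiffE.
Qed.

Lemma avoid_seq (s : seq C) z0 : exists2 d : R, 0 < d &
  forall w, 0 < rnorm (w - z0) < d -> w \notin s.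
Proof.
elim: s => [|a s [d d0 hd]]; first by exists 1.
have [az|az] := eqVneq a z0.
  exists d => // w /[dup] h /hd ws; rewrite inE negb_or ws andbT az.
  by move: h => /andP[]; rewrite rnorm_gt0 subr_eq0.
exists (Num.min d (rnorm (a - z0))); first by rewrite lt_min d0 rnorm_gt0 subr_eq0.
move=> w /andP[w0]; rewrite lt_min => /andP[wd wa]; rewrite inE negb_or hd ?w0// andbT.
by apply: contraTneq wa => ->; rewrite ltxx.
Qed.

Lemma maximum_modulus_seq (s : seq C) f (r M : R) :
  (forall z : C, rnorm z <= r -> {for z, continuous f}) ->
  (forall z : C, rnorm z < r -> z \notin s -> differentiable f z) ->
  (forall z, rnorm z = r -> rnorm (f z) <= M) ->
  forall z, rnorm z <= r -> rnorm (f z) <= M.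
Proof.
move=> cf df; apply: maximum_modulus => // z0 z0r.
have [d d0 hd] := avoid_seq s z0.
exists (Num.min d (r - rnorm z0)); first by rewrite lt_min d0 subr_gt0.
move=> z /andP[zz0]; rewrite lt_min => /andP[zd zr]; apply: df; last by apply: hd; rewrite zz0.
have h := rdistD z0 z 0; rewrite !subr0 in h; rewrite ltrBrDr in zr.
exact: le_lt_trans h zr.
Qed.

Lemma disc_bounded f (r : R) : (forall z : C, rnorm z <= r -> {for z, continuous f}) ->
  exists2 B : R, 0 <= B & forall z, rnorm z <= r -> rnorm (f z) <= B.
Proof.
move=> cf; have cD := @closed_disc_compact R r.
have [rlt0|r0] := ltP r 0.
  by exists 0 => // z zr; have := lt_le_trans (le_lt_trans zr rlt0) (rnorm_ge0 z); rewrite ltxx.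
have [||z1 _ z1max] := @compact_EVT_max _ _ (fun w => rnorm (f w)) _ _ cD.
- by exists 0; rewrite /= rnorm0.
- apply: continuous_in_subspaceT => w; rewrite inE => Dw.
  exact: (continuous_comp (cf w Dw) (@rnorm_continuous R (f w))).
by exists (rnorm (f z1)); [exact: rnorm_ge0 | move=> z zr; apply: z1max; rewrite inE].
Qed.

(** With k the divided difference of f at 0, the maximum principle is applied to w |-> (k w - k z) /
    (w - z) and read off at w = 0. The base point is z because k is only known to be continuous at
    0, which is not enough to take a divided difference there. *)
Lemma holomorphic_remainder2 f (r : R) : 0 < r ->
  (forall z : C, rnorm z < r -> differentiable f z) ->
  exists B d : R, 0 < d /\ forall z, rnorm z < d ->
    rnorm (f z - f 0 - 'd f 0 1 * z) <= B * rnorm z ^+ 2.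
Proof.
move=> r0 df; pose rho := r / 2; pose k := divdiff f 0.
have rho0 : 0 < rho by rewrite divr_gt0.
have rhor : rho < r by rewrite /rho; lra.
have ck z : rnorm z <= rho -> {for z, continuous k}.
  move=> zr; have dz := df z (le_lt_trans zr rhor).
  have [->|z0] := eqVneq z 0.
    by apply: divdiff_continuous_at; apply: df; rewrite rnorm0.
  exact: (divdiff_continuous z0 (contc_diff dz)).
have dk z : rnorm z < rho -> z != 0 -> differentiable k z.
  by move=> zr z0; apply: divdiff_diff => //; apply: df; apply: lt_trans rhor.
have [B B0 hB] := disc_bounded ck.
exists (2 * B / (rho / 2)), (rho / 2); split; first by rewrite divr_gt0.
move=> z zd; have zrho : rnorm z < rho by apply: lt_trans zd _; lra.
have [->|z0] := eqVneq z 0; first by rewrite subrr sub0r mulr0 oppr0 rnorm0 expr0n mulr0.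
have kz := dk z zrho z0.
have key : rnorm (divdiff k z 0) <= 2 * B / (rho / 2).
  apply: (@maximum_modulus_seq [:: 0; z] _ rho); last by rewrite rnorm0 ltW.
  - move=> w wr; have [->|wz] := eqVneq w z; first exact: divdiff_continuous_at.
    exact: (divdiff_continuous wz (ck w wr)).
  - move=> w wr; rewrite !inE negb_or => /andP[w0 wz].
    exact: divdiff_diff wz (dk w wr w0).
  - move=> w wr; have wz : w != z by apply: contra_eq_neq wr => ->; rewrite lt_eqF.
    rewrite divdiffE// rnormf_div.
    have d1 : rho / 2 <= rnorm (w - z).
      have := rdistD z w 0; rewrite !subr0 wr; rewrite /rho in zd *; lra.
    have d2 : rnorm (k w - k z) <= 2 * B.
      by rewrite (le_trans (rnormB _ _))// mulr2n mulrDl mul1r lerD// hB// ?wr// ltW.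
    by rewrite ler_pM// ?invr_ge0 ?rnorm_ge0// lef_pV2// posrE; lra.
move: key; rewrite divdiffE 1?eq_sym// sub0r rnormf_div rnormN ler_pdivrMr ?rnorm_gt0// => key.
have -> : f z - f 0 - 'd f 0 1 * z = z * (k z - k 0).
  by rewrite /k divdiffE// /divdiff eqxx subr0; field.
by rewrite rnormM rdistC mulrC expr2 mulrA ler_wpM2r// rnorm_ge0.
Qed.

(** The divided difference at 0 is estimated on the circle; the factor 2 appears since f - f 0 is at
    most 2 B there. *)
Lemma schwarz_bound f (r B : R) : 0 < r ->
  (forall z : C, rnorm z <= r -> differentiable f z) ->
  (forall z, rnorm z = r -> rnorm (f z) <= B) ->
  forall z, rnorm z <= r -> rnorm (f z - f 0) <= 2 * B / r * rnorm z.
Proof.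
move=> r0 df fB z zr.
have f0 : rnorm (f 0) <= B.
  have r0' : rnorm (0 : C) <= r by rewrite rnorm0 ltW.
  apply: (maximum_modulus_seq (s := [::]) _ _ fB r0').
    by move=> w /df; exact: contc_diff.
  by move=> w wr _; apply: df; exact: ltW.
have [->|z0] := eqVneq z 0; first by rewrite subrr rnorm0 mulr0.
have : rnorm (divdiff f 0 z) <= 2 * B / r.
  apply: (maximum_modulus_seq (s := [:: 0]) (r := r) _ _ _ zr).
  - move=> w wr; have [->|w0] := eqVneq w 0.
      by apply: divdiff_continuous_at; apply: df; rewrite rnorm0 ltW.
    exact: (divdiff_continuous w0 (contc_diff (df w wr))).
  - by move=> w wr; rewrite inE => w0; apply: divdiff_diff => //; apply: df; exact: ltW.
  - move=> w wr; have w0 : w != 0 by rewrite -rnorm_gt0 wr.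
    rewrite divdiffE// rnormf_div subr0 wr ler_pM2r ?invr_gt0//.
    by rewrite (le_trans (rnormB _ _))// mulr2n mulrDl mul1r lerD// fB.
by rewrite divdiffE// subr0 rnormf_div ler_pdivrMr ?rnorm_gt0.
Qed.

(* For a bounded isolated singularity at 0, the function z * f(z)^m is continuous at 0
   for every m; the maximum principle for it yields the claim as m tends to infinity. *)
Lemma maximum_modulus_bounded f (r d B M : R) : 0 < r -> 0 < d ->
  (forall z : C, 0 < rnorm z <= r -> differentiable f z) ->
  (forall z, 0 < rnorm z < d -> rnorm (f z) <= B) ->
  (forall z, rnorm z = r -> rnorm (f z) <= M) ->
  forall z, 0 < rnorm z <= r -> rnorm (f z) <= M.
Proof.
move=> r0 d0 df fB fM z /andP[z0 zr]; rewrite leNgt; apply/negP => Mz.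
have M0 : 0 <= M.
  by rewrite (le_trans (rnorm_ge0 (f r%:C)))// fM// rnormC gtr0_norm.
pose F m w : C := f w ^+ m * w.
have x0 := le_lt_trans M0 Mz.
have key m : rnorm (F m z) <= M ^+ m * r.
  apply: (maximum_modulus_seq (s := [:: 0]) (r := r) _ _ _ zr).
  - move=> w wr; have [->|w0] := eqVneq w 0; last first.
      have dw : differentiable f w by apply: df; rewrite rnorm_gt0 w0.
      by apply: contc_mul; [exact: contc_exp (contc_diff dw) | exact: contc_diff (diffc_id w)].
    apply/continuous_rnormP => e e0.
    pose B' := Num.max B 1.
    have B'0 : 0 < B' ^+ m by rewrite exprn_gt0// lt_max ltr01 orbT.
    exists (Num.min d (e / B' ^+ m)); first by rewrite lt_min d0 divr_gt0.
    move=> u; rewrite subr0 lt_min => /andP[ud ue]; rewrite /F mulr0 subr0.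
    have [->|u0] := eqVneq u 0; first by rewrite mulr0 rnorm0.
    rewrite -rnorm_gt0 in u0.
    rewrite rnormM rnormX; move: ue; rewrite ltr_pdivlMr// mulrC; apply: le_lt_trans.
    rewrite ler_wpM2r ?rnorm_ge0// lerXn2r ?nnegrE ?rnorm_ge0//.
      by rewrite le_max ler01 orbT.
    by rewrite le_max fB ?u0.
  - move=> w wr; rewrite inE => w0; rewrite -rnorm_gt0 in w0.
    apply: diffc_mul; last exact: diffc_id.
    by apply: diffc_exp; apply: df; rewrite w0 ltW.
  - move=> w wr; rewrite rnormM rnormX wr ler_wpM2r ?(ltW r0)// lerXn2r ?nnegrE ?rnorm_ge0//.
    exact: fM.
have q1 : `|M / rnorm (f z)| < 1.
  by rewrite ger0_norm ?divr_ge0 ?rnorm_ge0// ltr_pdivrMr ?mul1r.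
have := cvg_expr q1 => /cvgrPdist_lt /(_ (rnorm z / r) (divr_gt0 z0 r0)) [m _ /(_ m (leqnn m))] /=.
rewrite sub0r normrN ger0_norm ?exprn_ge0 ?divr_ge0 ?rnorm_ge0//.
rewrite expr_div_n ltr_pdivrMr ?exprn_gt0// mulrAC ltr_pdivlMr// ltNge => /negP; apply.
by have := key m; rewrite /F rnormM rnormX mulrC.
Qed.

(** On the circle, p takes values in a half-disc, which lies in the disc of centre N and radius
    sqrt(N^2 + B'^2). The maximum principle for N - p keeps p z in this disc. If x = Re (p z) < 0,
    this gives 2 N (- x) <= B'^2, which the choice of N contradicts. *)
Lemma Re_ge0_bounded p (r d B B' : R) : 0 < r -> 0 < d ->
  (forall z : C, 0 < rnorm z <= r -> differentiable p z) ->
  (forall z, 0 < rnorm z < d -> rnorm (p z) <= B) ->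
  (forall z, rnorm z = r -> rnorm (p z) <= B' /\ 0 <= complex.Re (p z)) ->
  forall z, 0 < rnorm z <= r -> 0 <= complex.Re (p z).
Proof.
move=> r0 d0 dp pB pc z zr; rewrite leNgt; apply/negP => lt.
set x := complex.Re (p z) in lt.
pose N := B' ^+ 2 / (- x) + 1.
have nx : 0 < - x by rewrite oppr_gt0.
have N0 : 0 < N by rewrite ltr_wpDl// divr_ge0 ?sqr_ge0 ?ltW.
have S0 : 0 <= N ^+ 2 + B' ^+ 2 by rewrite addr_ge0 ?sqr_ge0.
have : rnorm (N%:C - p z) <= Num.sqrt (N ^+ 2 + B' ^+ 2).
  refine (@maximum_modulus_bounded (fun z => N%:C - p z) r d (N + B) _ r0 d0 _ _ _ z zr).
  - by move=> w /dp dw; exact: (diffc_sub (diffc_cst _ _) dw).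
  - by move=> w /pB wB; rewrite (le_trans (rnormB _ _))// lerD// rnormC gtr0_norm.
  - move=> w /pc [pB' Rp]; rewrite -(@ler_pXn2r _ 2) ?nnegrE ?rnorm_ge0 ?sqrtr_ge0//.
    rewrite sqr_sqrtr// rnorm_sqr ReD ImD ReN ImN /=.
    have B1 : rnorm (p w) ^+ 2 <= B' ^+ 2.
      by rewrite lerXn2r ?nnegrE ?rnorm_ge0// (le_trans (rnorm_ge0 (p w))).
    rewrite rnorm_sqr in B1.
    have B2 : 0 <= N * complex.Re (p w) by rewrite mulr_ge0// ltW.
    by rewrite sub0r sqrrN; nra.
rewrite -(@ler_pXn2r _ 2) ?nnegrE ?rnorm_ge0 ?sqrtr_ge0//.
rewrite sqr_sqrtr// rnorm_sqr ReD ImD ReN ImN /= -/x.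
have E : B' ^+ 2 = (N - 1) * (- x) by rewrite /N addrK divfK// gt_eqF.
have := sqr_ge0 (0 - complex.Im (p z)); rewrite E.
move: (_ ^+ 2) => y y0; nra.
Qed.

(* Schwarz lemma for the Cayley transform (h + z) / (h - z) of -h / z. *)
Lemma caratheodory_bound (h : C -> C) :
  (forall z : C, rnorm z < 1 -> differentiable h z) -> h 0 = 0 -> 'd h 0 1 = -1 ->
  (forall z : C, 0 < rnorm z < 1 -> complex.Re (h z / z) <= 0) ->
  forall z, rnorm z < 1 -> rnorm (h z + z) <= 2 * rnorm z ^+ 2 / (1 - rnorm z).
Proof.
move=> dh h0 dh0 Rh z z1.
have [->|zn0] := eqVneq z 0.
  by rewrite h0 addr0 rnorm0 expr0n mulr0 mul0r.
have z0 : 0 < rnorm z by rewrite rnorm_gt0.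
pose q w : C := (h w + w) / (h w - w).
have hw_ge w : 0 < rnorm w < 1 -> rnorm w <= rnorm (h w - w).
  move=> /[dup] wr /andP[w0 _]; have wn0 : w != 0 by rewrite -rnorm_gt0.
  have -> : h w - w = w * (h w / w - 1) by field.
  rewrite rnormM ler_peMr ?rnorm_ge0// (le_trans _ (Re_le_rnorm _))// ReD ReN /=.
  by rewrite ler0_norm; have := Rh w wr; lra.
have hw_neq w : 0 < rnorm w < 1 -> h w - w != 0.
  by move=> /[dup] /hw_ge + /andP[+ _]; rewrite -rnorm_gt0 => /[swap]; apply: lt_le_trans.
have qle1 w : 0 < rnorm w < 1 -> rnorm (q w) <= 1.
  move=> wr; have := hw_neq w wr; rewrite -rnorm_gt0 => hn.
  rewrite rnormf_div ler_pdivrMr// mul1r -(@ler_pXn2r _ 2) ?nnegrE ?rnorm_ge0//.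
  have wn0 : w != 0 by rewrite -rnorm_gt0; case/andP: wr.
  have -> : h w + w = w * (h w / w + 1) by field.
  have -> : h w - w = w * (h w / w - 1) by field.
  rewrite !rnormM !exprMn ler_wpM2l ?sqr_ge0// !rnorm_sqr !ReD !ImD ReN ImN /=.
  have := Rh w wr; rewrite oppr0 addr0; move: (complex.Re _) => x; nra.
have [B [d [d0 hd]]] := holomorphic_remainder2 ltr01 dh.
have B0 : 0 <= B.
  have := hd (d / 2)%:C; rewrite rnormC gtr0_norm ?divr_gt0// => /(_ ltac:(lra)).
  move=> /(le_trans (rnorm_ge0 _)); rewrite pmulr_lge0// exprn_gt0// divr_gt0//.
(* On the circle of radius r the quotient q(w) / w is at most 1 / r. Near 0 it is bounded, because
   h(w) + w = O(w^2) while |h(w) - w| >= |w|. *)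
have key r : rnorm z < r < 1 -> rnorm (q z) <= rnorm z / r.
  move=> /andP[zr r1]; have r0 := lt_trans z0 zr.
  suff : rnorm (q z / z) <= 1 / r.
    by rewrite rnormf_div ler_pdivrMr// mulrAC mul1r mulrC.
  have zr0 : 0 < rnorm z <= r by rewrite z0 ltW.
  have d1 : 0 < Num.min d 1 by rewrite lt_min d0 ltr01.
  refine (@maximum_modulus_bounded (fun w => q w / w) r _ B _ r0 d1 _ _ _ z zr0).
  - move=> w /andP[w0 wr]; have w1 := le_lt_trans wr r1.
    have wn0 : w != 0 by rewrite -rnorm_gt0.
    have hn : h w - w != 0 by apply: hw_neq; rewrite w0.
    have dq : differentiable q w.
      apply: diffc_div; first exact: hn.
        by apply: diffc_add; [exact: dh | exact: diffc_id].
      by apply: diffc_sub; [exact: dh | exact: diffc_id].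
    exact: (diffc_div wn0 dq (diffc_id w)).
  - move=> w /andP[w0]; rewrite lt_min => /andP[wd w1].
    have wr : 0 < rnorm w < 1 by rewrite w0.
    have hn := hw_neq w wr; rewrite -rnorm_gt0 in hn.
    rewrite !rnormf_div ler_pdivrMr// ler_pdivrMr//.
    have := hd w wd; rewrite h0 dh0 subr0 mulN1r opprK => /le_trans; apply.
    by rewrite expr2 mulrA ler_wpM2l ?mulr_ge0 ?rnorm_ge0// hw_ge.
  - move=> w wr; rewrite rnormf_div wr ler_pM2r ?invr_gt0//.
    by apply: qle1; rewrite wr r0.
have qz : rnorm (q z) <= rnorm z.
  apply/ler_addgt0Pr => /= e e0.
  (* A radius between |z| and 1, close enough to 1 for |z| / r <= |z| + e. *)
  pose r := Num.max ((1 + rnorm z) / 2) (rnorm z / (rnorm z + e)).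
  have zr : rnorm z < r by rewrite lt_max; apply/orP; left; lra.
  have h2 : rnorm z / (rnorm z + e) < 1 by rewrite ltr_pdivrMr ?addr_gt0// mul1r ltrDl.
  have r1 : r < 1 by rewrite gt_max h2 andbT; lra.
  apply: (le_trans (key r _)); first by rewrite zr.
  rewrite ler_pdivrMr ?(lt_trans z0 zr)// mulrC -ler_pdivrMr ?addr_gt0//.
  by rewrite le_max lexx orbT.
have zr : 0 < rnorm z < 1 by rewrite z0.
have hn := hw_neq z zr.
have q1 : 1 - q z != 0.
  by rewrite -rnorm_gt0; have := rnorm1B_ge (q z); lra.
(* The Cayley transform is solved for h; |q z| <= |z| then controls both numerator and
   denominator. *)
have -> : h z + z = - (2 * z * q z / (1 - q z)).
  have hq : (h z - z) * q z = h z + z by rewrite /q; field.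
  have -> : h z + z = - (2 * z * q z) / (1 - q z); last by rewrite mulNr.
  apply/eqP; rewrite -(can2_eq (mulfK q1) (divfK q1)); apply/eqP.
  by rewrite mulrBr mulr1 -{1}hq; ring.
rewrite rnormN rnormf_div 2!rnormM.
have -> : rnorm (2 : C) = 2 by rewrite -realc_nat rnormC ger0_norm.
have d1 : 1 - rnorm z <= rnorm (1 - q z).
  by have := rnorm1B_ge (q z); lra.
have d2 : 0 < 1 - rnorm z by lra.
apply: ler_pM; rewrite ?invr_ge0 ?mulr_ge0 ?rnorm_ge0//.
  by rewrite expr2 mulrA ler_wpM2l// mulr_ge0 ?rnorm_ge0.
by rewrite lef_pV2// posrE (lt_le_trans d2).
Qed.

End DividedDifferences.

(** * The class M *)

Section ClassM.
Context {R : realType} {n : nat}.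
Local Notation C := R[i].
Local Notation Cn := 'rV[R[i]]_n.
Implicit Types (z u v w : Cn) (i j : 'I_n).

Lemma rnorm_coord z j : rnorm (z 0 j) <= rnorm z.
Proof.
rewrite -lecR -!normE [leRHS]mx_normE -[leLHS]nngE num_le.
exact: (@le_bigmax _ _ _ _ _ (ord0, j)).
Qed.

Lemma rnorm_row_max z : z != 0 -> exists j, rnorm z = rnorm (z 0 j).
Proof.
move=> z0; have : mx_norm z != 0.
  by apply: contra z0 => /eqP /mx_norm_eq0 ->.
move=> /mx_norm_neq0[[k j] /= h]; exists j; apply: complexI.
by rewrite -!normE [LHS]h (ord1 k).
Qed.

Lemma rnorm_row_le z (r : R) : 0 <= r -> (forall j, rnorm (z 0 j) <= r) -> rnorm z <= r.
Proof.
move=> r0 h; have [->|/rnorm_row_max[j ->]//] := eqVneq z 0.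
by rewrite rnorm0.
Qed.

Lemma rnorm_row_lt z (r : R) : 0 < r -> (forall j, rnorm (z 0 j) < r) -> rnorm z < r.
Proof.
move=> r0 h; have [->|/rnorm_row_max[j ->]//] := eqVneq z 0.
by rewrite rnorm0.
Qed.

Lemma polydiscE z : polydisc z = (rnorm z < 1) :> Prop.
Proof. by rewrite /polydisc /= -normlt. Qed.

Lemma diff_row (V : normedModType C) (F : V -> 'I_n -> C) (x : V) :
  (forall j, differentiable (fun y => F y j) x) ->
  differentiable (fun y => \row_j F y j : Cn) x.
Proof.
move=> dF.
have -> : (fun y => \row_j F y j : Cn) = \sum_j (fun y => F y j *: delta_mx 0 j).
  apply/funext => y; rewrite fct_sumE [LHS]row_sum_delta.
  by apply: eq_bigr => j _; rewrite mxE.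
by apply: differentiable_sum => j; apply: differentiableZl; exact: dF.
Qed.

Lemma diff_entry (V : normedModType C) (g : V -> Cn) (x : V) j :
  differentiable g x -> differentiable (fun y => g y 0 j) x.
Proof. by move=> dg; exact: (differentiable_comp dg (differentiable_coord (g x) 0 j)). Qed.

Lemma diff_scale_add (v w : Cn) (c : C) : differentiable (fun c : C => v + c *: w) c.
Proof.
apply: differentiableD; first exact: differentiable_cst.
by apply: differentiableZl; exact: diffc_id.
Qed.

Lemma holomorphic_slice (h : Cn -> Cn) (V : normedModType C) (g : V -> Cn) (x : V) i :
  holomorphic h -> rnorm (g x) < 1 -> differentiable g x ->
  differentiable (fun y => h (g y) 0 i) x.
Proof.
move=> hh gx dg; apply: diff_entry.
have dh : differentiable h (g x) by apply: hh; rewrite polydiscE.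
exact: (differentiable_comp dg dh).
Qed.

Lemma diff_unique_C (f : C -> C) (l : C) : differentiable f 0 ->
  (forall e : R, 0 < e -> exists2 d : R, 0 < d & forall z : C, rnorm z < d ->
     rnorm (f z - f 0 - l * z) <= e * rnorm z) -> 'd f 0 1 = l.
Proof.
move=> df fl; apply/eqP; rewrite -subr_eq0 -rnorm_eq0 -normr_le0 ger0_norm ?rnorm_ge0//.
apply/ler_addgt0Pr => /= e e0; rewrite add0r.
have e2 : 0 < e / 2 by rewrite divr_gt0.
have [d1 d10 h1] := diff_rnorm df e2; have [d2 d20 h2] := fl _ e2.
pose r := Num.min d1 d2 / 2; have r0 : 0 < r by rewrite divr_gt0// lt_min d10.
have rz : rnorm (r%:C : C) = r by rewrite rnormC gtr0_norm.
have : r < Num.min d1 d2.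
  have : 0 < Num.min d1 d2 by rewrite lt_min d10.
  rewrite /r; lra.
rewrite lt_min => /andP[r1 r2].
have := h1 r%:C; rewrite subr0 rz => /(_ r1); rewrite (diff_C _ df) => k1.
have := h2 r%:C; rewrite rz => /(_ r2) => k2.
have : rnorm (('d f 0 1 - l) * r%:C) <= e * r.
  have -> : ('d f 0 1 - l) * r%:C = (f r%:C - f 0 - l * r%:C) - (f r%:C - f 0 - 'd f 0 1 * r%:C) by ring.
  by rewrite (le_trans (rnormB _ _))// (splitr e) mulrDl lerD.
by rewrite rnormM rz ler_pM2r.
Qed.

Lemma jacobian_mul (h : Cn -> Cn) z w : 'd h z w = w *m 'J h z.
Proof. by rewrite /jacobian mul_rV_lin1. Qed.

Section Estimates.
Variable h : Cn -> Cn.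
Hypothesis hM : classM h.

Let hol : holomorphic h. Proof. by case: hM. Qed.
Let h0 : h 0 = 0. Proof. by case: hM. Qed.

Let H z i := h z 0 i + z 0 i.

Lemma classM_littleo (e : R) : 0 < e -> exists2 d : R, 0 < d & forall z, rnorm z < d ->
  rnorm (h z + z) <= e * rnorm z.
Proof.
move=> e0; have dh : differentiable h 0 by apply: hol; rewrite polydiscE rnorm0.
have [d d0 hd] := diff_rnorm dh e0; exists d => // z zd.
have := hd z; rewrite subr0 h0 subr0 jacobian_mul; case: hM => _ _ -> _.
by rewrite mulmxN mulmx1 opprK; apply.
Qed.

Let H_slice (V : normedModType C) (g : V -> Cn) (x : V) i :
  rnorm (g x) < 1 -> differentiable g x -> differentiable (fun y => H (g y) i) x.
Proof.
by move=> gx dg; apply: diffc_add; [exact: holomorphic_slice | exact: diff_entry].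
Qed.

Lemma classM_maximal_coord z i : rnorm z < 1 -> rnorm z = rnorm (z 0 i) ->
  rnorm (H z i) <= 2 * rnorm z ^+ 2 / (1 - rnorm z).
Proof.
move=> z1 zi; have [z0|z0] := eqVneq z 0.
  by rewrite /H z0 h0 !mxE addr0 !rnorm0 expr0n mulr0 mul0r.
pose r := rnorm z; have r0 : 0 < r by rewrite rnorm_gt0.
have rn0 : r%:C != 0 :> C by rewrite realc_eq0 gt_eqF.
pose w := (r%:C)^-1 *: z.
have zE : z = r%:C *: w by rewrite scalerA divff// scale1r.
have rw : rnorm w = 1 by rewrite rnormZ -realcV rnormC gtr0_norm ?invr_gt0// mulVf ?gt_eqF.
have rwi : rnorm (w 0 i) = 1.
  by rewrite mxE rnormM -zi -realcV rnormC gtr0_norm ?invr_gt0// mulVf ?gt_eqF.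
have wi0 : w 0 i != 0 by rewrite -rnorm_gt0 rwi.
pose phi (c : C) := h (c *: w) 0 i / w 0 i.
have rcw (c : C) : rnorm (c *: w) = rnorm c by rewrite rnormZ rw mulr1.
have dphi (c : C) : rnorm c < 1 -> differentiable phi c.
  move=> c1; apply: diffc_mul; last exact: diffc_cst.
  apply: holomorphic_slice; [exact: hol | by rewrite rcw |].
  by apply: differentiableZl; exact: diffc_id.
have phi0 : phi 0 = 0 by rewrite /phi scale0r h0 mxE mul0r.
have dphi0 : 'd phi 0 1 = -1.
  apply: diff_unique_C; first by apply: dphi; rewrite rnorm0.
  move=> e e0; have [d d0 hd] := classM_littleo e0; exists d => // c cd.
  rewrite phi0 subr0 mulN1r opprK.
  have -> : phi c + c = (h (c *: w) + c *: w) 0 i / w 0 i by rewrite /phi [X in _ = X / _]mxE [(c *: w) 0 i]mxE mulrDl mulfK.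
  rewrite rnormf_div rwi divr1 (le_trans (rnorm_coord _ _))//.
  by have := hd (c *: w); rewrite rcw; apply.
have Rphi (c : C) : 0 < rnorm c < 1 -> complex.Re (phi c / c) <= 0.
  move=> /andP[c0 c1]; have cn0 : c != 0 by rewrite -rnorm_gt0.
  have -> : phi c / c = h (c *: w) 0 i / (c *: w) 0 i by rewrite /phi [(c *: w) 0 i]mxE; field; rewrite wi0 cn0.
  case: hM => _ _ _; apply; first by rewrite polydiscE rcw.
    by rewrite !normE rcw mxE rnormM rwi mulr1.
  by rewrite normE mxE rnormM rwi mulr1 ltcR.
have := caratheodory_bound dphi phi0 dphi0 Rphi (z := r%:C).
rewrite rnormC gtr0_norm// => /(_ z1); rewrite -/r; congr (_ <= _).
have zi' : z 0 i = r%:C * w 0 i by rewrite {1}zE mxE.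
have -> : phi r%:C + r%:C = H z i / w 0 i by rewrite /phi -zE /H zi'; field.
by rewrite rnormf_div rwi divr1.
Qed.

(** The maximum principle in the i-th variable alone: on its boundary circle of radius 1/2 the i-th
    coordinate is maximal, and the bound 2 r^2 / (1 - r) equals 1 at r = 1/2. *)
Lemma classM_le1 z i : rnorm z <= 1 / 2 -> rnorm (H z i) <= 1.
Proof.
move=> z2; pose g (c : C) : Cn := \row_j (if j == i then c else z 0 j).
have gi c : g c 0 i = c by rewrite mxE eqxx.
have rg c : rnorm c <= 1 / 2 -> rnorm (g c) <= 1 / 2.
  move=> c2; apply: rnorm_row_le => [|j]; first by lra.
  by rewrite mxE; case: eqP => // _; apply: le_trans (rnorm_coord _ _) z2.
have gz : g (z 0 i) = z.
  by apply/rowP => j; rewrite mxE; case: eqP => [->|].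
have dg c : differentiable g c.
  apply: diff_row => j; case: (j == i); [exact: diffc_id | exact: diffc_cst].
have dH c : rnorm c <= 1 / 2 -> differentiable (fun c => H (g c) i) c.
  by move=> c2; apply: H_slice; [apply: le_lt_trans (rg c c2) _; lra | exact: dg].
rewrite -{1}gz; apply: (@maximum_modulus_seq R [::] (fun c => H (g c) i) (1 / 2)).
- by move=> c /dH; exact: contc_diff.
- by move=> c /ltW c2 _; exact: dH.
- move=> c c2; have c2' : rnorm c <= 1 / 2 by rewrite c2.
  have e : rnorm (g c) = rnorm (g c 0 i).
    by apply/eqP; rewrite eq_le rnorm_coord gi c2 rg.
  have e2 : rnorm (g c) = 1 / 2 by rewrite e gi.
  have := classM_maximal_coord _ e; rewrite e2.
  have -> : 2 * (1 / 2) ^+ 2 / (1 - 1 / 2) = 1 :> R by field.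
  by apply; lra.
- exact: le_trans (rnorm_coord _ _) z2.
Qed.

(** On the disc through z, H has a double zero at the centre, so H / c^2 is bounded near 0. At |c| =
    1/2, where |H| <= 1, this quotient is at most 4. *)
Lemma classM_quadratic z i : rnorm z <= 1 / 2 -> rnorm (H z i) <= 4 * rnorm z ^+ 2.
Proof.
move=> z2; have [z0|z0] := eqVneq z 0.
  by rewrite /H z0 h0 !mxE addr0 !rnorm0 expr0n mulr0.
pose r := rnorm z; have r0 : 0 < r by rewrite rnorm_gt0.
have rn0 : r%:C != 0 :> C by rewrite realc_eq0 gt_eqF.
pose w := (r%:C)^-1 *: z.
have zE : z = r%:C *: w by rewrite scalerA divff// scale1r.
have rw : rnorm w = 1 by rewrite rnormZ -realcV rnormC gtr0_norm ?invr_gt0// mulVf ?gt_eqF.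
have rcw (c : C) : rnorm (c *: w) = rnorm c by rewrite rnormZ rw mulr1.
pose f (c : C) := H (c *: w) i.
have df (c : C) : rnorm c < 1 -> differentiable f c.
  move=> c1; apply: H_slice; first by rewrite rcw.
  by apply: differentiableZl; exact: diffc_id.
have f0 : f 0 = 0 by rewrite /f /H scale0r h0 !mxE addr0.
have df0 : 'd f 0 1 = 0.
  apply: diff_unique_C; first by apply: df; rewrite rnorm0.
  move=> e e0; have [d d0 hd] := classM_littleo e0; exists d => // c cd.
  rewrite f0 subr0 mul0r subr0.
  have -> : f c = (h (c *: w) + c *: w) 0 i by rewrite /f /H !mxE.
  rewrite (le_trans (rnorm_coord _ _))//.
  by have := hd (c *: w); rewrite rcw; apply.
have [B [d [d0 hd]]] := holomorphic_remainder2 ltr01 df.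
have r2 : (0 : R) < 1 / 2 by lra.
suff : rnorm (f r%:C / r%:C ^+ 2) <= 4.
  rewrite rnormf_div rnormX rnormC gtr0_norm// ler_pdivrMr ?exprn_gt0//.
  by rewrite /f -zE.
have rr : 0 < rnorm (r%:C : C) <= 1 / 2 by rewrite rnormC gtr0_norm// r0.
refine (@maximum_modulus_bounded _ (fun c => f c / c ^+ 2) (1 / 2) d B _ r2 d0 _ _ _ _ rr).
- move=> c /andP[c0 c2]; have cn0 : c ^+ 2 != 0 by rewrite expf_neq0// -rnorm_gt0.
  apply: diffc_div; [exact: cn0 | apply: df; lra | exact: diffc_exp (diffc_id c)].
- move=> c /andP[c0 cd]; rewrite rnormf_div rnormX ler_pdivrMr ?exprn_gt0//.
  by have := hd c cd; rewrite f0 df0 subr0 mul0r subr0.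
- move=> c c2; rewrite rnormf_div rnormX c2.
  have : rnorm (f c) <= 1 by apply: classM_le1; rewrite rcw c2.
  lra.
Qed.

(** If |u - v| > s, the quadratic bound at u and at v suffices. Otherwise the complex line from v
    through u is followed up to parameter radius r = s / |u - v| >= 1; it stays in the ball of
    radius 2 s, where |H| <= 16 s^2, and the Schwarz bound gives 2 * 16 s^2 / r = 32 s |u - v|. *)
Lemma classM_lipschitz u v i (s : R) : s <= 1 / 4 -> rnorm u <= s -> rnorm v <= s ->
  rnorm (H u i - H v i) <= 32 * s * rnorm (u - v).
Proof.
move=> s4 us vs; have s0 := le_trans (rnorm_ge0 u) us.
have Hs w (t : R) : rnorm w <= t -> t <= 1 / 2 -> rnorm (H w i) <= 4 * t ^+ 2.
  move=> wt t2; apply: le_trans (classM_quadratic i (le_trans wt t2)) _.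
  by rewrite ler_wpM2l// lerXn2r ?nnegrE ?rnorm_ge0// (le_trans (rnorm_ge0 w)).
have [uv|uv] := ltP s (rnorm (u - v)).
  have h1 := Hs u s us ltac:(lra); have h2 := Hs v s vs ltac:(lra).
  rewrite (le_trans (rnormB _ _))// (le_trans (lerD h1 h2))//.
  have : s * s <= s * rnorm (u - v) by rewrite ler_wpM2l// ltW.
  rewrite expr2; have := mulr_ge0 s0 (rnorm_ge0 (u - v)); lra.
have [uv0|uv0] := eqVneq (u - v) 0.
  move/eqP: uv0; rewrite subr_eq0 => /eqP ->; rewrite !subrr rnorm0.
  by rewrite mulr_ge0 ?rnorm_ge0// mulr_ge0.
rewrite -rnorm_gt0 in uv0.
pose f (c : C) := H (v + c *: (u - v)) i.
pose r := s / rnorm (u - v).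
have sp : 0 < s by apply: lt_le_trans uv.
have r0 : 0 < r by rewrite divr_gt0.
have ng (c : C) : rnorm c <= r -> rnorm (v + c *: (u - v)) <= 2 * s.
  move=> cr; rewrite (le_trans (rnormD _ _))// mulr2n mulrDl mul1r lerD// rnormZ.
  by rewrite -ler_pdivlMr.
have df (c : C) : rnorm c <= r -> differentiable f c.
  move=> cr; apply: H_slice; last exact: diff_scale_add.
  by apply: le_lt_trans (ng c cr) _; lra.
have fB (c : C) : rnorm c = r -> rnorm (f c) <= 16 * s ^+ 2.
  move=> cr; have := Hs _ _ (ng c _) ltac:(lra); rewrite cr => /(_ (lexx _)) /le_trans; apply.
  by rewrite exprMn mulrA -natrX -natrM.
have r1 : rnorm (1 : C) <= r by rewrite rnorm1 ler_pdivlMr// mul1r.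
have := schwarz_bound r0 df fB r1.
rewrite /f scale1r scale0r addr0 subrKC rnorm1 mulr1 => /le_trans; apply.
rewrite /r le_eqVlt; apply/orP; left; apply/eqP; field.
by rewrite (gt_eqF sp) (gt_eqF uv0).
Qed.

(* For |z| = 1 and z_i = 0, apply the definition of the class on the boundary of the disc
   zeta |-> zeta z + (omega zeta^2 / rho) e_i, |zeta| <= rho, on which the i-th coordinate is maximal. *)
Lemma classM_zero_coord z i : z 0 i = 0 -> rnorm z <= 1 / 4 ->
  rnorm (h z 0 i) <= rnorm z ^+ 2 * (1 + 32 * rnorm z).
Proof.
move=> zi z4; have [z0|z0] := eqVneq z 0.
  by rewrite z0 h0 mxE !rnorm0 expr0n mul0r.
pose a := rnorm z; have a0 : 0 < a by rewrite rnorm_gt0.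
have an0 : a%:C != 0 :> C by rewrite realc_eq0 gt_eqF.
have [->|eta0] := eqVneq (h z 0 i) 0.
  by rewrite rnorm0 mulr_ge0 ?sqr_ge0 ?addr_ge0 ?mulr_ge0 ?rnorm_ge0.
set eta := h z 0 i in eta0 *; have re0 : 0 < rnorm eta by rewrite rnorm_gt0.
have ren0 : (rnorm eta)%:C != 0 :> C by rewrite realc_eq0 gt_eqF.
pose w := (a%:C)^-1 *: z.
have zE : z = a%:C *: w by rewrite scalerA divff// scale1r.
have rw : rnorm w = 1 by rewrite rnormZ -realcV rnormC gtr0_norm ?invr_gt0// mulVf ?gt_eqF.
have wi : w 0 i = 0 by rewrite mxE zi mulr0.
(* The phase of eta: it makes eta divided by the i-th coordinate of the disc positive, so that an
   inequality on real parts sees the full modulus of eta. *)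
pose om := eta / (rnorm eta)%:C.
have rom : rnorm om = 1 by rewrite rnormf_div rnormC gtr0_norm// divff// gt_eqF.
have omn0 : om != 0 by rewrite -rnorm_gt0 rom.
(* For rho < 1 the closed disc stays inside the polydisc; the claim is the limit as rho tends to
   1. *)
suff key rho : 1 / 2 <= rho < 1 -> rnorm eta * rho <= a ^+ 2 * (1 + 32 * a).
  set D := a ^+ 2 * (1 + 32 * a) in key *; rewrite leNgt; apply/negP => lt.
  have D0 : 0 < D by rewrite mulr_gt0 ?exprn_gt0// addr_gt0// mulr_gt0.
  pose rho := Num.max (1 / 2) ((D / rnorm eta + 1) / 2).
  have q1 : D / rnorm eta < 1 by rewrite ltr_pdivrMr// mul1r.
  have rho1 : 1 / 2 <= rho < 1.
    by rewrite le_max lexx /= gt_max; apply/andP; split; lra.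
  have h1 : rho <= D / rnorm eta by rewrite ler_pdivlMr// mulrC; exact: key.
  have h2 : D / rnorm eta < rho by rewrite lt_max; apply/orP; right; lra.
  by move: (lt_le_trans h2 h1); rewrite ltxx.
move=> /andP[rho2 rho1]; have rho0 : 0 < rho by lra.
have rhon0 : rho%:C != 0 :> C by rewrite realc_eq0 gt_eqF.
pose Z (c : C) : Cn := \row_j (if j == i then om * c ^+ 2 / rho%:C else c * w 0 j).
have Zi c : Z c 0 i = om * c ^+ 2 / rho%:C by rewrite mxE eqxx.
have rZi c : rnorm (Z c 0 i) = rnorm c ^+ 2 / rho.
  by rewrite Zi rnormf_div rnormM rom mul1r rnormX rnormC gtr0_norm.
have rZ c : rnorm c <= rho -> rnorm (Z c) <= rnorm c.
  move=> cr; apply: rnorm_row_le => [|j]; first exact: rnorm_ge0.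
  have [->|ji] := eqVneq j i.
    by rewrite rZi ler_pdivrMr// expr2 ler_wpM2l ?rnorm_ge0.
  rewrite mxE (negbTE ji) rnormM ler_piMr ?rnorm_ge0//.
  by rewrite -rw rnorm_coord.
have dZ c : differentiable Z c.
  apply: diff_row => j; case: (j == i).
    by apply: diffc_mul; [apply: diffc_mul; [exact: diffc_cst | exact: diffc_exp (diffc_id c)] | exact: diffc_cst].
  by apply: diffc_mul; [exact: diffc_id | exact: diffc_cst].
pose p c := - (h (Z c) 0 i / Z c 0 i).
have Zin0 c : 0 < rnorm c -> Z c 0 i != 0.
  by move=> c0; rewrite -rnorm_gt0 rZi divr_gt0// exprn_gt0.
have pE c : 0 < rnorm c -> p c = 1 - H (Z c) i / Z c 0 i.
  by move=> /Zin0 c0; rewrite /p /H; field.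
have dp c : 0 < rnorm c <= rho -> differentiable p c.
  move=> /andP[c0 cr]; apply: diffc_opp; apply: diffc_div.
  - exact: Zin0.
  - apply: holomorphic_slice; [exact: hol | | exact: dZ].
    by apply: le_lt_trans (le_lt_trans (rZ c cr) (le_lt_trans cr rho1)).
  - exact: diff_entry (dZ c).
(* 5 = 1 + 4: |H| <= 4 |c|^2 by the quadratic bound, and the i-th coordinate has modulus |c|^2 / rho
   >= |c|^2. The numerator and the denominator vanish to the same order, which makes the singularity
   at 0 harmless. *)
have pB c : 0 < rnorm c < 1 / 2 -> rnorm (p c) <= 5.
  move=> /andP[c0 c2]; rewrite pE// (le_trans (rnormB _ _))// rnorm1.
  have cr : rnorm c <= rho by lra.
  have := classM_quadratic i (le_trans (rZ c cr) (ltW c2)) => h1.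
  have : rnorm (H (Z c) i / Z c 0 i) <= 4.
    rewrite rnormf_div rZi ler_pdivrMr ?divr_gt0 ?exprn_gt0// (le_trans h1)//.
    rewrite ler_wpM2l// (@le_trans _ _ (rnorm c ^+ 2))//.
      by rewrite lerXn2r ?nnegrE ?rnorm_ge0// rZ.
    by rewrite ler_pdivlMr// ler_piMr ?sqr_ge0// ltW.
  lra.
have pc c : rnorm c = rho -> rnorm (p c) <= 1 + 2 * rho / (1 - rho) /\ 0 <= complex.Re (p c).
  move=> cr; have c0 : 0 < rnorm c by rewrite cr.
  have e1 : rnorm (Z c 0 i) = rho by rewrite rZi cr expr2 mulfK// gt_eqF.
  have e2 : rnorm (Z c) = rho.
    by apply/eqP; rewrite eq_le -{1}cr rZ ?cr//= -{1}e1 rnorm_coord.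
  have Z1 : rnorm (Z c) < 1 by rewrite e2.
  split.
    rewrite pE// (le_trans (rnormB _ _))// rnorm1 lerD2l rnormf_div e1.
    have := classM_maximal_coord Z1 (etrans e2 (esym e1)); rewrite e2 => h1.
    by rewrite ler_pdivrMr// (le_trans h1)// expr2 [leRHS]mulrAC mulrA.
  rewrite /p ReN oppr_ge0; case: hM => _ _ _; apply; first by rewrite polydiscE.
    by rewrite !normE e1 e2.
  by rewrite normE e1 ltcR.
have r2 : (0 : R) < 1 / 2 by lra.
have ra : 0 < rnorm (a%:C : C) <= rho by rewrite rnormC gtr0_norm// a0 /=; rewrite -/a in z4; lra.
have := Re_ge0_bounded rho0 r2 dp pB pc ra.
rewrite pE; last by case/andP: ra.
have raE : rnorm (a%:C : C) = a by rewrite rnormC gtr0_norm.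
rewrite ReD ReN /= subr_ge0 => Rle.
have Za : rnorm (Z a%:C) <= a by have := rZ a%:C; rewrite raE; apply; case/andP: ra; rewrite raE.
have HzE : H z i = eta by rewrite /H zi addr0.
have Zz : rnorm (Z a%:C - z) <= a ^+ 2 / rho.
  apply: rnorm_row_le => [|j]; first by rewrite divr_ge0 ?sqr_ge0// ltW.
  rewrite !mxE; have [->|ji] := eqVneq j i.
    by rewrite zi subr0 -Zi rZi raE.
  by rewrite mulVKf// subrr rnorm0 divr_ge0 ?sqr_ge0// ltW.
(* The points Z(a) and z differ only in coordinate i, by a^2 / rho. After division by the i-th
   coordinate of Z(a), of that same modulus, passing from one to the other costs 32 a. *)
have L := classM_lipschitz i z4 Za (lexx a).
rewrite HzE in L.
have ZaN : rnorm (Z a%:C 0 i) = a ^+ 2 / rho by rewrite rZi raE.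
have Za0 : Z a%:C 0 i != 0 by apply: Zin0; rewrite raE.
have q0 : 0 < a ^+ 2 / rho by rewrite divr_gt0// exprn_gt0.
have E1 : eta / Z a%:C 0 i = (rnorm eta * rho / a ^+ 2)%:C.
  rewrite Zi /om realcM realcM realcV realcX; field.
  by rewrite an0 rhon0 ren0 eta0.
have E2 : rnorm ((H (Z a%:C) i - eta) / Z a%:C 0 i) <= 32 * a.
  rewrite rnormf_div ZaN ler_pdivrMr// (le_trans L)//.
  by rewrite ler_wpM2l// mulr_ge0// ltW.
have E3 : complex.Re (H (Z a%:C) i / Z a%:C 0 i) =
  complex.Re ((H (Z a%:C) i - eta) / Z a%:C 0 i) + rnorm eta * rho / a ^+ 2.
  have -> : rnorm eta * rho / a ^+ 2 = complex.Re (eta / Z a%:C 0 i) by rewrite E1.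
  by rewrite -ReD -mulrDl subrK.
have E4 := le_trans (Re_le_rnorm _) E2.
move: E4; rewrite ler_norml => /andP[E4 _].
have : rnorm eta * rho / a ^+ 2 <= 1 + 32 * a by lra.
by rewrite ler_pdivrMr ?exprn_gt0// [X in _ <= X -> _]mulrC.
Qed.

End Estimates.
End ClassM.

(** * Coefficient bounds *)

Section MeanValue.
Context {R : realType}.
Local Notation C := R[i].
Local Notation mu := (@lebesgue_measure R).

(** Continuous induction: the supremum of the t with P a t is attained and cannot lie below b,
    because P holds on small intervals around it. For additive estimates this does the work of an
    integral. *)
Lemma cousin (P : R -> R -> Prop) (a b : R) : a <= b ->
  (forall x y z, a <= x -> x <= y -> y <= z -> z <= b -> P x y -> P y z -> P x z) ->
  (forall t, a <= t -> t <= b -> exists2 d : R, 0 < d & forall x y, a <= x -> x <= t ->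
     t <= y -> y <= b -> y - x < d -> P x y) ->
  P a b.
Proof.
move=> ab trans loc.
pose S := [set t | [/\ a <= t, t <= b & P a t]].
have Sa : S a.
  have [d d0 hd] := loc a (lexx a) ab.
  by split=> //; apply: hd => //; rewrite subrr.
have ubS : ubound S b by move=> t [].
have hS : has_sup S by split; [exists a | exists b].
pose s := sup S.
have as_ : a <= s by apply: ub_le_sup => //; exists b.
have sb : s <= b by apply: ge_sup => //; exists a.
have [d d0 hd] := loc s as_ sb.
have d2 : 0 < d / 2 by rewrite divr_gt0.
have [t [at_ tb Pt] ts] := sup_adherent d2 hS; rewrite -/s in ts.
have t_s : t <= s by apply: ub_le_sup; [exists b | split].
pose s' := Num.min b (s + d / 2).
have ss' : s <= s' by rewrite le_min sb lerDl ltW.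
have s'b : s' <= b by rewrite ge_min lexx.
have Ss' : S s'.
  split=> //; first exact: le_trans as_ ss'.
  apply: (trans a t s') => //; first exact: le_trans ss'.
  apply: hd => //; have : s' <= s + d / 2 by rewrite ge_min lexx orbT.
  lra.
have : s' <= s by apply: ub_le_sup => //; exists b.
rewrite ge_min => /orP[bs|]; last by rewrite gerDl leNgt d2.
have e : s = b by apply/eqP; rewrite eq_le sb.
have e' : s' = b by rewrite /s' min_l// e lerDl ltW.
by rewrite -e'; case: Ss'.
Qed.

(** The parameter is real while the scalars of V are complex, so the derivative is spelled out with
    epsilons and the embedding of h. *)
Definition path_derivative (V : normedModType C) (u : R -> V) (t : R) (l : V) :=
  forall e : R, 0 < e -> exists2 d : R, 0 < d & forall h : R, `|h| < d ->
    rnorm (u (t + h) - u t - h%:C *: l) <= e * `|h|.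

(** Straddle estimate: the expansions of u and Phi at t are used on both sides of t, for every short
    interval containing t. The resulting inequality is additive in the interval, as continuous
    induction requires. *)
Lemma path_derivative_increment (V : normedModType C) (u : R -> V) (t : R) (l : V)
    (Phi : R -> R) (k e : R) :
  path_derivative u t l -> is_derive t (1 : R) Phi k -> rnorm l <= k -> 0 < e ->
  exists2 d : R, 0 < d & forall x y, x <= t -> t <= y -> y - x < d ->
    rnorm (u y - u x) <= Phi y - Phi x + e * (y - x).
Proof.
move=> ul Pk lk e0; have e2 : 0 < e / 2 by rewrite divr_gt0.
have [d1 d10 h1] := ul _ e2; have [d2 d20 h2] := is_derive_epsilon Pk e2.
exists (Num.min d1 d2); first by rewrite lt_min d10.
have half h : `|h| < Num.min d1 d2 -> rnorm (u (t + h) - u t) <= k * `|h| + e / 2 * `|h| /\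
    `|Phi (t + h) - Phi t - k * h| <= e / 2 * `|h|.
  rewrite lt_min => /andP[hd1 hd2]; split; last exact: h2.
  have -> : u (t + h) - u t = h%:C *: l + (u (t + h) - u t - h%:C *: l) by rewrite subrKC.
  rewrite (le_trans (rnormD _ _))// lerD ?h1// rnormZ rnormC mulrC ler_wpM2r//.
move=> x y xt ty yx.
have [|Ux Px] := half (x - t).
  by rewrite ler0_norm ?subr_le0// opprB; apply: le_lt_trans yx; rewrite lerD2r.
have [|Uy Py] := half (y - t).
  by rewrite ger0_norm ?subr_ge0//; apply: le_lt_trans yx; rewrite lerD2l lerN2.
move: Ux Px Uy Py; rewrite !subrKC (ler0_norm (_ : x - t <= 0)) ?subr_le0//.
rewrite (ger0_norm (_ : 0 <= y - t)) ?subr_ge0// !ler_norml.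
move=> Ux /andP[Px1 Px2] Uy /andP[Py1 Py2].
have := rdistD (u t) (u y) (u x); rewrite (rdistC (u t) (u x)).
lra.
Qed.

Lemma mean_value_path (V : normedModType C) (u du : R -> V) (Phi dPhi : R -> R) (a b : R) :
  a <= b ->
  (forall t, a <= t -> t <= b -> path_derivative u t (du t)) ->
  (forall t, a <= t -> t <= b -> is_derive t (1 : R) Phi (dPhi t)) ->
  (forall t, a <= t -> t <= b -> rnorm (du t) <= dPhi t) ->
  rnorm (u b - u a) <= Phi b - Phi a.
Proof.
move=> ab hu hPhi hd; apply/ler_addgt0Pr => /= e e0.
pose e' := e / (b - a + 1).
have ba : 0 < b - a + 1 by rewrite ltr_wpDl// subr_ge0.
have e'0 : 0 < e' by rewrite divr_gt0.
have : rnorm (u b - u a) <= Phi b - Phi a + e' * (b - a).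
  apply: (@cousin (fun x y => rnorm (u y - u x) <= Phi y - Phi x + e' * (y - x))) => //.
    move=> x y z _ _ _ _ Pxy Pyz; apply: (le_trans (rdistD (u y) _ _)).
    by apply: (le_trans (lerD Pyz Pxy)); lra.
  move=> t at_ tb.
  have [d d0 h] := path_derivative_increment (hu t at_ tb) (hPhi t at_ tb) (hd t at_ tb) e'0.
  by exists d => // x y _ xt ty _; apply: h.
move=> /le_trans; apply; rewrite lerD2l /e' -mulrA ger_pMr// mulrC ler_pdivrMr// mul1r.
by rewrite lerDl.
Qed.

Definition separated (s : seq (R * R)) := pairwise (fun p q => p.2 <= q.1) s.

(** Absolute continuity for lists of intervals ordered from left to right: the lists of two adjacent
    intervals can be concatenated. *)
Definition ac_on (a b : R) (V : normedModType C) (u : R -> V) :=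
  forall e : R, 0 < e -> exists2 d : R, 0 < d & forall s : seq (R * R),
    separated s -> (forall p, p \in s -> [/\ a <= p.1, p.1 <= p.2 & p.2 <= b]) ->
    \sum_(p <- s) (p.2 - p.1) < d -> \sum_(p <- s) rnorm (u p.2 - u p.1) < e.

(** The list collects the intervals on which nothing is known about the derivative; c bounds the
    increment over the rest. The total length is compared with the measure of O in the half-open
    interval ]x, y], which makes the condition additive. *)
Let bad_cover (O : set R) (x y : R) (V : normedModType C) (u : R -> V) (c : R) :=
  exists s : seq (R * R), [/\ separated s,
    forall p, p \in s -> [/\ x <= p.1, p.1 <= p.2 & p.2 <= y],
    ((\sum_(p <- s) (p.2 - p.1))%:E <= mu (O `&` `]x, y]))%E &
    rnorm (u y - u x) <= c + \sum_(p <- s) rnorm (u p.2 - u p.1)].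

Let bad_cover_trans (O : set R) (x y z : R) (V : normedModType C) (u : R -> V) (c d : R) :
  measurable O -> x <= y -> y <= z ->
  bad_cover O x y u c -> bad_cover O y z u d -> bad_cover O x z u (c + d).
Proof.
move=> mO xy yz [s [s1 s2 s3 s4]] [t [t1 t2 t3 t4]].
exists (s ++ t); split.
- rewrite /separated pairwise_cat; apply/and3P; split=> //.
  apply/allrelP => p q ps qt; have [_ _ h1] := s2 p ps; have [h2 _ _] := t2 q qt.
  exact: le_trans h1 h2.
- move=> p; rewrite mem_cat => /orP[/s2[h1 h2 h3]|/t2[h1 h2 h3]]; split=> //.
    exact: le_trans h3 yz.
  exact: le_trans xy h1.
- rewrite big_cat /= EFinD.
  have -> : O `&` `]x, z] = (O `&` `]x, y]) `|` (O `&` `]y, z]).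
    rewrite -setIUr; congr (_ `&` _); apply/seteqP; split=> w /=; rewrite !in_itv /=.
      move=> /andP[xw wz]; have [wy|yw] := leP w y; [left|right]; by apply/andP.
    move=> [/andP[xw wy]|/andP[yw wz]]; apply/andP; split=> //.
      exact: le_trans wy yz.
    exact: le_lt_trans xy yw.
  rewrite measureU; last first.
  - apply/seteqP; split=> // w [[_ /=]]; rewrite in_itv /= => /andP[_ wy] [_ /=].
    by rewrite in_itv /= => /andP[yw _]; move: (lt_le_trans yw wy); rewrite ltxx.
  - exact: measurableI.
  - exact: measurableI.
  exact: leeD.
- rewrite big_cat /= (le_trans (rdistD (u y) _ _))// (le_trans (lerD t4 s4))//.
  by rewrite le_eqVlt; apply/orP; left; apply/eqP; ring.
Qed.

Lemma negligible_open_cover (N : set R) (d : R) : mu.-negligible N -> 0 < d ->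
  exists O : set R, [/\ open O, N `<=` O & (mu O < d%:E)%E].
Proof.
move=> [A [mA A0 NA]] d0.
have Afin : (mu A < +oo)%E by rewrite A0 ltry.
have [U [oU AU Ud]] := lebesgue_regularity_outer mA Afin d0.
exists U; split=> //; first exact: subset_trans AU.
have mU : measurable U by exact: measurable_realfun.open_measurable.
have -> : U = (U `\` A) `|` A.
  by rewrite setUC setDUK.
rewrite measureU0//; exact: measurableD.
Qed.

(** At a time outside N the straddle estimate applies; around a time of N, a whole interval inside
    the open cover W is put on the list. The list has total length at most the measure of W, which
    lies below the modulus of absolute continuity for e / 2. *)
Lemma mean_value_ac (V : normedModType C) (u du : R -> V) (Phi dPhi : R -> R) (N : set R) (a b : R) :
  a <= b -> ac_on a b u -> mu.-negligible N ->
  (forall t, a <= t -> t <= b -> ~ N t -> path_derivative u t (du t)) ->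
  (forall t, a <= t -> t <= b -> is_derive t (1 : R) Phi (dPhi t)) ->
  (forall t, a <= t -> t <= b -> 0 <= dPhi t) ->
  (forall t, a <= t -> t <= b -> rnorm (du t) <= dPhi t) ->
  rnorm (u b - u a) <= Phi b - Phi a.
Proof.
move=> ab acu N0 hu hPhi dPhi0 hd; apply/ler_addgt0Pr => /= e e0.
pose e' := e / 2 / (b - a + 1).
have ba : 0 < b - a + 1 by rewrite ltr_wpDl// subr_ge0.
have e2 : 0 < e / 2 by rewrite divr_gt0.
have e'0 : 0 < e' by rewrite divr_gt0.
have [d d0 acd] := acu _ e2.
have [W [oW NW Wd]] := negligible_open_cover N0 d0.
have mW : measurable W by exact: measurable_realfun.open_measurable.
have Phi_mono x y : a <= x -> x <= y -> y <= b -> Phi x <= Phi y.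
  move=> ax xy yb.
  have dF w : w \in `[x, y] -> is_derive w 1 Phi (dPhi w).
    by rewrite in_itv /= => /andP[h1 h2]; apply: hPhi; [exact: le_trans ax h1 | exact: le_trans h2 yb].
  have [|c] := @MVT_segment R Phi dPhi x y xy (fun w hw => dF w (subset_itv_oo_cc hw)).
    by apply: derivable_within_continuous => w /dF [].
  rewrite in_itv /= => /andP[h1 h2] E; rewrite -subr_ge0 E.
  by rewrite mulr_ge0 ?subr_ge0// dPhi0//; [exact: le_trans ax h1 | exact: le_trans h2 yb].
pose P x y := bad_cover W x y u (Phi y - Phi x + e' * (y - x)).
have : P a b.
  apply: cousin => //.
    move=> x y z ax xy yz zb Pxy Pyz; rewrite /P.
    have -> : Phi z - Phi x + e' * (z - x) = (Phi y - Phi x + e' * (y - x)) + (Phi z - Phi y + e' * (z - y)) by ring.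
    exact: (bad_cover_trans mW xy yz Pxy Pyz).
  move=> t at_ tb; have [Nt|Nt] := pselect (N t); last first.
    have [r r0 h] := path_derivative_increment (hu t at_ tb Nt) (hPhi t at_ tb) (hd t at_ tb) e'0.
    exists r => // x y _ xt ty _ yx; exists [::]; split=> //; rewrite big_nil//.
    by rewrite addr0; apply: h.
  have /nbhs_normP[r /= r0 hr] := oW _ (NW _ Nt).
  exists r => // x y ax xt ty yb yx; have xy := le_trans xt ty.
  have sub : `]x, y]%classic `<=` W.
    move=> w /=; rewrite in_itv /= => /andP[xw wy]; apply: hr.
    by rewrite /ball_ /= ltr_norml; apply/andP; split; lra.
  exists [:: (x, y)]; split=> //.
  - by move=> p; rewrite inE => /eqP ->.
  - have -> : W `&` `]x, y] = `]x, y]%classic.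
      by apply/seteqP; split=> [w []//|w hw]; split=> //; exact: sub.
    rewrite big_seq1 /= lebesgue_measure_itv /=.
    case: ifPn => [_|]; first by rewrite EFinB.
    by rewrite lte_fin -leNgt => yx'; rewrite lee_fin subr_le0.
  - rewrite big_seq1 /= -[leLHS]add0r lerD2r addr_ge0// ?subr_ge0.
      exact: Phi_mono.
    by rewrite mulr_ge0 ?subr_ge0// ltW.
move=> [s [s1 s2 s3 s4]].
have sd : \sum_(p <- s) (p.2 - p.1) < d.
  rewrite -lte_fin; apply: le_lt_trans Wd; apply: (le_trans s3).
  by apply: le_measure; rewrite ?inE//; exact: measurableI.
have := acd s s1 s2 sd => /ltW sl.
apply: (le_trans s4); rewrite [X in _ <= _ + X]splitr addrA lerD// lerD2l.
rewrite /e' -mulrA ger_pMr// mulrC ler_pdivrMr// mul1r.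
by rewrite lerDl.
Qed.

Lemma ac_on_abs_continuous (n : nat) (a b : R) (u : R -> 'rV[C]_n) :
  abs_continuous_on a b u -> ac_on a b u.
Proof.
move=> acu e e0; have [d d0 hd] := acu e e0; exists d => // s s1 s2 s3.
pose x (i : 'I_(size s)) := (nth (0, 0) s i).1.
pose y (i : 'I_(size s)) := (nth (0, 0) s i).2.
rewrite -ltcR; have := hd (size s) x y.
have -> : (\sum_(p <- s) rnorm (u p.2 - u p.1))%:C = \sum_i `|u (y i) - u (x i)|.
  rewrite rmorph_sum /= (big_nth (0, 0)) big_mkord; apply: eq_bigr => i _.
  by rewrite normE.
apply.
- by move=> i; have [|h1 h2 h3] := s2 (nth (0, 0) s i); rewrite ?mem_nth.
- have /(pairwiseP (0, 0)) hp := s1.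
  move=> i j; rewrite neq_ltn => /orP[ij|ji]; [left|right]; apply: hp => //; exact: ltn_ord.
- by move: s3; rewrite (big_nth (0, 0)) big_mkord.
Qed.

Lemma ac_on_lipschitz (V : normedModType C) (a b L : R) (u : R -> V) :
  (forall x y, a <= x -> x <= y -> y <= b -> rnorm (u y - u x) <= L * (y - x)) ->
  ac_on a b u.
Proof.
move=> uL e e0; pose L' := `|L| + 1.
have L0 : 0 < L' by rewrite ltr_wpDl.
exists (e / L'); first by rewrite divr_gt0.
move=> s _ s2; rewrite ltr_pdivlMr// mulrC mulr_sumr; apply: le_lt_trans.
rewrite big_seq [leRHS]big_seq; apply: ler_sum => p ps; have [h1 h2 h3] := s2 p ps.
apply: (le_trans (uL _ _ h1 h2 h3)); rewrite ler_wpM2r ?subr_ge0//.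
by rewrite (le_trans (ler_norm _))// lerDl.
Qed.

Lemma abs_continuous_lipschitz (n : nat) (a b L : R) (u : R -> 'rV[C]_n) :
  (forall x y, a <= x -> x <= y -> y <= b -> rnorm (u y - u x) <= L * (y - x)) ->
  abs_continuous_on a b u.
Proof.
move=> uL e e0; pose L' := `|L| + 1.
have L0 : 0 < L' by rewrite ltr_wpDl.
exists (e / L'); first by rewrite divr_gt0.
move=> m x y xy _; rewrite ltr_pdivlMr// mulrC mulr_sumr => h.
have -> : \sum_i `|u (y i) - u (x i)| = (\sum_i rnorm (u (y i) - u (x i)))%:C.
  by rewrite rmorph_sum; apply: eq_bigr => i _; rewrite normE.
rewrite ltcR; apply: le_lt_trans h; apply: ler_sum => i _; have [h1 [h2 h3]] := xy i.
apply: (le_trans (uL _ _ h1 h2 h3)); rewrite ler_wpM2r ?subr_ge0//.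
by rewrite (le_trans (ler_norm _))// lerDl.
Qed.

Lemma ac_on_le (V W : normedModType C) (a b K L : R) (u : R -> V) (v : R -> W) :
  ac_on a b u ->
  (forall x y, a <= x -> x <= y -> y <= b ->
     rnorm (v y - v x) <= K * rnorm (u y - u x) + L * (y - x)) ->
  ac_on a b v.
Proof.
move=> acu uv e e0; pose K' := `|K| + 1; pose L' := `|L| + 1.
have K0 : 0 < K' by rewrite ltr_wpDl.
have L0 : 0 < L' by rewrite ltr_wpDl.
have eK : 0 < e / 2 / K' by rewrite !divr_gt0.
have [d d0 hd] := acu _ eK.
exists (Num.min d (e / 2 / L')); first by rewrite lt_min d0 !divr_gt0.
move=> s s1 s2; rewrite lt_min => /andP[sd sL].
have := hd s s1 s2 sd; rewrite ltr_pdivlMr// mulrC => H1.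
move: sL; rewrite ltr_pdivlMr// mulrC => H2.
apply: (@le_lt_trans _ _ (K' * (\sum_(p <- s) rnorm (u p.2 - u p.1)) + L' * (\sum_(p <- s) (p.2 - p.1)))); last first.
  by rewrite (splitr e) ltrD.
rewrite !mulr_sumr -big_split /= big_seq [leRHS]big_seq; apply: ler_sum => p ps.
have [h1 h2 h3] := s2 p ps; apply: (le_trans (uv _ _ h1 h2 h3)); apply: lerD.
  by rewrite ler_wpM2r ?rnorm_ge0// (le_trans (ler_norm _))// lerDl.
by rewrite ler_wpM2r ?subr_ge0// (le_trans (ler_norm _))// lerDl.
Qed.

Lemma ac_on_sum (V : normedModType C) (I : finType) (a b : R) (u : I -> R -> V) :
  (forall i, ac_on a b (u i)) -> ac_on a b (fun t => \sum_i u i t).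
Proof.
move=> acu; elim: (index_enum I) => [|i r ih] e e0.
  exists 1 => // s _ _ _; rewrite big1// => p _.
  by rewrite !big_nil subrr rnorm0.
have e2 : 0 < e / 2 by rewrite divr_gt0.
have [d1 d10 h1] := ih _ e2; have [d2 d20 h2] := acu i _ e2.
exists (Num.min d1 d2); first by rewrite lt_min d10.
move=> s s1 s2; rewrite lt_min => /andP[sd1 sd2].
rewrite (splitr e); apply: le_lt_trans (ltrD (h2 s s1 s2 sd2) (h1 s s1 s2 sd1)).
rewrite -big_split /=; apply: ler_sum => p _.
by rewrite !big_cons opprD addrACA rnormD.
Qed.

Lemma path_cvg_derivative (V : normedModType C) (u : R -> V) (t : R) (l : V) :
  (h^-1)%:C *: (u (t + h) - u t) @[h --> (0 : R)^'] --> l <-> path_derivative u t l.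
Proof.
have key (h : R) : h != 0 -> u (t + h) - u t - h%:C *: l = h%:C *: ((h^-1)%:C *: (u (t + h) - u t) - l).
  move=> h0; rewrite scalerBr scalerA -realcM divff// scale1r//.
split=> [ul e e0|ul A /= /rnbhsP[e e0 he]].
  have : nbhs l [set w | rnorm (w - l) < e] by apply/rnbhsP; exists e.
  move=> /ul /nbhs_normP[d /= d0 hd]; exists d => // h hh.
  have [->|h0] := eqVneq h 0.
    by rewrite addr0 subrr scale0r subrr rnorm0 normr0 mulr0.
  rewrite key// rnormZ rnormC mulrC ler_wpM2r//; apply: ltW; apply: hd => //.
  by rewrite /ball_ /= sub0r normrN.
have e2 : 0 < e / 2 by rewrite divr_gt0.
have [d d0 hd] := ul _ e2; apply/nbhs_normP; exists d => // h; rewrite /ball_ /= sub0r normrN.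
move=> hh h0; apply: he; have hp : 0 < `|h| by rewrite normr_gt0.
have := hd h hh; rewrite key// rnormZ rnormC mulrC ler_pM2r// => /le_lt_trans; apply; lra.
Qed.

End MeanValue.

(** * Displacement of the rescaled flow near the origin *)

Section LoewnerFlow.
Context {R : realType} {n : nat}.
Local Notation C := R[i].
Local Notation Cn := 'rV[R[i]]_n.
Local Notation mu := (@lebesgue_measure R).

Lemma path_derivative_expR (u : R -> Cn) (t : R) (l : Cn) :
  path_derivative u t l ->
  path_derivative (fun s => (expR s)%:C *: u s) t ((expR t)%:C *: (u t + l)).
Proof.
move=> ul e e0; have et := expR_gt0 t.
pose K := expR t * (2 + rnorm (u t) + rnorm l).
have K0 : 0 < K by rewrite mulr_gt0// -addrA ltr_wpDr// addr_ge0 ?rnorm_ge0.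
pose e1 := Num.min (e / K) 1.
have e10 : 0 < e1 by rewrite lt_min divr_gt0 ?ltr01.
have [d1 d10 h1] := ul _ e10.
have [d2 d20 h2] := is_derive_epsilon (is_derive_expR (0 : R)) e10.
exists (Num.min (Num.min d1 d2) (e1 / 2)); first by rewrite !lt_min d10 d20 divr_gt0.
move=> h; rewrite !lt_min => /andP[/andP[hd1 hd2] hd3].
have X1 := h1 h hd1; have X2 := h2 h hd2.
rewrite add0r expR0 mul1r in X2.
have e11 : e1 <= 1 by rewrite ge_min lexx orbT.
have eK : K * e1 <= e by rewrite mulrC -ler_pdivlMr// ge_min lexx.
have X3 : `|expR h - 1| <= e1.
  have -> : expR h - 1 = (expR h - 1 - h) + h by ring.
  have := ler_normD (expR h - 1 - h) h; have := normr_ge0 h; nra.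
have X4 : `|expR h| <= 2.
  have -> : expR h = (expR h - 1) + 1 by ring.
  by have := ler_normD (expR h - 1) 1; rewrite normr1; lra.
have -> : (expR (t + h))%:C *: u (t + h) - (expR t)%:C *: u t - h%:C *: ((expR t)%:C *: (u t + l))
  = (expR t)%:C *: ((expR h)%:C *: (u (t + h) - u t - h%:C *: l) + (expR h - 1 - h)%:C *: u t
      + ((expR h - 1) * h)%:C *: l).
  by apply/rowP => j; rewrite !mxE expRD !realcM !realcB realc1; ring.
rewrite rnormZ rnormC ger0_norm ?expR_ge0//.
apply: (@le_trans _ _ (expR t * (2 * (e1 * `|h|) + e1 * `|h| * rnorm (u t) + e1 * `|h| * rnorm l))).
  rewrite ler_wpM2l ?expR_ge0// (le_trans (rnormD _ _))// lerD//.
    rewrite (le_trans (rnormD _ _))// lerD// rnormZ rnormC.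
      by apply: ler_pM; rewrite ?rnorm_ge0.
    by rewrite ler_wpM2r ?rnorm_ge0.
  by rewrite rnormZ rnormC normrM ler_wpM2r ?rnorm_ge0// ler_wpM2r.
have -> : expR t * (2 * (e1 * `|h|) + e1 * `|h| * rnorm (u t) + e1 * `|h| * rnorm l) = K * e1 * `|h|.
  by rewrite /K; ring.
by rewrite ler_wpM2r.
Qed.

Lemma path_derivative_sum (I : finType) (u : I -> R -> C) (t : R) (l : I -> C) :
  (forall i, path_derivative (u i) t (l i)) ->
  path_derivative (fun s => \sum_i u i s) t (\sum_i l i).
Proof.
move=> ul; elim: (index_enum I) => [|i r ih] e e0.
  exists 1 => // h _; rewrite !big_nil scaler0 !subr0 rnorm0.
  by rewrite mulr_ge0// ltW.
have e2 : 0 < e / 2 by rewrite divr_gt0.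
have [d1 d10 h1] := ih _ e2; have [d2 d20 h2] := ul i _ e2.
exists (Num.min d1 d2); first by rewrite lt_min d10.
move=> h; rewrite lt_min => /andP[hd1 hd2].
rewrite !big_cons (splitr e) mulrDl.
have E (x x' y y' v v' : C) : x + x' - (y + y') - h%:C *: (v + v') =
    (x - y - h%:C *: v) + (x' - y' - h%:C *: v') by rewrite scalerDr; ring.
rewrite E (le_trans (rnormD _ _))// lerD//; [exact: h2 | exact: h1].
Qed.

Lemma path_derivative_coord (u : R -> Cn) (t : R) (l : Cn) (c : C) (i : 'I_n) :
  path_derivative u t l -> path_derivative (fun s => c * u s 0 i) t (c * l 0 i).
Proof.
move=> ul e e0; have K0 : 0 < rnorm c + 1 by rewrite ltr_wpDl// rnorm_ge0.
have [d d0 hd] := ul _ (divr_gt0 e0 K0); exists d => // h hh.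
have -> : c * u (t + h) 0 i - c * u t 0 i - h%:C *: (c * l 0 i) =
    c * (u (t + h) - u t - h%:C *: l) 0 i.
  by rewrite !mxE /= /GRing.scale /=; ring.
rewrite rnormM.
apply: (@le_trans _ _ ((rnorm c + 1) * (e / (rnorm c + 1) * `|h|))).
  apply: ler_pM; rewrite ?rnorm_ge0//; first by rewrite lerDl.
  by rewrite (le_trans (rnorm_coord _ _))// hd.
have -> : (rnorm c + 1) * (e / (rnorm c + 1) * `|h|) = e * `|h| by field; rewrite gt_eqF.
exact: lexx.
Qed.

Lemma ac_on_continuous (V : normedModType C) (a b : R) (u : R -> V) : ac_on a b u ->
  forall e : R, 0 < e -> exists2 d : R, 0 < d & forall x y, a <= x -> x <= y -> y <= b ->
    y - x < d -> rnorm (u y - u x) < e.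
Proof.
move=> acu e e0; have [d d0 hd] := acu e e0; exists d => // x y ax xy yb yx.
have := hd [:: (x, y)]; rewrite !big_seq1 /=; apply=> //.
by move=> p; rewrite inE => /eqP ->.
Qed.

Section Flow.
Variables (G : Cn -> R -> Cn) (phi : R -> R -> Cn -> Cn).
Hypotheses (hG : herglotz G) (hphi : loewner_solution G phi).

Definition rescaled z (t : R) : Cn := (expR t)%:C *: phi 0 t z.

Let classMG t : 0 <= t -> classM (G ^~ t). Proof. by case: hG => + _; apply. Qed.

Let phi_lt1 z t : rnorm z < 1 -> 0 <= t -> rnorm (phi 0 t z) < 1.
Proof.
move=> z1 t0; case: hphi => + _ => /(_ 0 t (lexx _) t0) [_ h].
by have := h z; rewrite !polydiscE; apply.
Qed.

Lemma rescaled0 z : rnorm z < 1 -> rescaled z 0 = z.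
Proof.
move=> z1; case: hphi => _ /(_ 0 z (lexx _)) []; first by rewrite polydiscE.
by rewrite /rescaled expR0 => -> _ _; rewrite scale1r.
Qed.

Lemma rescaled_ac z T : rnorm z < 1 -> ac_on 0 T (rescaled z).
Proof.
move=> z1; have [T0|T0] := ltP T 0.
  by apply: (@ac_on_lipschitz _ _ _ _ 0) => x y x0 xy yT; lra.
case: hphi => _ /(_ 0 z (lexx _)) []; first by rewrite polydiscE.
move=> _ /(_ T T0) /ac_on_abs_continuous acp _.
have [d d0 hd] := is_derive_epsilon (is_derive_expR (0 : R)) ltr01.
apply: (@ac_on_le _ _ _ _ _ (expR T) (expR T) (fun t => phi 0 t z)) => // x y x0 xy yT.
have -> : rescaled z y - rescaled z x =
   (expR y)%:C *: (phi 0 y z - phi 0 x z) + (expR y - expR x)%:C *: phi 0 x z.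
  by apply/rowP => j; rewrite !mxE realcB; ring.
rewrite (le_trans (rnormD _ _))// !rnormZ !rnormC ger0_norm ?expR_ge0//; apply: lerD.
  by rewrite ler_wpM2r ?rnorm_ge0// ler_expR.
have [c] := @MVT_segment R expR expR x y xy (fun w _ => is_derive_expR w)
  (continuous_subspaceT (@continuous_expR R)).
rewrite in_itv /= => /andP[xc cy] ->.
rewrite ger0_norm ?mulr_ge0 ?expR_ge0 ?subr_ge0//.
apply: (@le_trans _ _ (expR c * (y - x))).
  by rewrite ler_piMr ?mulr_ge0 ?expR_ge0 ?subr_ge0// ltW// phi_lt1.
by rewrite ler_wpM2r ?subr_ge0// ler_expR (le_trans cy).
Qed.

Lemma rescaled_derivative z : rnorm z < 1 -> exists2 N : set R, mu.-negligible N &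
  forall t, 0 <= t -> ~ N t -> path_derivative (rescaled z) t
    ((expR t)%:C *: (phi 0 t z + G (phi 0 t z) t)).
Proof.
move=> z1; case: hphi => _ /(_ 0 z (lexx _)) []; first by rewrite polydiscE.
move=> _ _ ae; exists (~` [set t | 0 <= t ->
  (h^-1)%:C *: (phi 0 (t + h) z - phi 0 t z) @[h --> (0 : R)^'] --> G (phi 0 t z) t]); first exact: ae.
move=> t t0 /= /contrapT /(_ t0) h.
apply: path_derivative_expR.
exact: (path_cvg_derivative (fun s => phi 0 s z) t (G (phi 0 t z) t)).1 h.
Qed.

Let Hvec_lipschitz t u v (s : R) : 0 <= t -> s <= 1 / 4 -> rnorm u <= s -> rnorm v <= s ->
  rnorm ((u + G u t) - (v + G v t)) <= 32 * s * rnorm (u - v).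
Proof.
move=> t0 s4 us vs; apply: rnorm_row_le => [|j].
  by rewrite mulr_ge0 ?rnorm_ge0// mulr_ge0// (le_trans (rnorm_ge0 u)).
have := classM_lipschitz (classMG t0) j s4 us vs; congr (_ <= _).
by rewrite !mxE; congr rnorm; ring.
Qed.

Let Hvec_quadratic t u : 0 <= t -> rnorm u <= 1 / 2 ->
  rnorm (u + G u t) <= 4 * rnorm u ^+ 2.
Proof.
move=> t0 u2; apply: rnorm_row_le => [|j]; first by rewrite mulr_ge0 ?sqr_ge0.
have := classM_quadratic (classMG t0) j u2; congr (_ <= _).
by rewrite !mxE addrC.
Qed.

Let is_derive_expNR (k t : R) : is_derive t (1 : R) (fun s => - k * expR (- s)) (k * expR (- t)).
Proof.
have h : is_derive t (1 : R) (fun s : R => - s) (-1) by apply: is_deriveN.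
have h2 : is_derive t (1 : R) (fun s : R => expR (- s)) (expR (- t) *: (-1)).
  exact: (is_derive1_comp (f := expR) (g := fun s : R => - s)).
have := is_deriveZ (- k) h2; rewrite /GRing.scale /=.
by move=> h3; apply: is_derive_eq; rewrite mulrN1 mulrNN.
Qed.

Let phi_rescaled z t : phi 0 t z = (expR (- t))%:C *: rescaled z t.
Proof. by rewrite /rescaled scalerA -realcM -expRD addNr expR0 scale1r. Qed.

(** As long as the rescaled path stays below 2 r, |phi| <= 2 r e^-t, and the quadratic bound makes
    its derivative at most e^t * 4 (2 r e^-t)^2 = 16 r^2 e^-t, whose integral over all times is 16
    r^2. *)
Lemma rescaled_step z (r T : R) : 0 < r -> r <= 1 / 32 -> rnorm z <= r -> 0 <= T ->
  (forall t, 0 <= t -> t <= T -> rnorm (rescaled z t) <= 2 * r) ->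
  rnorm (rescaled z T - z) <= 16 * r ^+ 2.
Proof.
move=> r0 r32 zr T0 hT; have z1 : rnorm z < 1 by lra.
have [N N0 dN] := rescaled_derivative z1.
pose k := 16 * r ^+ 2; have k0 : 0 <= k by rewrite mulr_ge0 ?sqr_ge0.
have := @mean_value_ac R _ _ _ (fun s => - k * expR (- s)) (fun s => k * expR (- s)) N 0 T T0
  (rescaled_ac T z1) N0 (fun t h _ => dN t h) (fun t _ _ => is_derive_expNR k t).
rewrite rescaled0// oppr0 expR0 mulr1 opprK => h.
apply: (@le_trans _ _ (- k * expR (- T) + k)); last first.
  by rewrite -lerBrDr subrr mulNr oppr_le0 mulr_ge0 ?expR_ge0.
apply: h => [t _ _|t t0 tT]; first by rewrite mulr_ge0 ?expR_ge0.
have ph : rnorm (phi 0 t z) <= expR (- t) * (2 * r).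
  by rewrite phi_rescaled rnormZ rnormC ger0_norm ?expR_ge0// ler_wpM2l ?expR_ge0// hT.
have et1 : expR (- t) <= 1 by rewrite -expR0 ler_expR oppr_le0.
have ph2 : rnorm (phi 0 t z) <= 1 / 2.
  apply: (le_trans ph); apply: (@le_trans _ _ (1 * (2 * r))); last by lra.
  by rewrite ler_wpM2r// mulr_ge0// ltW.
rewrite rnormZ rnormC ger0_norm ?expR_ge0//.
apply: (@le_trans _ _ (expR t * (4 * (expR (- t) * (2 * r)) ^+ 2))).
  rewrite ler_wpM2l ?expR_ge0// (le_trans (Hvec_quadratic t0 ph2))// ler_wpM2l//.
  by rewrite lerXn2r ?nnegrE ?rnorm_ge0// (le_trans (rnorm_ge0 _) ph).
have e1 : expR t * expR (- t) = 1 by rewrite -expRD subrr expR0.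
have -> : expR t * (4 * (expR (- t) * (2 * r)) ^+ 2) = (expR t * expR (- t)) * (k * expR (- t)).
  by rewrite /k; ring.
by rewrite e1 mul1r.
Qed.

Let step_arith (r q : R) : 0 < r -> q <= r * (1 / 32) -> r / 2 + (16 * q + r) <= 2 * r.
Proof. lra. Qed.

(** Bootstrap: up to a time x where the bound 2 r holds, the path is in fact within 16 r^2 <= r / 2
    of z, thus below 3 r / 2; by uniform continuity it remains below 2 r for a time independent of
    x. The condition r <= 1/32 is 16 r^2 <= r / 2. *)
Lemma rescaled_bound z (r T : R) : 0 < r -> r <= 1 / 32 -> rnorm z <= r -> 0 <= T ->
  rnorm (rescaled z T) <= 2 * r.
Proof.
move=> r0 r32 zr T0; have z1 : rnorm z < 1 by lra.
pose P x y := (forall t, 0 <= t -> t <= x -> rnorm (rescaled z t) <= 2 * r) ->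
  (forall t, 0 <= t -> t <= y -> rnorm (rescaled z t) <= 2 * r).
suff : P 0 T.
  apply=> // t t0 t0'; have -> : t = 0 by apply/eqP; rewrite eq_le t0 t0'.
  rewrite rescaled0//; lra.
have r2 : 0 < r / 2 by rewrite divr_gt0.
have [d d0 hd] := ac_on_continuous (rescaled_ac T z1) r2.
apply: cousin => // [x y w _ _ _ _ Pxy Pyw /Pxy /Pyw //|t t0 tT].
exists d => // x y x0 xt ty yT yx hx s s0 sy.
have [sx|xs] := leP s x; first exact: hx.
have h1 := rescaled_step r0 r32 zr x0 hx.
have h2 : rnorm (rescaled z s - rescaled z x) < r / 2.
  apply: hd; [exact: x0 | exact: ltW | exact: le_trans sy yT |].
  by apply: le_lt_trans yx; rewrite lerD2r.
have := rdistD (rescaled z x) (rescaled z s) 0; have := rdistD z (rescaled z x) 0.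
rewrite !subr0 => h3 h4.
have h5 : r ^+ 2 <= r * (1 / 32) by rewrite expr2 ler_wpM2l// ltW.
apply: (le_trans h4); apply: (le_trans (lerD (ltW h2) (le_trans h3 (lerD h1 zr)))).
exact: step_arith.
Qed.

Lemma rescaled_close z (r T : R) : 0 < r -> r <= 1 / 32 -> rnorm z <= r -> 0 <= T ->
  rnorm (rescaled z T - z) <= 16 * r ^+ 2.
Proof.
move=> r0 r32 zr T0; apply: rescaled_step => // t t0 _.
exact: rescaled_bound.
Qed.

(** The unknown point phi is replaced by e^-t z. With s = e^-t both lie in the ball of radius 2 r s,
    where the Lipschitz constant is 64 r s, and their distance is at most 16 r^2 s; multiplied by
    e^t, the product is 1024 r^3 s. *)
Lemma rescaled_field_bound z (i : 'I_n) (r m K t : R) : 0 < r -> r <= 1 / 32 -> rnorm z <= r ->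
  0 <= t -> 0 <= K ->
  rnorm (G ((expR (- t))%:C *: z) t 0 i + ((expR (- t))%:C *: z) 0 i) <=
    m * (expR (- t) * r) ^+ 2 + K * (expR (- t) * r) ^+ 3 ->
  rnorm (((expR t)%:C *: (phi 0 t z + G (phi 0 t z) t)) 0 i) <=
    (m * r ^+ 2 + (K + 1024) * r ^+ 3) * expR (- t).
Proof.
move=> r0 r32 zr t0 K0 M2.
set s := expR (- t) in M2 *; have s0 : 0 < s by exact: expR_gt0.
have s1 : s <= 1 by rewrite -expR0 ler_expR oppr_le0.
have es : expR t * s = 1 by rewrite -expRD subrr expR0.
have pE : phi 0 t z = s%:C *: rescaled z t by exact: phi_rescaled.
have B1 := rescaled_bound r0 r32 zr t0.
have B2 := rescaled_close r0 r32 zr t0.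
have P1 : rnorm (phi 0 t z) <= 2 * r * s.
  by rewrite pE rnormZ rnormC gtr0_norm// mulrC ler_wpM2r// ltW.
have P2 : rnorm (s%:C *: z) <= 2 * r * s.
  rewrite rnormZ rnormC gtr0_norm// mulrC ler_wpM2r ?(ltW s0)//.
  by apply: (le_trans zr); lra.
have s4 : 2 * r * s <= 1 / 4.
  apply: (@le_trans _ _ (2 * r * 1)); last by lra.
  by rewrite ler_wpM2l// mulr_ge0// ltW.
have L := Hvec_lipschitz t0 s4 P1 P2.
have L2 : rnorm (phi 0 t z - s%:C *: z) <= s * (16 * r ^+ 2).
  by rewrite pE -scalerBr rnormZ rnormC gtr0_norm// ler_wpM2l// ltW.
rewrite mxE rnormM rnormC ger0_norm ?expR_ge0//.
set A := phi 0 t z + G (phi 0 t z) t in L *.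
set B := s%:C *: z + G (s%:C *: z) t in L.
have AB : rnorm (A 0 i) <= rnorm (A - B) + rnorm (B 0 i).
  have -> : A 0 i = (A - B) 0 i + B 0 i by rewrite !mxE subrK.
  by rewrite (le_trans (rnormD _ _))// lerD2r rnorm_coord.
have BE : rnorm (B 0 i) <= m * (s * r) ^+ 2 + K * (s * r) ^+ 3.
  by rewrite /B mxE addrC.
have LB : rnorm (A - B) <= 32 * (2 * r * s) * (s * (16 * r ^+ 2)).
  by rewrite (le_trans L)// ler_wpM2l// !mulr_ge0// ltW.
apply: (@le_trans _ _ (expR t * (32 * (2 * r * s) * (s * (16 * r ^+ 2)) +
   (m * (s * r) ^+ 2 + K * (s * r) ^+ 3)))).
  by rewrite ler_wpM2l ?expR_ge0// (le_trans AB)// lerD.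
have -> : expR t * (32 * (2 * r * s) * (s * (16 * r ^+ 2)) +
   (m * (s * r) ^+ 2 + K * (s * r) ^+ 3)) =
   (expR t * s) * (s * (1024 * r ^+ 3 + m * r ^+ 2 + s * (K * r ^+ 3))) by ring.
rewrite es mul1r mulrC ler_wpM2r ?(ltW s0)// .
have : s * (K * r ^+ 3) <= K * r ^+ 3.
  by rewrite ler_piMl// mulr_ge0// exprn_ge0// ltW.
lra.
Qed.

(** A finite union of null sets is one exceptional set for all the points. Off it, the functional
    has derivative at most k0 e^-t, and the primitive - k0 e^-t grows by at most k0, whatever T. *)
Lemma rescaled_functional (I : finType) (c : I -> C) (z : I -> Cn) (i : 'I_n) (r m K T : R) :
  0 < r -> r <= 1 / 32 -> 0 <= m -> 0 <= K -> 0 <= T ->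
  \sum_k rnorm (c k) <= 1 -> (forall k, rnorm (z k) <= r) ->
  (forall h : Cn -> Cn, classM h -> forall k (s : R), 0 < s -> s <= 1 ->
     rnorm (h (s%:C *: z k) 0 i + (s%:C *: z k) 0 i) <= m * (s * r) ^+ 2 + K * (s * r) ^+ 3) ->
  rnorm (\sum_k c k * (rescaled (z k) T - z k) 0 i) <= m * r ^+ 2 + (K + 1024) * r ^+ 3.
Proof.
move=> r0 r32 m0 K0 T0 c1 zr hm; have z1 k : rnorm (z k) < 1 by have := zr k; lra.
have /choice[N NP] : forall k, exists N : set R, mu.-negligible N /\
  forall t, 0 <= t -> ~ N t -> path_derivative (rescaled (z k)) t
    ((expR t)%:C *: (phi 0 t (z k) + G (phi 0 t (z k)) t)).
  by move=> k; have [N N1 N2] := rescaled_derivative (z1 k); exists N.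
pose NN := ~` [set t | forall k, ~ N k t].
have NN0 : mu.-negligible NN.
  have FF : Filter (almost_everywhere mu) by exact: ae_filter_ringOfSetsType.
  have h : forall k, \forall t \near (almost_everywhere mu), ~ N k t.
    move=> k; have [Nk _] := NP k.
    have : almost_everywhere mu (fun t => ~ N k t).
      by rewrite /almost_everywhere; apply: negligibleS Nk => t /= /contrapT.
    exact.
  exact: (filter_forall FF h).
pose v t := \sum_k c k * rescaled (z k) t 0 i.
pose dv t := \sum_k c k * ((expR t)%:C *: (phi 0 t (z k) + G (phi 0 t (z k)) t)) 0 i.
pose k0 := m * r ^+ 2 + (K + 1024) * r ^+ 3.
have k00 : 0 <= k0.
  exact: (addr_ge0 (mulr_ge0 m0 (sqr_ge0 r)) (mulr_ge0 (addr_ge0 K0 (ler0n _ _)) (exprn_ge0 _ (ltW r0)))).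
have acv : ac_on 0 T v.
  apply: ac_on_sum => k.
  apply: (@ac_on_le _ _ _ _ _ (rnorm (c k)) 0 (rescaled (z k))).
    exact: rescaled_ac.
  move=> x y _ _ _; rewrite mul0r addr0 -mulrBr rnormM ler_wpM2l ?rnorm_ge0//.
  by have := rnorm_coord (rescaled (z k) y - rescaled (z k) x) i; rewrite !mxE.
have dvP t : 0 <= t -> t <= T -> ~ NN t -> path_derivative v t (dv t).
  move=> t0 _ /contrapT hN; apply: path_derivative_sum => k.
  by apply: path_derivative_coord; have [_] := NP k; apply.
have dvB t : 0 <= t -> t <= T -> rnorm (dv t) <= k0 * expR (- t).
  move=> t0 _; rewrite /dv (le_trans (rnorm_sum _ _ _))//.
  apply: (@le_trans _ _ (\sum_k rnorm (c k) * (k0 * expR (- t)))); last first.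
    by rewrite -mulr_suml ler_piMl// mulr_ge0 ?expR_ge0.
  apply: ler_sum => k _; rewrite rnormM ler_wpM2l ?rnorm_ge0//.
  have st1 : expR (- t) <= 1 by rewrite -expR0 ler_expR oppr_le0.
  exact: (rescaled_field_bound r0 r32 (zr k) t0 K0 (hm _ (classMG t0) k _ (expR_gt0 (- t)) st1)).
have := @mean_value_ac R _ v dv (fun s => - k0 * expR (- s)) (fun s => k0 * expR (- s)) NN 0 T T0
  acv NN0 dvP (fun t _ _ => is_derive_expNR k0 t).
rewrite oppr0 expR0 mulr1 opprK => h.
have vE : v T - v 0 = \sum_k c k * (rescaled (z k) T - z k) 0 i.
  rewrite /v -sumrB; apply: eq_bigr => k _.
  by rewrite rescaled0// -mulrBr !mxE.
rewrite -vE; apply: (@le_trans _ _ (- k0 * expR (- T) + k0)).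
  by apply: h => // t _ _; rewrite mulr_ge0 ?expR_ge0.
by rewrite -/k0 -lerBrDr subrr mulNr oppr_le0 mulr_ge0 ?expR_ge0.
Qed.

End Flow.

Lemma locally_uniform_pointwise (F : R -> Cn -> Cn) (f : Cn -> Cn) z :
  locally_uniform_limit F f -> rnorm z < 1 -> forall e : R, 0 < e ->
  exists T : R, forall t, T < t -> rnorm (F t z - f z) < e.
Proof.
move=> Ff z1 e e0; have zp : polydisc z by rewrite polydiscE.
have [U /nbhs_singleton Uz FU] := Ff z zp.
have sub : [set z] `<=` U by move=> w ->.
have := uniform_subset_cvg _ sub FU; rewrite uniform_set1 => cvgz.
have : nbhs (f z) [set w | rnorm (w - f z) < e] by apply/rnbhsP; exists e.
move=> /cvgz [T [_ hT]]; exists T => t /hT //.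
Qed.

Lemma classS0_functional (f : Cn -> Cn) (I : finType) (c : I -> C) (z : I -> Cn) (i : 'I_n)
    (r m K : R) :
  classS0 f -> 0 < r -> r <= 1 / 32 -> 0 <= m -> 0 <= K ->
  \sum_k rnorm (c k) <= 1 -> (forall k, rnorm (z k) <= r) ->
  (forall h : Cn -> Cn, classM h -> forall k (s : R), 0 < s -> s <= 1 ->
     rnorm (h (s%:C *: z k) 0 i + (s%:C *: z k) 0 i) <= m * (s * r) ^+ 2 + K * (s * r) ^+ 3) ->
  rnorm (\sum_k c k * (f (z k) 0 i - z k 0 i)) <= m * r ^+ 2 + (K + 1024) * r ^+ 3.
Proof.
move=> [_ [G [phi [hG hphi lim]]]] r0 r32 m0 K0 c1 zr hm.
apply/ler_addgt0Pr => /= e e0.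
have z1 k : rnorm (z k) < 1 by have := zr k; lra.
have /choice[T hT] : forall k, exists T : R, forall t, T < t ->
    rnorm (rescaled phi (z k) t - f (z k)) < e.
  by move=> k; exact: locally_uniform_pointwise lim (z1 k) e e0.
pose t : R := \sum_k `|T k| + 1.
have t0 : 0 <= t by rewrite addr_ge0// sumr_ge0.
have tT k : T k < t.
  rewrite (le_lt_trans (ler_norm _))// ltr_pwDr// (bigD1 k)//= lerDl sumr_ge0//.
have := rescaled_functional hG hphi r0 r32 m0 K0 t0 c1 zr hm.
set X := \sum_k c k * (rescaled phi _ _ - _) _ _ => HX.
have -> : \sum_k c k * (f (z k) 0 i - z k 0 i) =
    X - \sum_k c k * (rescaled phi (z k) t - f (z k)) 0 i.
  by rewrite /X -sumrB; apply: eq_bigr => k _; rewrite !mxE; ring.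
rewrite (le_trans (rnormB _ _))// lerD// (le_trans (rnorm_sum _ _ _))//.
apply: (@le_trans _ _ (\sum_k rnorm (c k) * e)); last by rewrite -mulr_suml ler_piMl// ltW.
apply: ler_sum => k _; rewrite rnormM ler_wpM2l ?rnorm_ge0//.
by rewrite (le_trans (rnorm_coord _ _))// ltW// hT.
Qed.

End LoewnerFlow.

(** * Isolating one coefficient with cube roots of unity *)

Section Coefficients.
#[local] Existing Instance totally_filter.
Context {R : realType} {n : nat}.
Local Notation C := R[i].
Local Notation Cn := 'rV[R[i]]_n.
Local Notation mindex_t := {ffun 'I_n -> nat}.
Implicit Types (a al : mindex_t).

Lemma cube_root_exists : exists om : C, om ^+ 3 = 1 /\ 1 + om + om ^+ 2 = 0.
Proof.
pose s : R := Num.sqrt 3.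
have s2 : s ^+ 2 = 3 by rewrite sqr_sqrtr.
pose om : C := (- (1 / 2)) +i* (s / 2).
have om2 : om ^+ 2 = (- (1 / 2)) +i* (- (s / 2)).
  rewrite expr2 /om; apply/eqP; rewrite eq_complex /=; apply/andP; split; apply/eqP; last by field.
  have -> : - (1 / 2) * - (1 / 2) - s / 2 * (s / 2) = 1 / 4 - s ^+ 2 / 4 by field.
  by rewrite s2; field.
have S : 1 + om + om ^+ 2 = 0.
  by rewrite om2 /om; apply/eqP; rewrite eq_complex /=; apply/andP; split; apply/eqP; field.
exists om; split=> //; apply/eqP; rewrite -subr_eq0.
have -> : om ^+ 3 - 1 = (om - 1) * (1 + om + om ^+ 2) by ring.
by rewrite S mulr0.
Qed.

Lemma monom_scale (c : C) (w : Cn) a : monom (c *: w) a = c ^+ mdeg a * monom w a.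
Proof.
rewrite /monom /mdeg -prodrXr -big_split /=; apply: eq_bigr => j _.
by rewrite mxE exprMn.
Qed.

Lemma rnorm_monom_le1 (w : Cn) a : rnorm w <= 1 -> rnorm (monom w a) <= 1.
Proof.
move=> w1; rewrite /monom; elim/big_rec: _ => [|j x _ x1]; first by rewrite rnorm1.
rewrite rnormM mulr_ile1 ?rnorm_ge0// rnormX exprn_ile1 ?rnorm_ge0//.
exact: le_trans (rnorm_coord _ _) w1.
Qed.

(* Evaluation points for the discrete Fourier inversion isolating the coefficient al: cube roots of
   unity in every coordinate, except that coordinate i vanishes if al does not involve it. *)
Section Fourier.
Variables (om : C) (i : 'I_n) (al : mindex_t).
Hypotheses (om3 : om ^+ 3 = 1) (oms : 1 + om + om ^+ 2 = 0) (ald : mdeg al = 2%N).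

Let I := {ffun 'I_n -> 'I_3}.

Definition fpoint (k : I) : Cn :=
  \row_j (if (j == i) && (al i == 0%N) then 0 else om ^+ k j).

(** As om^3 = 1, the exponent 2 al_j k_j stands for - al_j k_j: this is the conjugate character,
    divided by the order 3 in each coordinate. *)
Definition fcoef (k : I) : C := \prod_j (om ^+ (2 * al j * k j) / 3).

Lemma rnorm_om : rnorm om = 1.
Proof.
apply/eqP; rewrite -(@pexpr_eq1 _ _ 3) ?rnorm_ge0//.
by rewrite -rnormX om3 rnorm1.
Qed.

Lemma rnorm_fpoint k : rnorm (fpoint k) <= 1.
Proof.
apply: rnorm_row_le => // j; rewrite mxE; case: ifP => _; first by rewrite rnorm0.
by rewrite rnormX rnorm_om expr1n.
Qed.

Lemma rnorm_fpoint_i k : al i <> 0%N -> rnorm (fpoint k 0 i) = 1.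
Proof.
by move=> /eqP/negbTE h; rewrite mxE h andbF rnormX rnorm_om expr1n.
Qed.

Lemma fpoint_i0 k : al i = 0%N -> fpoint k 0 i = 0.
Proof. by move=> h; rewrite mxE h !eqxx. Qed.

Lemma sum_rnorm_fcoef : \sum_k rnorm (fcoef k) = 1.
Proof.
have E k : rnorm (fcoef k) = (3^-1) ^+ n.
  rewrite /fcoef (big_morph _ (@rnormM R) (@rnorm1 R)).
  rewrite (eq_bigr (fun _ => 3^-1)) => [|j _]; first by rewrite prodr_const card_ord.
  by rewrite rnormf_div rnormX rnorm_om expr1n -(realc_nat (R := R) 3) rnormC ger0_norm// mul1r.
rewrite (eq_bigr _ (fun k _ => E k)) sumr_const.
have -> : #|I| = (3 ^ n)%N by rewrite card_ffun !card_ord.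
rewrite -[_ *+ (3 ^ n)]mulr_natl natrX.
by rewrite -exprMn divff ?expr1n.
Qed.

Lemma sum_om_pow (e : nat) : \sum_(q < 3) om ^+ (e * q) / 3 = if (3 %| e)%N then 1 else 0 :> C.
Proof.
have om_mod m : om ^+ m = om ^+ (m %% 3).
  by rewrite {1}(divn_eq m 3) exprD mulnC exprM om3 expr1n mul1r.
rewrite !big_ord_recl big_ord0 addr0 /= -!mulrDl muln0 muln1 expr0 (om_mod e) (om_mod (e * 2)%N).
rewrite -modnMml; have := ltn_pmod e (isT : 0 < 3)%N; rewrite /dvdn.
case: (e %% 3)%N => [|[|[|]]] //= _.
- by rewrite !expr0; field.
- by rewrite expr1 addrA oms mul0r.
- by rewrite (_ : (2 * 2) %% 3 = 1)%N// expr1 [om ^+ 2 + om]addrC addrA oms mul0r.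
Qed.

(** The sum factors over coordinates. Exponents in degree 2 are at most 2, so 3 divides 2 al_j + a_j
    exactly when a_j = al_j, and otherwise the average over the j-th root vanishes. If al_i = 0, the
    i-th coordinate is 0 and its power a_i makes the same selection. *)
Lemma fourier_sum a : mdeg a = 2%N ->
  \sum_k fcoef k * monom (fpoint k) a = (a == al)%:R.
Proof.
move=> ad.
have le2 (b : mindex_t) j : mdeg b = 2%N -> (b j <= 2)%N.
  by move=> bd; rewrite -bd /mdeg (bigD1 j)//= leq_addr.
pose F j (q : 'I_3) : C := om ^+ (2 * al j * q) / 3 *
   (if (j == i) && (al i == 0%N) then 0 else om ^+ q) ^+ a j.
have -> : \sum_k fcoef k * monom (fpoint k) a = \sum_(k : I) \prod_j F j (k j).
  apply: eq_bigr => k _; rewrite /fcoef /monom -big_split /=; apply: eq_bigr => j _.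
  by rewrite /F mxE.
rewrite -(bigA_distr_bigA F).
have FE j : ~~ ((j == i) && (al i == 0%N)) ->
    \sum_(q < 3) F j q = if (3 %| 2 * al j + a j)%N then 1 else 0.
  move=> /negbTE h; rewrite -sum_om_pow; apply: eq_bigr => q _.
  by rewrite /F h -exprM mulrAC -exprD mulnDl [(a j * q)%N]mulnC.
have [aal|aal] := eqVneq a al.
  rewrite big1// => j _; have [h|h] := boolP ((j == i) && (al i == 0%N)); last first.
    by rewrite FE// aal -[X in (_ + X)%N]mul1n -mulnDl dvdn_mulr.
  move: (h) => /andP[/eqP ji /eqP al0].
  transitivity (\sum_(q < 3) om ^+ (0 * q) / 3); last by rewrite sum_om_pow dvdn0.
  apply: eq_bigr => q _.
  by rewrite /F h ji aal al0 expr0 mulr1 muln0 mul0n.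
have [j aj] : exists j, a j != al j.
  apply/existsP; rewrite -negb_forall; apply: contra aal => /forallP h.
  by apply/eqP/ffunP => j; apply/eqP.
rewrite (bigD1 j)//= (_ : \sum_q F j q = 0) ?mul0r//.
have [h|h] := boolP ((j == i) && (al i == 0%N)).
  move: (h) => /andP[/eqP ji /eqP al0]; rewrite big1// => q _.
  by rewrite /F h; move: aj; rewrite ji al0 => aj; rewrite expr0n (negbTE aj) mulr0.
rewrite FE//; have := le2 a j ad; have := le2 al j ald; move: aj.
by case: (a j) => [|[|[|]]] //; case: (al j) => [|[|[|]]].
Qed.

End Fourier.

Lemma sum_fset_eq (V : zmodType) (J K : {fset mindex_t}) (P Q : pred mindex_t)
    (F : mindex_t -> V) :
  (forall a, (a \in J) && P a = (a \in K) && Q a) ->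
  \sum_(a <- enum_fset J | P a) F a = \sum_(a <- enum_fset K | Q a) F a.
Proof.
move=> h; rewrite -big_filter -[RHS]big_filter; apply: perm_big.
apply: uniq_perm; rewrite ?filter_uniq ?fset_uniq// => a.
by rewrite !mem_filter andbC h andbC.
Qed.

(** Finite sums avoiding a suitable [J0] are bounded by 2, as differences of two sums within 1 of
    the limit. Restricted to the terms whose real or imaginary part has a given sign, they bound
    sums of absolute values: 2 for each sign, 4 for each part, 8 in all. *)
Lemma expansion_bounded (i : 'I_n) (f : Cn -> Cn) (A : mindex_t -> C) (z : Cn) :
  expansion i f A -> rnorm z < 1 ->
  exists B : R, forall J : {fset mindex_t},
    \sum_(a <- enum_fset J | (2 <= mdeg a)%N) rnorm (A a * monom z a) <= B.
Proof.
move=> hA z1; have := hA z; rewrite polydiscE => /(_ z1).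
pose t a : C := A a * monom z a; pose Q a := (2 <= mdeg a)%N.
set l := (_ - _) => Sl.
have /Sl : nbhs l [set w | rnorm (w - l) < 1] by apply/rnbhsP; exists 1.
move=> [J0 _ hJ0].
have hK (K : {fset mindex_t}) : {subset J0 <= K} ->
    rnorm (\sum_(a <- enum_fset K | Q a && (a \notin J0)) t a) <= 2.
  move=> JK; have h0 := hJ0 J0 (fsubset_refl _).
  have h1 : rnorm (\sum_(a <- enum_fset K | Q a) t a - l) < 1.
    by apply: hJ0; apply/fsubsetP.
  have -> : \sum_(a <- enum_fset K | Q a && (a \notin J0)) t a =
     (\sum_(a <- enum_fset K | Q a) t a - l) - (\sum_(a <- enum_fset J0 | Q a) t a - l).
    rewrite [X in _ = X - l - _](bigID (fun a => a \in J0)) /= (@sum_fset_eq _ K J0 (fun a => Q a && (a \in J0)) Q).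
      by ring.
    move=> a; have := JK a; case: (a \in J0) => [/(_ isT) ->|_]; last by rewrite !andbF.
    by rewrite andbT.
  rewrite (le_trans (rnormB _ _))// -[2]/(1 + 1 : R) lerD//; exact: ltW.
have half (la : C -> R) (J : {fset mindex_t}) (p : pred C) :
    {morph la : x y / x + y} -> la 0 = 0 -> (forall x, `|la x| <= rnorm x) ->
    `|\sum_(a <- enum_fset J | [&& Q a, a \notin J0 & p (t a)]) la (t a)| <= 2.
  move=> laD la0 lan.
  have -> : \sum_(a <- enum_fset J | [&& Q a, a \notin J0 & p (t a)]) la (t a) =
      la (\sum_(a <- enum_fset (J0 `|` [fset a in J | p (t a)])%fset | Q a && (a \notin J0)) t a).
    rewrite (big_morph la laD la0); apply: sum_fset_eq => a.
    rewrite !inE; case: (a \in J0); rewrite ?andbF//= !andbT.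
    by rewrite -andbA [p _ && _]andbC.
  apply: (le_trans (lan _)); apply: hK => a aJ.
  by rewrite inE aJ.
have part (la : C -> R) (J : {fset mindex_t}) :
    {morph la : x y / x + y} -> la 0 = 0 -> (forall x, `|la x| <= rnorm x) ->
    \sum_(a <- enum_fset J | Q a && (a \notin J0)) `|la (t a)| <= 4.
  move=> laD la0 lan.
  have h1 := half la J (fun x => 0 <= la x) laD la0 lan.
  have h2 := half la J (fun x => ~~ (0 <= la x)) laD la0 lan.
  rewrite (bigID (fun a => 0 <= la (t a))) /=.
  rewrite (_ : 4 = 2 + 2 :> R); last by rewrite -natrD.
  apply: lerD.
    apply: le_trans h1; apply: le_trans (ler_norm _).
    rewrite le_eqVlt; apply/orP; left; apply/eqP; apply: eq_big => a; first by rewrite andbA.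
    by move=> /andP[_ h]; rewrite ger0_norm.
  rewrite -normrN in h2; apply: le_trans h2; apply: le_trans (ler_norm _).
  rewrite -sumrN le_eqVlt; apply/orP; left; apply/eqP; apply: eq_big => a; first by rewrite andbA.
  by move=> /andP[_]; rewrite -ltNge => h; rewrite ltr0_norm.
exists (\sum_(a <- enum_fset J0 | Q a) rnorm (t a) + 8) => J.
rewrite (bigID (fun a => a \in J0)) /=; apply: lerD.
  rewrite [leRHS](bigID (fun a => a \in J)) /=.
  rewrite (@sum_fset_eq _ J J0 _ (fun a => Q a && (a \in J))).
    by rewrite lerDl sumr_ge0// => a _; exact: rnorm_ge0.
  by move=> a; rewrite -/(Q a); case: (a \in J); case: (a \in J0); rewrite ?andbF ?andbT.
apply: (@le_trans _ _ (\sum_(a <- enum_fset J | Q a && (a \notin J0)) (`|complex.Re (t a)| + `|complex.Im (t a)|))).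
  by apply: ler_sum => a _; exact: rnorm_le_ReIm.
rewrite big_split /= (_ : 8 = 4 + 4 :> R); last by rewrite -natrD.
apply: lerD; apply: part => //.
- exact: ReD.
- exact: Re_le_rnorm.
- exact: ImD.
- exact: Im_le_rnorm.
Qed.

Section FourierCoefficient.
Variables (om : C) (i : 'I_n) (al : mindex_t) (f : Cn -> Cn) (A : mindex_t -> C).
Hypotheses (om3 : om ^+ 3 = 1) (oms : 1 + om + om ^+ 2 = 0) (ald : mdeg al = 2%N).
Hypothesis hA : expansion i f A.

Local Notation fpoint := (fpoint om i al).
Local Notation fcoef := (fcoef om al).

(** In degree 2 only [al] survives the weights. A term of degree d >= 3 at radius r is at most (2
    r)^d <= (2 r)^3 times its modulus at (1/2, ..., 1/2), where the series converges absolutely;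
    hence the constant 8 B. *)
Lemma fourier_coefficient : exists2 B : R, 0 <= B & forall r : R, 0 < r -> r <= 1 / 2 ->
  rnorm (\sum_k fcoef k * (f (r%:C *: fpoint k) 0 i - (r%:C *: fpoint k) 0 i)
         - A al * (r ^+ 2)%:C) <= B * r ^+ 3.
Proof.
pose z0 : Cn := (1 / 2)%:C *: const_mx 1.
have z01 : rnorm z0 < 1.
  rewrite rnormZ rnormC ger0_norm// (@le_lt_trans _ _ (1 / 2 * 1))//; last by lra.
  by rewrite ler_wpM2l// rnorm_row_le// => j; rewrite mxE rnorm1.
have [B hB] := expansion_bounded hA z01.
have B0 : 0 <= B.
  by have := hB fset0; rewrite big_nil.
have mz0 a : monom z0 a = ((1 / 2) ^+ mdeg a)%:C.
  rewrite monom_scale realcX /monom big1 ?mulr1// => j _.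
  by rewrite mxE expr1n.
exists (8 * B); first by rewrite mulr_ge0.
move=> r r0 r2; apply/ler_addgt0Pr => /= e e0.
pose S k (J : {fset mindex_t}) := \sum_(a <- enum_fset J | (2 <= mdeg a)%N) A a * monom (r%:C *: fpoint k) a.
pose l k := f (r%:C *: fpoint k) 0 i - (r%:C *: fpoint k) 0 i.
have pk k : rnorm (r%:C *: fpoint k) < 1.
  rewrite rnormZ rnormC gtr0_norm// (@le_lt_trans _ _ (r * 1))//; last by lra.
  by rewrite ler_wpM2l ?(ltW r0)// rnorm_fpoint.
have near1 : \forall J \near totally, forall k, rnorm (S k J - l k) < e.
  apply: filter_forall => k; have hk : polydisc (r%:C *: fpoint k).
    rewrite polydiscE; exact: pk.
  have Sk := hA hk.
  by have /Sk : nbhs (l k) [set w | rnorm (w - l k) < e] by apply/rnbhsP; exists e.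
have near2 : \forall J \near totally, al \in (J : {fset mindex_t}).
  exists [fset al]%fset => // J /= /fsubsetP; apply; exact: fset11.
have [J [hJ alJ]] := filter_ex (filterI near1 near2).
have E : \sum_k fcoef k * l k - A al * (r ^+ 2)%:C =
    (\sum_k fcoef k * S k J - A al * (r ^+ 2)%:C) - \sum_k fcoef k * (S k J - l k).
  under [X in _ = _ - X]eq_bigr do rewrite mulrBr.
  by rewrite sumrB; ring.
rewrite E (le_trans (rnormB _ _))// lerD//; last first.
  rewrite (le_trans (rnorm_sum _ _ _))//.
  apply: (@le_trans _ _ (\sum_k rnorm (fcoef k) * e)).
    by apply: ler_sum => k _; rewrite rnormM ler_wpM2l ?rnorm_ge0// ltW.
  by rewrite -mulr_suml sum_rnorm_fcoef ?mul1r.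
pose D a := \sum_k fcoef k * monom (fpoint k) a.
have Dle1 a : rnorm (D a) <= 1.
  apply: (le_trans (rnorm_sum _ _ _)).
  apply: (@le_trans _ _ (\sum_k rnorm (fcoef k))); last by rewrite sum_rnorm_fcoef.
  apply: ler_sum => k _; rewrite rnormM ler_piMr ?rnorm_ge0//.
  by apply: rnorm_monom_le1; exact: rnorm_fpoint.
have SE : \sum_k fcoef k * S k J =
    \sum_(a <- enum_fset J | (2 <= mdeg a)%N) A a * (r ^+ mdeg a)%:C * D a.
  rewrite /S; under eq_bigr do rewrite mulr_sumr.
  rewrite exchange_big /=; apply: eq_bigr => a _; rewrite mulr_sumr; apply: eq_bigr => k _.
  by rewrite monom_scale realcX; ring.
rewrite SE (bigID (fun a => mdeg a == 2%N)) /=.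
have -> : \sum_(a <- enum_fset J | (2 <= mdeg a)%N && (mdeg a == 2%N)) A a * (r ^+ mdeg a)%:C * D a
    = A al * (r ^+ 2)%:C.
  rewrite (eq_bigl (fun a => mdeg a == 2%N)); last first.
    by move=> a; case: eqP => [->|_]; rewrite ?andbF.
  have DE a : mdeg a = 2%N -> D a = (a == al)%:R.
    by move=> ad; exact: (fourier_sum i om3 oms ald ad).
  rewrite (bigID (fun a => a == al)) /= [X in _ + X]big1 ?addr0; last first.
    by move=> a /andP[/eqP /DE -> /negbTE ->]; rewrite mulr0.
  rewrite (@sum_fset_eq _ J [fset al]%fset _ predT) => [|a].
    by rewrite big_seq_fset1 (DE al ald) eqxx mulr1 ald.
  by rewrite [in RHS]inE andbT; have [->|_] := eqVneq a al; rewrite ?andbF// ald alJ.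
rewrite [X in rnorm X]addrAC subrr add0r (le_trans (rnorm_sum _ _ _))//.
apply: (@le_trans _ _ (\sum_(a <- enum_fset J | (2 <= mdeg a)%N) rnorm (A a * monom z0 a) * (2 * r) ^+ 3)); last first.
  rewrite -mulr_suml exprMn mulrA -natrX [8 * B]mulrC -mulrA -[B * 8 * _]mulrA.
  by rewrite ler_wpM2r// mulr_ge0// exprn_ge0// ltW.
rewrite [leRHS](bigID (fun a => mdeg a == 2%N)) /= -[leLHS]add0r lerD//.
  by rewrite sumr_ge0// => a _; rewrite mulr_ge0 ?rnorm_ge0// exprn_ge0// mulr_ge0// ltW.
apply: ler_sum => a /andP[a2 an2].
have a3 : (3 <= mdeg a)%N by rewrite ltn_neqAle eq_sym an2.
rewrite mz0 !rnormM !rnormC -mulrA -mulrA ler_wpM2l ?rnorm_ge0//.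
rewrite !ger0_norm ?exprn_ge0 ?(ltW r0)//.
rewrite (@le_trans _ _ (r ^+ mdeg a * 1))//.
  by rewrite ler_wpM2l// exprn_ge0// ltW.
have -> : r ^+ mdeg a * 1 = (1 / 2) ^+ mdeg a * (2 * r) ^+ mdeg a.
  by rewrite -exprMn mulr1; congr (_ ^+ _); field.
have r20 : 0 <= 2 * r by rewrite mulr_ge0// ltW.
rewrite ler_wpM2l ?exprn_ge0// -(subnK a3) exprD ler_piMl ?exprn_ge0// exprn_ile1//.
by lra.
Qed.

Let small_radius (L e : R) : 0 < L -> 0 < e -> exists r, [/\ 0 < r, r <= 1 / 32 & L * r <= e].
Proof.
move=> L0 e0; exists (Num.min (1 / 32) (e / L)); split.
- by rewrite lt_min !divr_gt0.
- by rewrite ge_min lexx.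
- by rewrite mulrC -ler_pdivlMr// ge_min lexx orbT.
Qed.

(** All errors are cubic in r, so dividing by r^2 and letting r tend to 0 leaves m. What remains to
    be supplied is an estimate of h_i + z_i at multiples of the points [fpoint]. *)
Lemma coefficient_bound (m K : R) : classS0 f -> 0 <= m -> 0 <= K ->
  (forall h : Cn -> Cn, classM h -> forall k (s : R), 0 < s -> s <= 1 / 32 ->
     rnorm (h (s%:C *: fpoint k) 0 i + (s%:C *: fpoint k) 0 i) <= m * s ^+ 2 + K * s ^+ 3) ->
  rnorm (A al) <= m.
Proof.
move=> fS m0 K0; have [B B0] := fourier_coefficient.
pose L := B + K + 1024.
have L0 : 0 < L by apply: ltr_wpDl; [exact: addr_ge0 | rewrite ltr0n].
move=> hB hm; apply/ler_addgt0Pr => /= e e0.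
have [r [r0 r32 rL]] := small_radius L0 e0.
have F : rnorm (\sum_k fcoef k * (f (r%:C *: fpoint k) 0 i - (r%:C *: fpoint k) 0 i))
    <= m * r ^+ 2 + (K + 1024) * r ^+ 3.
  apply: (classS0_functional fS r0 r32 m0 K0).
  - by rewrite sum_rnorm_fcoef.
  - move=> k; rewrite rnormZ rnormC gtr0_norm// -[leRHS]mulr1 ler_wpM2l ?(ltW r0)//.
    exact: rnorm_fpoint.
  - move=> h hM k s s0 s1; rewrite scalerA -realcM; apply: hm => //; first exact: mulr_gt0.
    by apply: le_trans r32; rewrite ler_piMl// ltW.
have r2 : r <= 1 / 2 by apply: (le_trans r32); lra.
have E := hB r r0 r2.
have : rnorm (A al * (r ^+ 2)%:C) <= m * r ^+ 2 + (K + 1024) * r ^+ 3 + B * r ^+ 3.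
  apply: le_trans (lerD F E); rewrite -[X in _ <= _ + X]rnormN opprB.
  by apply: le_trans (rnormD _ _); rewrite subrKC.
rewrite rnormM rnormC ger0_norm ?sqr_ge0// => H.
rewrite -(@ler_pM2r _ (r ^+ 2)) ?exprn_gt0// (le_trans H)//.
have -> : m * r ^+ 2 + (K + 1024) * r ^+ 3 + B * r ^+ 3 = (m + L * r) * r ^+ 2.
  by rewrite /L; ring.
by rewrite ler_wpM2r ?sqr_ge0// lerD2l.
Qed.

End FourierCoefficient.

Lemma coefficient_bound2 (i : 'I_n) (f : Cn -> Cn) (A : mindex_t -> C) al :
  classS0 f -> expansion i f A -> mdeg al = 2%N -> al i <> 0%N -> rnorm (A al) <= 2.
Proof.
move=> fS hA ald ali; have [om [om3 oms]] := cube_root_exists.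
(* K = 4 absorbs the denominator: 2 s^2 / (1 - s) <= 2 s^2 + 4 s^3 for s <= 1/2. *)
apply: (coefficient_bound (K := 4) om3 oms ald hA fS) => // h hM k s s0 s32.
set z := s%:C *: fpoint om i al k.
have zi : rnorm (z 0 i) = s by rewrite mxE rnormM (rnorm_fpoint_i om3 k ali) mulr1 rnormC gtr0_norm.
have zs : rnorm z = s.
  apply/eqP; rewrite eq_le -[X in _ && (X <= _)]zi rnorm_coord andbT.
  rewrite rnormZ rnormC gtr0_norm// -[leRHS]mulr1 ler_wpM2l ?(ltW s0)//.
  exact: rnorm_fpoint.
have := classM_maximal_coord (i := i) hM _ (etrans zs (esym zi)); rewrite zs => /(_ _) H.
have s1 : s < 1 by apply: le_lt_trans s32 _; lra.
apply: (le_trans (H s1)); rewrite ler_pdivrMr ?subr_gt0//.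
have q : 0 <= s ^+ 3 by rewrite exprn_ge0// ltW.
have -> : (2 * s ^+ 2 + 4 * s ^+ 3) * (1 - s) = 2 * s ^+ 2 + s ^+ 3 * (2 - 4 * s) by ring.
by rewrite lerDl mulr_ge0//; lra.
Qed.

Lemma coefficient_bound1 (i : 'I_n) (f : Cn -> Cn) (A : mindex_t -> C) al :
  classS0 f -> expansion i f A -> mdeg al = 2%N -> al i = 0%N -> rnorm (A al) <= 1.
Proof.
move=> fS hA ald ali; have [om [om3 oms]] := cube_root_exists.
(* K = 32 is the cubic coefficient in s^2 (1 + 32 s), the bound at points whose i-th coordinate
   vanishes. *)
apply: (coefficient_bound (K := 32) om3 oms ald hA fS) => // h hM k s s0 s32.
set z := s%:C *: fpoint om i al k.
have zi : z 0 i = 0 by rewrite mxE (fpoint_i0 om k ali) mulr0.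
have zs : rnorm z <= s.
  rewrite rnormZ rnormC gtr0_norm// -[leRHS]mulr1 ler_wpM2l ?(ltW s0)//.
  exact: rnorm_fpoint.
have z4 : rnorm z <= 1 / 4 by apply: (le_trans zs); lra.
rewrite zi addr0 (le_trans (classM_zero_coord hM zi z4))//.
apply: (@le_trans _ _ (s ^+ 2 * (1 + 32 * s))); last first.
  by rewrite le_eqVlt; apply/orP; left; apply/eqP; ring.
apply: ler_pM; rewrite ?sqr_ge0 ?addr_ge0 ?mulr_ge0 ?rnorm_ge0//.
  by rewrite lerXn2r ?nnegrE ?rnorm_ge0// ltW.
by rewrite lerD2l ler_wpM2l.
Qed.

End Coefficients.

(** * Autonomous Loewner flows *)

Section ComplexDerivative.
Context {R : realType}.
Local Notation C := R[i].
Implicit Types (f q : C -> C) (z l : C).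

Definition has_derivative f z l :=
  forall e : R, 0 < e -> exists2 d : R, 0 < d & forall w, rnorm (w - z) < d ->
    rnorm (f w - f z - l * (w - z)) <= e * rnorm (w - z).

(** Caratheodory's form of the derivative: an explicit factor q, continuous at z, reduces
    differentiation of the explicit flows to an algebraic identity. *)
Lemma has_derivative_quotient f q z : (\forall w \near z, f w - f z = (w - z) * q w) ->
  {for z, continuous q} -> has_derivative f z (q z).
Proof.
move=> /rnbhsP[d1 d10 h1] /continuous_rnormP hq e e0.
have [d2 d20 h2] := hq e e0; exists (Num.min d1 d2); first by rewrite lt_min d10.
move=> w; rewrite lt_min => /andP[wd1 wd2]; rewrite h1//.
have -> : (w - z) * q w - q z * (w - z) = (q w - q z) * (w - z) by ring.
by rewrite rnormM ler_wpM2r ?rnorm_ge0// ltW// h2.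
Qed.

Lemma has_derivative_cst (c z : C) : has_derivative (fun _ => c) z 0.
Proof.
move=> e e0; exists 1 => // w _; rewrite subrr mul0r subr0 rnorm0.
by rewrite mulr_ge0 ?rnorm_ge0// ltW.
Qed.

Lemma differentiable_littleo (V : normedModType C) (g : V -> C) (v : V) :
  (forall e : R, 0 < e -> exists2 d : R, 0 < d & forall w, rnorm (w - v) < d ->
     rnorm (g w - g v) <= e * rnorm (w - v)) -> differentiable g v.
Proof.
move=> gv.
have Lc : continuous (\0 : V -> C) by exact: cst_continuous.
have E : g \o shift v = cst (g v) + \0 +o_ (nbhs (0 : V)) id.
  apply/eqaddoP => _/posnumP[e]; set e' := complex.Re e%:num.
  have eE : e%:num = e'%:C.
    by rewrite /e' RRe_real// ger0_real.
  have e0 : 0 < e' by have := [gt0 of e%:num]; rewrite eE ltcR.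
  have [d d0 hd] := gv _ e0; apply/rnbhsP; exists d => // w; rewrite subr0 => wd.
  rewrite !fctE /= addr0 eE !normE -rmorphM /= lecR.
  by have := hd (w + v); rewrite addrK => /(_ wd).
have D := diff_unique (df := \0) Lc E; apply/diff_locallyP; rewrite D.
by split.
Qed.

Lemma has_derivative_differentiable f z l : has_derivative f z l -> differentiable f z.
Proof.
move=> fl.
have -> : f = (fun w => l * w + (f w - l * w)) by apply/funext => w; rewrite subrKC.
apply: diffc_add; first by apply: diffc_mul; [exact: diffc_cst | exact: diffc_id].
apply: differentiable_littleo => e e0; have [d d0 hd] := fl e e0; exists d => // w wd.
have -> : f w - l * w - (f z - l * z) = f w - f z - l * (w - z) by ring.
exact: hd.
Qed.

End ComplexDerivative.

Section PathCalculus.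
Context {R : realType}.
Local Notation C := R[i].

Lemma has_derivative_path (f : C -> C) (x : R) (l : C) : has_derivative f x%:C l ->
  path_derivative (fun y : R => f y%:C) x l.
Proof.
move=> fl e e0; have [d d0 hd] := fl e e0; exists d => // h hh.
have E : (x + h)%:C - x%:C = h%:C by rewrite realcD; ring.
have := hd (x + h)%:C; rewrite E rnormC => /(_ hh).
by rewrite [l * _]mulrC.
Qed.

Lemma path_derivative_comp (V : normedModType C) (u : R -> V) (g : R -> R) (t k : R) (l : V) :
  path_derivative u (g t) l -> is_derive t (1 : R) g k ->
  path_derivative (fun s => u (g s)) t (k%:C *: l).
Proof.
move=> ul gk e e0; pose K := `|k| + 1 + rnorm l.
have k1 : 0 < `|k| + 1 by rewrite ltr_wpDl.
have K0 : 0 < K by rewrite ltr_wpDr ?rnorm_ge0.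
pose e1 := Num.min (e / K) 1.
have e10 : 0 < e1 by rewrite lt_min divr_gt0 ?ltr01.
have e11 : e1 <= 1 by rewrite ge_min lexx orbT.
have eK : e1 * K <= e by rewrite -ler_pdivlMr// ge_min lexx.
have [d1 d10 h1] := ul _ e10; have [d2 d20 h2] := is_derive_epsilon gk e10.
exists (Num.min d2 (d1 / (`|k| + 1))); first by rewrite lt_min d20 divr_gt0.
move=> h; rewrite lt_min ltr_pdivlMr// => /andP[hd2 hd1].
have X := h2 h hd2; set h' := g (t + h) - g t in X.
have hp := normr_ge0 h.
have Y : `|h'| <= `|h| * (`|k| + 1).
  have -> : h' = (h' - k * h) + k * h by ring.
  rewrite (le_trans (ler_normD _ _))// normrM.
  have : e1 * `|h| <= 1 * `|h| by rewrite ler_wpM2r.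
  lra.
have := h1 h' (le_lt_trans Y hd1); rewrite /h' subrKC -/h' => Z.
have -> : u (g (t + h)) - u (g t) - h%:C *: (k%:C *: l) =
    (u (g (t + h)) - u (g t) - h'%:C *: l) + (h' - k * h)%:C *: l.
  rewrite scalerA -realcM [h * k]mulrC realcB scalerBl addrA subrK//.
rewrite (le_trans (rnormD _ _))// rnormZ rnormC.
apply: (@le_trans _ _ (e1 * (`|h| * (`|k| + 1)) + e1 * `|h| * rnorm l)).
  apply: lerD; last by rewrite ler_wpM2r ?rnorm_ge0.
  by apply: (le_trans Z); rewrite ler_wpM2l// ltW.
have -> : e1 * (`|h| * (`|k| + 1)) + e1 * `|h| * rnorm l = e1 * K * `|h| by rewrite /K; ring.
by rewrite ler_wpM2r.
Qed.

Lemma path_derivative_row (n : nat) (u : R -> 'rV[C]_n) (t : R) (l : 'rV[C]_n) :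
  (forall j, path_derivative (fun s => u s 0 j) t (l 0 j)) -> path_derivative u t l.
Proof.
move=> ul e e0.
have /choice[d hd] : forall j, exists d : R, 0 < d /\ forall h : R, `|h| < d ->
    rnorm (u (t + h) 0 j - u t 0 j - h%:C * l 0 j) <= e * `|h|.
  by move=> j; have [d d0 hd] := ul j e e0; exists d.
exists (\big[Num.min/1]_j d j).
  by elim/big_ind: _ => // [x y x0 y0|j _]; [rewrite lt_min x0 | case: (hd j)].
move=> h hh; apply: rnorm_row_le => [|j]; first by rewrite mulr_ge0// ltW.
rewrite !mxE; apply: (hd j).2; apply: (lt_le_trans hh).
exact: bigmin_le_cond.
Qed.

End PathCalculus.

Section AutonomousFlow.
Context {R : realType} {n : nat}.
Local Notation C := R[i].
Local Notation Cn := 'rV[R[i]]_n.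
Implicit Types (z w : Cn) (x y r : R).

Lemma jacobian_quadratic (f : Cn -> Cn) (s : C) (K : R) :
  (forall z, rnorm z <= 1 / 2 -> rnorm (f z - s *: z) <= K * rnorm z ^+ 2) ->
  f 0 = 0 /\ 'J f 0 = s%:M.
Proof.
move=> fK.
have f0 : f 0 = 0.
  apply/eqP; rewrite -rnorm_eq0 -normr_le0 ger0_norm ?rnorm_ge0//.
  have := fK 0; rewrite rnorm0 scaler0 subr0 expr0n mulr0; apply.
  by rewrite divr_ge0.
split=> //.
have Lc : continuous ( *:%R s : Cn -> Cn).
  by move=> w; apply: continuousZl_tmp; exact: cvg_id.
have E : f \o shift 0 = cst (f 0) + ( *:%R s) +o_ (nbhs (0 : Cn)) id.
  apply/eqaddoP => _/posnumP[e]; set e' := complex.Re e%:num.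
  have eE : e%:num = e'%:C by rewrite /e' RRe_real// ger0_real.
  have e0 : 0 < e' by have := [gt0 of e%:num]; rewrite eE ltcR.
  have K1 : 0 < `|K| + 1 by rewrite ltr_wpDl.
  apply/rnbhsP; exists (Num.min (1 / 2) (e' / (`|K| + 1))).
    by rewrite lt_min !divr_gt0.
  move=> w; rewrite subr0 lt_min => /andP[w1]; rewrite ltr_pdivlMr// => w2.
  rewrite !fctE /= addr0 f0 add0r eE !normE -rmorphM /= lecR.
  apply: (le_trans (fK _ (ltW w1))); rewrite expr2 mulrA ler_wpM2r ?rnorm_ge0//.
  apply: le_trans (ltW w2); rewrite mulrC ler_wpM2l ?rnorm_ge0//.
  by rewrite (le_trans (ler_norm _))// lerDl.
have D := diff_unique (df := *:%R s) Lc E.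
by apply/row_matrixP => i; rewrite rowE -jacobian_mul D rowE mul_mx_scalar.
Qed.

Section Flow.
Variables (Psi : C -> Cn -> Cn) (P : R -> Cn -> Cn) (G : Cn -> Cn).

(** The conditions are imposed coordinate by coordinate, so that maps with coordinates of several
    kinds are assembled from ready-made pieces. P is the derivative of Psi in x; since x = e^(s - t)
    has derivative - x, [fc_ode] is the Loewner equation for x Psi(x, z). The bound P = O(|z|^2),
    uniform for x in [0, 1], yields the normalisation of Psi(0, .), the Lipschitz dependence on x
    and the locally uniform limit. *)
Record flow_coord (l : 'I_n) : Prop := FlowCoord {
  fc_diff : forall x z, 0 <= x -> x <= 1 -> rnorm z < 1 ->
    differentiable (fun z => Psi x%:C z 0 l) z;
  fc_one : forall z, rnorm z < 1 -> Psi 1 z 0 l = z 0 l;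
  fc_lt1 : forall x z, 0 < x -> x <= 1 -> rnorm z < 1 -> rnorm (x%:C * Psi x%:C z 0 l) < 1;
  fc_deriv : forall x z, 0 <= x -> x <= 1 -> rnorm z < 1 ->
    has_derivative (fun c : C => Psi c z 0 l) x%:C (P x z 0 l);
  fc_ode : forall x z, 0 < x -> x <= 1 -> rnorm z < 1 ->
    G (x%:C *: Psi x%:C z) 0 l = - (x%:C * (Psi x%:C z 0 l + x%:C * P x z 0 l));
  fc_bound : forall r, r < 1 -> exists2 K : R, 0 <= K & forall x z, 0 <= x -> x <= 1 ->
    rnorm z <= r -> rnorm (P x z 0 l) <= K * rnorm z ^+ 2;
  fc_field : forall z, rnorm z < 1 -> differentiable (fun z => G z 0 l) z;
  fc_re : forall z, rnorm z < 1 -> rnorm z = rnorm (z 0 l) -> z 0 l != 0 ->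
    complex.Re (G z 0 l / z 0 l) <= 0 }.

Hypothesis coord : forall l, flow_coord l.
Hypothesis inj : forall x z w, 0 <= x -> x <= 1 -> rnorm z < 1 -> rnorm w < 1 ->
  Psi x%:C z = Psi x%:C w -> z = w.

Let Psi1 z : rnorm z < 1 -> Psi 1 z = z.
Proof. by move=> z1; apply/rowP => l; rewrite (fc_one (coord l) z1). Qed.

Let P_bound r : r < 1 -> exists2 K : R, 0 <= K & forall x z, 0 <= x -> x <= 1 ->
  rnorm z <= r -> rnorm (P x z) <= K * rnorm z ^+ 2.
Proof.
move=> r1; have /choice[K hK] : forall l, exists K : R, 0 <= K /\ forall x z, 0 <= x -> x <= 1 ->
    rnorm z <= r -> rnorm (P x z 0 l) <= K * rnorm z ^+ 2.
  by move=> l; have [K K0 hK] := fc_bound (coord l) r1; exists K.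
have K0 l : 0 <= K l by case: (hK l).
exists (\sum_l K l); first by rewrite sumr_ge0.
move=> x z x0 x1 zr; apply: rnorm_row_le => [|l].
  by rewrite mulr_ge0 ?sumr_ge0// exprn_ge0// rnorm_ge0.
apply: (le_trans ((hK l).2 x z x0 x1 zr)); rewrite ler_wpM2r ?exprn_ge0 ?rnorm_ge0//.
by rewrite (bigD1 l)//= lerDl sumr_ge0.
Qed.

Let Psi_derivative x z : 0 <= x -> x <= 1 -> rnorm z < 1 ->
  path_derivative (fun x => Psi x%:C z) x (P x z).
Proof.
move=> x0 x1 z1; apply: path_derivative_row => l.
exact: has_derivative_path (fc_deriv (coord l) x0 x1 z1).
Qed.

Let Psi_lipschitz r : r < 1 -> exists2 K : R, 0 <= K & forall x y z, 0 <= x -> x <= y -> y <= 1 ->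
  rnorm z <= r -> rnorm (Psi y%:C z - Psi x%:C z) <= K * rnorm z ^+ 2 * (y - x).
Proof.
move=> r1; have [K K0 hK] := P_bound r1; exists K => // x y z x0 xy y1 zr.
have z1 := le_lt_trans zr r1.
pose k := K * rnorm z ^+ 2.
have := @mean_value_path _ _ (fun x => Psi x%:C z) (P ^~ z) (fun s => k * s) (fun=> k) x y xy.
rewrite -mulrBr; apply.
- move=> t xt ty; apply: Psi_derivative => //; first exact: le_trans xt.
  exact: le_trans y1.
- by move=> t _ _; apply: is_derive_eq; rewrite /GRing.scale /= mulr1.
- move=> t xt ty; apply: hK => //; first exact: le_trans xt.
  exact: le_trans y1.
Qed.

Let holomorphicP x : 0 <= x -> x <= 1 -> holomorphic (Psi x%:C).
Proof.
move=> x0 x1 z; rewrite polydiscE => z1.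
have -> : Psi x%:C = (fun z => \row_l Psi x%:C z 0 l).
  by apply/funext => w; apply/rowP => l; rewrite mxE.
by apply: diff_row => l; exact: fc_diff (coord l) _ _ x0 x1 z1.
Qed.

Let univalentP x : 0 <= x -> x <= 1 -> univalent (Psi x%:C).
Proof.
move=> x0 x1; split; first exact: holomorphicP.
move=> z w; rewrite !inE !polydiscE => z1 w1; exact: inj.
Qed.

Let normalized : Psi 0 0 = 0 /\ 'J (Psi 0) 0 = 1%:M.
Proof.
have h1 : 1 / 2 < 1 :> R by lra.
have [K K0 hK] := Psi_lipschitz h1.
apply: (@jacobian_quadratic _ _ K) => z z2; have z1 := le_lt_trans z2 h1.
rewrite scale1r rdistC -[X in rnorm (X - _)](Psi1 z1).
by have := hK 0 1 z (lexx _) ler01 (lexx _) z2; rewrite subr0 mulr1.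
Qed.

Let classM_G : classM G.
Proof.
have hol : holomorphic G.
  move=> z; rewrite polydiscE => z1.
  have -> : G = (fun z => \row_l G z 0 l).
    by apply/funext => w; apply/rowP => l; rewrite mxE.
  by apply: diff_row => l; exact: fc_field (coord l) _ z1.
have h1 : 1 / 2 < 1 :> R by lra.
have [K K0 hK] := P_bound h1.
have [|G0 JG] := @jacobian_quadratic G (- 1) K.
  move=> z z2; have z1 := le_lt_trans z2 h1.
  (* The flow equation at x = 1, where Psi is the identity, reads G z = - z - P 1 z. *)
  suff -> : G z - (-1) *: z = - P 1 z by rewrite rnormN; exact: hK.
  apply/rowP => l; have := fc_ode (coord l) ltr01 (lexx _) z1.
  by rewrite realc1 scale1r (Psi1 z1) !mul1r !mxE => ->; ring.
split=> //; first by rewrite JG; apply/matrixP => i j; rewrite !mxE mulNrn.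
move=> z l; rewrite polydiscE normE [X in _ = X]normE => z1 /complexI zl.
rewrite normr_gt0 => zl0; exact: fc_re (coord l) _ z1 zl zl0.
Qed.

Let phi (s t : R) z : Cn := (expR (s - t))%:C *: Psi (expR (s - t))%:C z.

Let phi_derivative s t z : s <= t -> rnorm z < 1 -> path_derivative (phi s ^~ z) t (G (phi s t z)).
Proof.
move=> st z1; set x := expR (s - t).
have x0 : 0 < x by exact: expR_gt0.
have x1 : x <= 1 by rewrite -expR0 ler_expR subr_le0.
have D1 : path_derivative (fun y => Psi (expR y)%:C z) (s - t) (x%:C *: P x z).
  exact: (path_derivative_comp (u := fun y => Psi y%:C z) (Psi_derivative (ltW x0) x1 z1) (is_derive_expR _)).
have D2 : is_derive t (1 : R) (fun t => s - t) (- 1).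
  by apply: (is_derive_eq (is_deriveB (is_derive_cst s t 1) (is_derive_id t 1))); rewrite sub0r.
have := path_derivative_comp (g := fun t : R => s - t) (path_derivative_expR D1) D2.
suff -> : (- 1)%:C *: ((expR (s - t))%:C *: (Psi (expR (s - t))%:C z + x%:C *: P x z)) = G (phi s t z) by [].
apply/rowP => l; rewrite /phi -/x (fc_ode (coord l) x0 x1 z1) !mxE realcN realc1; ring.
Qed.

Theorem flow_classS0 : classS0 (Psi 0).
Proof.
have [Psi0 J0] := normalized.
split; first by split=> //; rewrite -realc0; exact: univalentP.
exists (fun z _ => G z), phi; split.
- by split=> [//|z j _]; split; exact: measurable_cst.
- split=> [s t s0 st|s z s0]; last rewrite polydiscE => z1.
    set x := expR (s - t).
    have x0 : 0 < x by exact: expR_gt0.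
    have x1 : x <= 1 by rewrite -expR0 ler_expR subr_le0.
    have [hol injx] := univalentP (ltW x0) x1.
    split; first split.
    - move=> z /hol dz; exact: differentiableZ.
    - move=> z w zP wP /scalerI; rewrite realc_eq0 gt_eqF// => /(_ isT); exact: injx.
    - move=> z; rewrite !polydiscE => z1; apply: rnorm_row_lt => // l.
      by rewrite mxE; exact: fc_lt1 (coord l) _ _ x0 x1 z1.
  split.
  - by rewrite /phi subrr expR0 realc1 scale1r Psi1.
  - move=> T sT; have [K K0 hK] := P_bound z1; have [L L0 hL] := Psi_lipschitz z1.
    (* A bound on |G(phi)| = x |Psi + x P|: Psi(x, z) is within L |z|^2 of Psi(1, z) = z, and P is
       at most K |z|^2. *)
    pose B := rnorm z + L * rnorm z ^+ 2 + K * rnorm z ^+ 2.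
    apply: (@abs_continuous_lipschitz _ _ _ _ B) => a b sa ab bT.
    have := @mean_value_path _ _ (phi s ^~ z) (fun t => G (phi s t z)) (fun t => B * t) (fun=> B) a b ab.
    rewrite -mulrBr; apply.
    - move=> t at_ tb; apply: phi_derivative => //; exact: le_trans at_.
    - by move=> t _ _; apply: is_derive_eq; rewrite /GRing.scale /= mulr1.
    - move=> t at_ tb; have st := le_trans sa at_.
      set x := expR (s - t).
      have x0 : 0 < x by exact: expR_gt0.
      have x1 : x <= 1 by rewrite -expR0 ler_expR subr_le0.
      have -> : G (phi s t z) = - (x%:C *: (Psi x%:C z + x%:C *: P x z)).
        by apply/rowP => l; rewrite /phi -/x (fc_ode (coord l) x0 x1 z1) !mxE.
      rewrite rnormN rnormZ rnormC gtr0_norm//.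
      apply: (@le_trans _ _ (1 * (rnorm (Psi x%:C z) + rnorm (P x z)))).
        apply: ler_pM; rewrite ?(ltW x0) ?rnorm_ge0// (le_trans (rnormD _ _))// lerD2l.
        by rewrite rnormZ rnormC gtr0_norm// ler_piMl ?rnorm_ge0.
      rewrite mul1r /B lerD//; last exact: hK (ltW x0) x1 (lexx _).
      have -> : Psi x%:C z = z - (Psi 1%:C z - Psi x%:C z).
        by rewrite realc1 (Psi1 z1) subKr.
      rewrite (le_trans (rnormB _ _))// lerD2l.
      apply: (le_trans (hL x 1 z (ltW x0) x1 (lexx _) (lexx _))).
      rewrite ler_piMr ?mulr_ge0 ?exprn_ge0 ?rnorm_ge0//.
      by rewrite lerBlDr lerDl ltW.
  - apply: aeW => t st; exact: (path_cvg_derivative (phi s ^~ z) t _).2 (phi_derivative st z1).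
- move=> z; rewrite polydiscE => z1; pose r := (1 + rnorm z) / 2.
  have r1 : r < 1 by rewrite /r; lra.
  exists [set w | rnorm w < r].
    apply/rnbhsP; exists (r - rnorm z); first by rewrite /r; lra.
    move=> w wz; have := rnormD (w - z) z; rewrite subrK /= => H; lra.
  have [L L0 hL] := Psi_lipschitz r1.
  move=> A /= /uniform_nbhs[E [+ EA]].
  rewrite -entourage_ballE => -[e /= e0 eE].
  have eR : e = (complex.Re e)%:C by rewrite RRe_real// ger0_real// ltW.
  rewrite eR ltcR in e0; set e' := complex.Re e in e0 eR.
  have L1 : 0 < L + 1 by rewrite ltr_wpDl.
  (* Beyond this time x = e^-t satisfies x (L + 1) < e', while e^t phi_{0,t}(w) = Psi(x, w) lies
     within L x of Psi(0, w). *)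
  exists (Num.max 0 (- ln (e' / (L + 1)))); split; first exact: num_real.
  move=> t; rewrite gt_max => /andP[t0 ht]; apply: EA => w /= wr; apply: eE; rewrite -ball_normE /= eR normlt rdistC.
  set x := expR (- t).
  have x0 : 0 < x by exact: expR_gt0.
  have xe : x * (L + 1) < e'.
    rewrite -ltr_pdivlMr// -[ltRHS]lnK ?posrE ?divr_gt0// ltr_expR ltrNl//.
  rewrite /phi sub0r -/x scalerA -realcM /x expRN divff ?gt_eqF ?expR_gt0// scale1r -expRN -/x.
  have x1 : x <= 1 by rewrite -expR0 ler_expR oppr_le0 ltW.
  have := hL 0 x w (lexx _) (ltW x0) x1 (ltW wr); rewrite subr0 realc0 => H.
  apply: (le_lt_trans H); apply: le_lt_trans xe; rewrite mulrC ler_wpM2l ?(ltW x0)//.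
  apply: (@le_trans _ _ (L * 1)); last by rewrite mulr1 lerDl.
  by rewrite ler_wpM2l// exprn_ile1 ?rnorm_ge0// ltW// (lt_trans wr).
Qed.

End Flow.
End AutonomousFlow.

(** Differentiability by recursion on the syntax of the function; the goals left over are mainly
    that inverted functions do not vanish. *)
Ltac diffc := repeat first
  [ assumption
  | lazymatch goal with |- @differentiable_def _ _ _ ?f _ _ =>
      lazymatch f with
      | (fun _ => ?c) => exact: diffc_cst
      | (fun x => @?a x + @?b x) => apply: (@diffc_add _ _ a b)
      | (fun x => - @?a x) => apply: (@diffc_opp _ _ a)
      | (fun x => @?a x * @?b x) => apply: (@diffc_mul _ _ a b)
      | (fun x => @?a x ^+ ?m) => apply: (@diffc_exp _ _ a m)
      | (fun x => (@?a x)^-1) => apply: (@diffc_inv _ _ a)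
      | (fun x => x) => exact: diffc_id
      | _ => exact: differentiable_coord
      end
    end ].

(** * Coordinates of the explicit rational flows *)

Section FlowCoordinates.
Context {R : realType} {n : nat}.
Local Notation C := R[i].
Local Notation Cn := 'rV[R[i]]_n.
Implicit Types (z : Cn) (x r : R) (l : 'I_n).

Lemma neq0_1D (a : C) : rnorm a < 1 -> 1 + a != 0.
Proof. by move=> a1; rewrite -rnorm_gt0; have := rnorm1D_ge a; lra. Qed.

Lemma Re_le_rnorm1 (a b : C) : rnorm a <= rnorm b -> b != 0 -> complex.Re ((- b + a) / b) <= 0.
Proof.
move=> ab b0; have -> : (- b + a) / b = - 1 + a / b by field.
rewrite ReD ReN /=; have := Re_le_rnorm (a / b); rewrite ler_norml => /andP[_].
have : rnorm (a / b) <= 1.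
  by rewrite rnormf_div ler_pdivrMr ?mul1r// rnorm_gt0.
lra.
Qed.

Lemma near_neq0 (V : normedModType C) (g : V -> C) (v : V) :
  differentiable g v -> g v != 0 -> \forall w \near v, g w != 0.
Proof.
move=> /differentiable_continuous/continuous_rnormP gc gv.
have [|d d0 hd] := gc (rnorm (g v)); first by rewrite rnorm_gt0.
apply/rnbhsP; exists d => // w /hd; apply: contraTN => /eqP ->.
by rewrite sub0r rnormN ltxx.
Qed.

Lemma rnormV_le (a : C) r : r < 1 -> 1 - r <= rnorm a -> (rnorm a)^-1 <= (1 - r)^-1.
Proof. by move=> r1 ra; rewrite lef_pV2 ?posrE; lra. Qed.

Lemma rnorm_quadratic_fraction (a d : C) (k : R) z r m : r < 1 -> 0 <= k -> 1 - r <= rnorm d ->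
  rnorm a <= k * rnorm z ^+ 2 -> rnorm (a / d ^+ m) <= k * (1 - r)^-1 ^+ m * rnorm z ^+ 2.
Proof.
move=> r1 k0 rd ak; rewrite rnormf_div rnormX -exprVn mulrAC.
have r1V : 0 <= (1 - r)^-1 by rewrite invr_ge0; lra.
apply: ler_pM; rewrite ?exprn_ge0 ?invr_ge0 ?rnorm_ge0//.
by apply: lerXn2r; rewrite ?nnegrE//; [rewrite invr_ge0 rnorm_ge0 | exact: rnormV_le].
Qed.

Lemma rnorm_coordM z i j : rnorm (z 0 i * z 0 j) <= 1 * rnorm z ^+ 2.
Proof. by rewrite rnormM mul1r expr2; apply: ler_pM; rewrite ?rnorm_ge0 ?rnorm_coord. Qed.

Lemma rnorm1D_real (t : R) (b : C) r : `|t| <= 1 -> rnorm b <= r -> 1 - r <= rnorm (1 + t%:C * b).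
Proof.
move=> t1 br; apply: le_trans (rnorm1D_ge _); rewrite rnormM rnormC lerD2l lerN2.
by apply: (le_trans _ br); rewrite ler_piMl ?rnorm_ge0.
Qed.

Lemma neq0_1D_real (t : R) (b : C) : `|t| <= 1 -> rnorm b < 1 -> 1 + t%:C * b != 0.
Proof.
move=> t1 b1; apply: neq0_1D; rewrite rnormM rnormC (le_lt_trans _ b1)//.
by rewrite ler_piMl ?rnorm_ge0.
Qed.

(** The real part is (1 - |b|^2) / |1 + b|^2, where |1 + b| <= 2 and |b|^2 <= |b|. *)
Lemma Re_cayley_ge (b : C) : rnorm b < 1 -> (1 - rnorm b) / 4 <= complex.Re ((1 - b) / (1 + b)).
Proof.
move=> b1; have nz := neq0_1D b1.
pose w := (1 + b)^-1.
have -> : (1 - b) / (1 + b) = 2%:R%:C * w - 1 by rewrite realc_nat /w; field.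
rewrite ReD ReN Re_cst_mul /=.
have E1 : w * (1 + b) = 1 by rewrite mulVf.
have E2 := rnorm_sqr w; have E3 : rnorm w * rnorm (1 + b) = 1 by rewrite -rnormM E1 rnorm1.
have E4 : b * w = 1 - w by rewrite -E1; ring.
have E5 : rnorm b ^+ 2 * rnorm w ^+ 2 = rnorm w ^+ 2 - (2 * complex.Re w - 1).
  by rewrite -exprMn -rnormM E4 !rnorm_sqr ReD ImD ReN ImN /=; ring.
have E6 : rnorm (1 + b) <= 2.
  by rewrite (le_trans (rnormD _ _))// rnorm1 -[leRHS]/(1 + 1 : R) lerD2l ltW.
have E7 : 1 / 2 <= rnorm w.
  by rewrite rnormV div1r lef_pV2 ?posrE// rnorm_gt0.
have -> : 2 * complex.Re w - 1 = rnorm w ^+ 2 * (1 - rnorm b ^+ 2) by rewrite -[2 * _ - 1](subKr (rnorm w ^+ 2)) -E5; ring.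
have b0 := rnorm_ge0 b.
have E8 : 1 / 4 <= rnorm w ^+ 2.
  have -> : 1 / 4 = (1 / 2) ^+ 2 :> R by field.
  by rewrite lerXn2r ?nnegrE ?rnorm_ge0.
rewrite mulrC -[4^-1]div1r; apply: ler_pM => //; first by rewrite subr_ge0 ltW.
by rewrite lerD2l lerN2 expr2 ler_piMl// ltW.
Qed.

Lemma Re_cayley (b : C) : rnorm b < 1 -> 0 <= complex.Re ((1 - b) / (1 + b)).
Proof. by move=> b1; apply: le_trans (Re_cayley_ge b1); rewrite divr_ge0// subr_ge0 ltW. Qed.

Section Coordinate.
Variables (Psi : C -> Cn -> Cn) (P : R -> Cn -> Cn) (G : Cn -> Cn) (l : 'I_n).

Lemma flow_coord_id : (forall c z, Psi c z 0 l = z 0 l) -> (forall x z, P x z 0 l = 0) ->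
  (forall z, G z 0 l = - z 0 l) -> flow_coord Psi P G l.
Proof.
move=> hPsi hP hG.
have E c : (fun z => Psi c z 0 l) = (fun z => z 0 l) by apply/funext.
have EG : (fun z => G z 0 l) = (fun z => - z 0 l) by apply/funext.
split.
- by move=> x z _ _ _; rewrite E; diffc.
- by move=> z _; rewrite hPsi.
- move=> x z x0 x1 z1; rewrite hPsi rnormM rnormC gtr0_norm//.
  apply: (@le_lt_trans _ _ (1 * rnorm z)); last by rewrite mul1r.
  by apply: ler_pM; rewrite ?(ltW x0) ?rnorm_ge0 ?rnorm_coord.
- move=> x z _ _ _; rewrite hP.
  have -> : (fun c => Psi c z 0 l) = (fun=> z 0 l) by apply/funext.
  exact: has_derivative_cst.
- by move=> x z _ _ _; rewrite hG mxE hPsi hP mulr0 addr0.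
- by move=> r r1; exists 0 => // x z _ _ _; rewrite hP rnorm0 mul0r.
- by move=> z _; rewrite EG; diffc.
- by move=> z _ _ z0; rewrite hG mulNr divff// ReN oppr_le0.
Qed.

(** The flow of f(a) = a / (1 + s a), for which f^-1(x f(a)) / x = a / (1 + s (1 - x) a). Both s =
    -1 and s = 1 occur among the extremal maps. *)
Lemma flow_coord_moebius (s : C) : rnorm s = 1 ->
  (forall c z, Psi c z 0 l = z 0 l / (1 + s * (1 - c) * z 0 l)) ->
  (forall x z, P x z 0 l = s * z 0 l ^+ 2 / (1 + s * (1 - x%:C) * z 0 l) ^+ 2) ->
  (forall z, G z 0 l = - (z 0 l * (1 + s * z 0 l))) -> flow_coord Psi P G l.
Proof.
move=> s1 hPsi hP hG.
have E c : (fun z => Psi c z 0 l) = (fun z => z 0 l / (1 + s * (1 - c) * z 0 l)) by apply/funext.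
have EG : (fun z => G z 0 l) = (fun z => - (z 0 l * (1 + s * z 0 l))) by apply/funext.
have small x z : 0 <= x -> x <= 1 -> rnorm z < 1 ->
    rnorm (s * (1 - x%:C) * z 0 l) <= (1 - x) * rnorm (z 0 l).
  move=> x0 x1 z1; rewrite !rnormM s1 mul1r -realc1 -realcB rnormC ger0_norm ?subr_ge0//.
have small1 x z : 0 <= x -> x <= 1 -> rnorm z < 1 -> rnorm (s * (1 - x%:C) * z 0 l) < 1.
  move=> x0 x1 z1; apply: (le_lt_trans (small x z x0 x1 z1)).
  apply: (@le_lt_trans _ _ (1 * rnorm z)); last by rewrite mul1r.
  by apply: ler_pM; rewrite ?rnorm_ge0 ?subr_ge0 ?rnorm_coord// lerBlDr lerDl.
have nz x z : 0 <= x -> x <= 1 -> rnorm z < 1 -> 1 + s * (1 - x%:C) * z 0 l != 0.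
  by move=> x0 x1 z1; apply: neq0_1D; exact: small1.
split.
- by move=> x z x0 x1 z1; rewrite E; diffc; exact: nz.
- by move=> z _; rewrite hPsi subrr mulr0 mul0r addr0 divr1.
- move=> x z x0 x1 z1; rewrite hPsi mulrA rnormf_div rnormM rnormC gtr0_norm//.
  have h1 := small x z (ltW x0) x1 z1; have h2 := small1 x z (ltW x0) x1 z1.
  have h3 := rnorm1D_ge (s * (1 - x%:C) * z 0 l).
  rewrite ltr_pdivrMr ?mul1r; last by lra.
  apply: lt_le_trans h3; have := rnorm_coord z l; have := rnorm_ge0 (z 0 l); nra.
- move=> x z x0 x1 z1; rewrite hP.
  have -> : (fun c => Psi c z 0 l) = (fun c => z 0 l / (1 + s * (1 - c) * z 0 l)) by apply/funext.
  have nzx := nz x z x0 x1 z1.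
  set a : C := z 0 l in nzx *.
  pose q (c : C) : C := s * a ^+ 2 / ((1 + s * (1 - x%:C) * a) * (1 + s * (1 - c) * a)).
  have -> : s * a ^+ 2 / (1 + s * (1 - x%:C) * a) ^+ 2 = q x%:C by rewrite /q expr2.
  apply: has_derivative_quotient; last first.
    by apply: contc_diff; rewrite /q; diffc; rewrite mulf_neq0.
  have : differentiable (fun c : C => 1 + s * (1 - c) * a) x%:C by diffc.
  move=> /near_neq0 /(_ nzx); apply: filterS => c hc; rewrite /q; field.
  by apply/andP; split; [exact: hc | exact: nzx].
- move=> x z x0 x1 z1; rewrite hG mxE hPsi hP; have := nz x z (ltW x0) x1 z1.
  by move=> h; field; exact: h.
- move=> r r1; have [r0|r0] := ltP r 0.
    by exists 0 => // x z _ _ zr; have := rnorm_ge0 z; lra.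
  exists ((1 - r)^-1 ^+ 2); first by rewrite exprn_ge0// invr_ge0; lra.
  move=> x z x0 x1 zr; have z1 := le_lt_trans zr r1; rewrite hP rnormf_div rnormM s1 mul1r !rnormX mulrC.
  have h1 := small x z x0 x1 z1; have h2 := rnorm_coord z l; have h3 := rnorm_ge0 (z 0 l).
  have h4 := rnorm1D_ge (s * (1 - x%:C) * z 0 l).
  have h5 : 1 - r <= rnorm (1 + s * (1 - x%:C) * z 0 l) by nra.
  rewrite -exprVn; apply: ler_pM; rewrite ?exprn_ge0 ?invr_ge0 ?rnorm_ge0//.
    rewrite lerXn2r ?nnegrE ?invr_ge0 ?rnorm_ge0 ?rnormV_le//; lra.
  by rewrite lerXn2r ?nnegrE ?rnorm_ge0.
- by move=> z _; rewrite EG; diffc.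
- move=> z z1 zl z0; rewrite hG; have -> : - (z 0 l * (1 + s * z 0 l)) = - z 0 l + - (s * z 0 l ^+ 2) by ring.
  apply: Re_le_rnorm1 => //; rewrite rnormN rnormM s1 mul1r rnormX expr2 ler_piMl ?rnorm_ge0//.
  by rewrite -zl ltW.
Qed.

(** The family belongs to f_l = z_l + z_j z_k. Where the l-th coordinate is maximal, |z_j z_k| <=
    |z|^2 <= |z_l|, so the quadratic term cannot outweigh - z_l. *)
Lemma flow_coord_shear j k : (forall c z, Psi c z 0 j = z 0 j) -> (forall c z, Psi c z 0 k = z 0 k) ->
  (forall c z, Psi c z 0 l = z 0 l + (1 - c) * (z 0 j * z 0 k)) ->
  (forall x z, P x z 0 l = - (z 0 j * z 0 k)) ->
  (forall z, G z 0 l = - z 0 l + z 0 j * z 0 k) -> flow_coord Psi P G l.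
Proof.
move=> hj hk hPsi hP hG.
have E c : (fun z => Psi c z 0 l) = (fun z => z 0 l + (1 - c) * (z 0 j * z 0 k)) by apply/funext.
have EG : (fun z => G z 0 l) = (fun z => - z 0 l + z 0 j * z 0 k) by apply/funext.
split.
- by move=> x z _ _ _; rewrite E; diffc.
- by move=> z _; rewrite hPsi subrr mul0r addr0.
- move=> x z x0 x1 z1; rewrite hPsi rnormM rnormC gtr0_norm//.
  have h1 : rnorm (z 0 l + (1 - x%:C) * (z 0 j * z 0 k)) <= rnorm z + (1 - x) * rnorm z ^+ 2.
    rewrite (le_trans (rnormD _ _))// lerD ?rnorm_coord// rnormM.
    rewrite -realc1 -realcB rnormC ger0_norm ?subr_ge0// ler_wpM2l ?subr_ge0//.
    by have := rnorm_coordM z j k; rewrite mul1r.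
  have h2 := rnorm_ge0 z; set r := rnorm z in z1 h1 h2.
  apply: (@le_lt_trans _ _ (x * (r + (1 - x) * r ^+ 2))); first by rewrite ler_wpM2l// ltW.
  apply: (@le_lt_trans _ _ r) => //.
  have -> : x * (r + (1 - x) * r ^+ 2) = r - r * (1 - x) * (1 - x * r) by ring.
  by rewrite lerBlDr lerDl !mulr_ge0// subr_ge0//; nra.
- move=> x z _ _ _; rewrite hP.
  have -> : (fun c => Psi c z 0 l) = (fun c => z 0 l + (1 - c) * (z 0 j * z 0 k)) by apply/funext.
  apply: (@has_derivative_quotient _ _ (fun=> - (z 0 j * z 0 k))); last exact: contc_cst.
  by apply/rnbhsP; exists 1 => // c _ /=; ring.
- by move=> x z _ _ _; rewrite hG !mxE hj hk hPsi hP; ring.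
- move=> r r1; exists 1 => // x z _ _ _; rewrite hP rnormN; exact: rnorm_coordM.
- by move=> z _; rewrite EG; diffc.
- move=> z z1 zl z0; rewrite hG; apply: Re_le_rnorm1 => //.
  rewrite -zl; apply: (le_trans (rnorm_coordM _ _ _)); rewrite mul1r expr2 ler_piMl ?rnorm_ge0//.
  exact: ltW.
Qed.

Lemma flow_coord_koebe_shear j : (forall c z, Psi c z 0 j = z 0 j / (1 - (1 - c) * z 0 j)) ->
  (forall c z, Psi c z 0 l =
     (z 0 l * (1 - (1 - c) * z 0 j) + (1 - c) * z 0 j ^+ 2) / (1 - (1 - c) * z 0 j)) ->
  (forall x z, P x z 0 l = - (z 0 j ^+ 2 / (1 - (1 - x%:C) * z 0 j) ^+ 2)) ->
  (forall z, G z 0 l = - z 0 l + z 0 j ^+ 2) -> flow_coord Psi P G l.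
Proof.
move=> hj hPsi hP hG.
have E c : (fun z => Psi c z 0 l) =
  (fun z => (z 0 l * (1 - (1 - c) * z 0 j) + (1 - c) * z 0 j ^+ 2) / (1 - (1 - c) * z 0 j))
  by apply/funext.
have EG : (fun z => G z 0 l) = (fun z => - z 0 l + z 0 j ^+ 2) by apply/funext.
have den x z : 1 - (1 - x%:C) * z 0 j = 1 + (x - 1)%:C * z 0 j by rewrite realcB realc1; ring.
have x11 x : 0 <= x -> x <= 1 -> `|x - 1| <= 1.
  by move=> x0 x1; rewrite ler_norml; lra.
have nz x z : 0 <= x -> x <= 1 -> rnorm z < 1 -> 1 - (1 - x%:C) * z 0 j != 0.
  move=> x0 x1 z1; rewrite den neq0_1D_real ?x11//; exact: le_lt_trans (rnorm_coord _ _) z1.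
have PsiE x z : 0 <= x -> x <= 1 -> rnorm z < 1 ->
    Psi x%:C z 0 l = z 0 l + (1 - x%:C) * (z 0 j ^+ 2 / (1 - (1 - x%:C) * z 0 j)).
  by move=> x0 x1 z1; have h := nz x z x0 x1 z1; rewrite hPsi; field; exact: h.
split.
- by move=> x z x0 x1 z1; rewrite E; diffc; exact: nz.
- by move=> z _; rewrite hPsi subrr !mul0r subr0 mulr1 addr0 divr1.
- move=> x z x0 x1 z1; rewrite (PsiE x z (ltW x0) x1 z1) rnormM rnormC gtr0_norm//.
  have h2 := rnorm_ge0 z; have h3 := rnorm_coord z j.
  have h4 : 1 - (1 - x) * rnorm z <= rnorm (1 - (1 - x%:C) * z 0 j).
    apply: le_trans (rnorm1B_ge _).
    by rewrite rnormM -realc1 -realcB rnormC ger0_norm ?subr_ge0// lerD2l lerN2 ler_wpM2l ?subr_ge0.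
  set r := rnorm z in z1 h2 h3 h4.
  have d0 : 0 < rnorm (1 - (1 - x%:C) * z 0 j) by rewrite rnorm_gt0; apply: nz => //; exact: ltW.
  (* The factor x compensates the denominator because x <= 1 - (1 - x) r. What remains is x r + (1 -
     x) r^2 <= r. *)
  have h1 : rnorm ((1 - x%:C) * (z 0 j ^+ 2 / (1 - (1 - x%:C) * z 0 j))) * x <= (1 - x) * r ^+ 2.
    rewrite rnormM -realc1 -realcB rnormC ger0_norm ?subr_ge0// -mulrA ler_wpM2l ?subr_ge0//.
    rewrite realcB realc1 rnormf_div rnormX mulrAC ler_pdivrMr//.
    apply: ler_pM; rewrite ?exprn_ge0 ?rnorm_ge0 ?(ltW x0)//.
      by rewrite lerXn2r ?nnegrE ?rnorm_ge0.
    by apply: le_trans h4; nra.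
  apply: (@le_lt_trans _ _ r) => //.
  apply: (@le_trans _ _ (x * r + (1 - x) * r ^+ 2)); last first.
    have -> : x * r + (1 - x) * r ^+ 2 = r - (1 - x) * r * (1 - r) by ring.
    by rewrite lerBlDr lerDl !mulr_ge0// subr_ge0// ltW.
  apply: (@le_trans _ _ (x * rnorm (z 0 l) + x * rnorm ((1 - x%:C) * (z 0 j ^+ 2 / (1 - (1 - x%:C) * z 0 j))))).
    by rewrite -mulrDr ler_wpM2l ?(ltW x0) ?rnormD.
  by apply: lerD; [rewrite ler_wpM2l ?(ltW x0) ?rnorm_coord | rewrite mulrC].
- move=> x z x0 x1 z1; rewrite hP.
  have -> : (fun c => Psi c z 0 l) =
    (fun c => (z 0 l * (1 - (1 - c) * z 0 j) + (1 - c) * z 0 j ^+ 2) / (1 - (1 - c) * z 0 j))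
    by apply/funext.
  have nzx := nz x z x0 x1 z1; set b : C := z 0 j in nzx *.
  pose q (c : C) : C := - (b ^+ 2 / ((1 - (1 - x%:C) * b) * (1 - (1 - c) * b))).
  have -> : - (b ^+ 2 / (1 - (1 - x%:C) * b) ^+ 2) = q x%:C by rewrite /q expr2.
  apply: has_derivative_quotient; last first.
    by apply: contc_diff; rewrite /q; diffc; rewrite mulf_neq0.
  have : differentiable (fun c : C => 1 - (1 - c) * b) x%:C by diffc.
  move=> /near_neq0 /(_ nzx); apply: filterS => c hc; rewrite /q; field.
  by apply/andP; split; [exact: hc | exact: nzx].
- move=> x z x0 x1 z1; rewrite hG !mxE hj hPsi hP; have := nz x z (ltW x0) x1 z1.
  by move=> h; field; exact: h.
- move=> r r1; exists (1 * (1 - r)^-1 ^+ 2); first by rewrite mul1r exprn_ge0// invr_ge0; lra.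
  move=> x z x0 x1 zr; rewrite hP rnormN; apply: rnorm_quadratic_fraction => //; last exact: rnorm_coordM.
  by rewrite den; apply: rnorm1D_real; rewrite ?x11// (le_trans (rnorm_coord _ _)).
- by move=> z _; rewrite EG; diffc.
- move=> z z1 zl z0; rewrite hG; apply: Re_le_rnorm1 => //.
  rewrite -zl; apply: (le_trans (rnorm_coordM _ _ _)); rewrite mul1r expr2 ler_piMl ?rnorm_ge0//.
  exact: ltW.
Qed.

(** The quotient G_l / z_l is minus a Cayley transform. The Koebe map (with j = l), the quadratic
    map and the Cayley map all have this l-th field component; they differ in how z_j moves. *)
Lemma Re_cayley_field j z : G z 0 l = - (z 0 l * ((1 - z 0 j) / (1 + z 0 j))) -> rnorm z < 1 ->
  z 0 l != 0 -> complex.Re (G z 0 l / z 0 l) <= 0.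
Proof.
move=> -> z1 z0; rewrite mulNr mulrAC divff// mul1r ReN oppr_le0; apply: Re_cayley.
exact: le_lt_trans (rnorm_coord _ _) z1.
Qed.

Lemma flow_coord_quadratic j : (forall c z, Psi c z 0 j = z 0 j) ->
  (forall c z, Psi c z 0 l = z 0 l * (1 + z 0 j) ^+ 2 / (1 + c * z 0 j) ^+ 2) ->
  (forall x z, P x z 0 l = - (2 * (z 0 l * z 0 j) * (1 + z 0 j) ^+ 2) / (1 + x%:C * z 0 j) ^+ 3) ->
  (forall z, G z 0 l = - (z 0 l * ((1 - z 0 j) / (1 + z 0 j)))) -> flow_coord Psi P G l.
Proof.
move=> hj hPsi hP hG.
have E c : (fun z => Psi c z 0 l) =
  (fun z => z 0 l * (1 + z 0 j) ^+ 2 / (1 + c * z 0 j) ^+ 2) by apply/funext.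
have EG : (fun z => G z 0 l) = (fun z => - (z 0 l * ((1 - z 0 j) / (1 + z 0 j)))) by apply/funext.
have x11 x : 0 <= x -> x <= 1 -> `|x| <= 1 by move=> x0 x1; rewrite ger0_norm.
have nz x z : 0 <= x -> x <= 1 -> rnorm z < 1 -> 1 + x%:C * z 0 j != 0.
  move=> x0 x1 z1; rewrite neq0_1D_real ?x11//; exact: le_lt_trans (rnorm_coord _ _) z1.
have nz1 z : rnorm z < 1 -> 1 + z 0 j != 0.
  by move=> z1; have := nz 1 z ler01 (lexx _) z1; rewrite mul1r.
split.
- by move=> x z x0 x1 z1; rewrite E; diffc; rewrite expf_neq0 ?nz.
- by move=> z z1; rewrite hPsi mul1r mulfK// expf_neq0// nz1.
- move=> x z x0 x1 z1; rewrite hPsi; set b := z 0 j.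
  have nzx := nz x z (ltW x0) x1 z1; rewrite -/b in nzx.
  have b1 : rnorm b < 1 by exact: le_lt_trans (rnorm_coord _ _) z1.
  have -> : x%:C * (z 0 l * (1 + b) ^+ 2 / (1 + x%:C * b) ^+ 2) =
     z 0 l * (x%:C * (1 + b) ^+ 2 / (1 + x%:C * b) ^+ 2) by ring.
  rewrite rnormM; apply: (@le_lt_trans _ _ (rnorm z * 1)); last by rewrite mulr1.
  apply: ler_pM; rewrite ?rnorm_ge0 ?rnorm_coord// rnormf_div rnormM !rnormX rnormC gtr0_norm//.
  rewrite ler_pdivrMr ?mul1r ?exprn_gt0 ?rnorm_gt0// !rnorm_sqr.
  rewrite !ReD !ImD Re_cst_mul ImM /= mul0r addr0 !add0r.
  have := rnorm_sqr b; have : rnorm b ^+ 2 <= 1 by rewrite expr_le1 ?rnorm_ge0// ltW.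
  set p := complex.Re b; set q := complex.Im b => H1 H2.
  rewrite -subr_ge0.
  (* This is |1 + x b|^2 - x |1 + b|^2, where the terms linear in Re b cancel. *)
  have -> : (1 + x * p) ^+ 2 + (x * q) ^+ 2 - x * ((1 + p) ^+ 2 + q ^+ 2) =
    (1 - x) * (1 - x * rnorm b ^+ 2) by rewrite H2; ring.
  rewrite mulr_ge0 ?subr_ge0// (le_trans _ x1)// ler_piMr// ltW//.
- move=> x z x0 x1 z1; rewrite hP.
  have -> : (fun c => Psi c z 0 l) =
    (fun c => z 0 l * (1 + z 0 j) ^+ 2 / (1 + c * z 0 j) ^+ 2) by apply/funext.
  have nzx := nz x z x0 x1 z1; set b : C := z 0 j in nzx *; set a : C := z 0 l.
  pose q (c : C) : C := - (a * b * (1 + b) ^+ 2) * (2 + (x%:C + c) * b)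
     / ((1 + x%:C * b) ^+ 2 * (1 + c * b) ^+ 2).
  have -> : - (2 * (a * b) * (1 + b) ^+ 2) / (1 + x%:C * b) ^+ 3 = q x%:C.
    by rewrite /q; field; exact: nzx.
  apply: has_derivative_quotient; last first.
    by apply: contc_diff; rewrite /q; diffc; rewrite mulf_neq0// expf_neq0.
  have : differentiable (fun c : C => 1 + c * b) x%:C by diffc.
  move=> /near_neq0 /(_ nzx); apply: filterS => c hc; rewrite /q; field.
  by apply/andP; split; [exact: hc | exact: nzx].
- move=> x z x0 x1 z1; rewrite hG !mxE hj hPsi hP; have := nz x z (ltW x0) x1 z1.
  by move=> h; field; exact: h.
- move=> r r1; exists (8 * (1 - r)^-1 ^+ 3).
    by rewrite mulr_ge0// exprn_ge0// invr_ge0; lra.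
  move=> x z x0 x1 zr; rewrite hP; apply: rnorm_quadratic_fraction => //.
    by apply: rnorm1D_real; rewrite ?x11// (le_trans (rnorm_coord _ _)).
  rewrite rnormN rnormM (rnormM 2) rnormX -(realc_nat (R := R) 2) rnormC ger0_norm//.
  have h1 := rnorm_coordM z l j; rewrite mul1r in h1.
  have h2 : rnorm (1 + z 0 j) ^+ 2 <= 2 ^+ 2.
    rewrite lerXn2r ?nnegrE ?rnorm_ge0// (le_trans (rnormD _ _))// rnorm1 -[leRHS]/(1 + 1 : R) lerD2l.
    by rewrite (le_trans (rnorm_coord _ _))// (le_trans zr)// ltW.
  have -> : 8 * rnorm z ^+ 2 = 2 * rnorm z ^+ 2 * 2 ^+ 2 by ring.
  apply: ler_pM => //; rewrite ?mulr_ge0 ?exprn_ge0 ?rnorm_ge0//.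
  by rewrite ler_wpM2l.
- by move=> z z1; rewrite EG; diffc; exact: nz1.
- by move=> z z1 _ z0; exact: Re_cayley_field (hG z) z1 z0.
Qed.

Lemma flow_coord_cayley j : (forall c z, Psi c z 0 j = z 0 j / (1 - (1 - c) * z 0 j)) ->
  (forall c z, Psi c z 0 l = z 0 l * (1 + z 0 j) / (1 + (2 * c - 1) * z 0 j)) ->
  (forall x z, P x z 0 l = - (2 * (z 0 l * z 0 j) * (1 + z 0 j)) / (1 + (2 * x%:C - 1) * z 0 j) ^+ 2) ->
  (forall z, G z 0 l = - (z 0 l * ((1 - z 0 j) / (1 + z 0 j)))) -> flow_coord Psi P G l.
Proof.
move=> hj hPsi hP hG.
have E c : (fun z => Psi c z 0 l) =
  (fun z => z 0 l * (1 + z 0 j) / (1 + (2 * c - 1) * z 0 j)) by apply/funext.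
have EG : (fun z => G z 0 l) = (fun z => - (z 0 l * ((1 - z 0 j) / (1 + z 0 j)))) by apply/funext.
have den x : 2 * x%:C - 1 = (2 * x - 1)%:C by rewrite realcB realcM realc1 realc_nat.
have den' x z : 1 - (1 - x%:C) * z 0 j = 1 + (x - 1)%:C * z 0 j by rewrite realcB realc1; ring.
have x11 x : 0 <= x -> x <= 1 -> `|2 * x - 1| <= 1.
  by move=> x0 x1; rewrite ler_norml; lra.
have nz x z : 0 <= x -> x <= 1 -> rnorm z < 1 -> 1 + (2 * x%:C - 1) * z 0 j != 0.
  move=> x0 x1 z1; rewrite den neq0_1D_real ?x11//; exact: le_lt_trans (rnorm_coord _ _) z1.
have nz' x z : 0 <= x -> x <= 1 -> rnorm z < 1 -> 1 - (1 - x%:C) * z 0 j != 0.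
  move=> x0 x1 z1; rewrite den' neq0_1D_real//; last exact: le_lt_trans (rnorm_coord _ _) z1.
  by rewrite ler_norml; lra.
have nz1 z : rnorm z < 1 -> 1 + z 0 j != 0.
  by move=> z1; apply: neq0_1D; exact: le_lt_trans (rnorm_coord _ _) z1.
split.
- by move=> x z x0 x1 z1; rewrite E; diffc; exact: nz.
- move=> z z1; rewrite hPsi; have -> : 2 * 1 - 1 = 1 :> C by ring.
  by rewrite mul1r mulfK// nz1.
- move=> x z x0 x1 z1; rewrite hPsi; set b := z 0 j.
  have nzx := nz x z (ltW x0) x1 z1; rewrite -/b in nzx.
  have b1 : rnorm b < 1 by exact: le_lt_trans (rnorm_coord _ _) z1.
  have -> : x%:C * (z 0 l * (1 + b) / (1 + (2 * x%:C - 1) * b)) =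
     z 0 l * (x%:C * (1 + b) / (1 + (2 * x%:C - 1) * b)) by ring.
  rewrite rnormM; apply: (@le_lt_trans _ _ (rnorm z * 1)); last by rewrite mulr1.
  apply: ler_pM; rewrite ?rnorm_ge0 ?rnorm_coord// rnormf_div rnormM rnormC gtr0_norm//.
  rewrite ler_pdivrMr ?mul1r ?rnorm_gt0//.
  rewrite -(@ler_pXn2r _ 2) ?nnegrE ?mulr_ge0 ?rnorm_ge0 ?(ltW x0)//.
  rewrite exprMn !rnorm_sqr den.
  rewrite !ReD !ImD Re_cst_mul ImM /= mul0r addr0 !add0r.
  have := rnorm_sqr b; have bb := Re_le_rnorm b; have b0 := rnorm_ge0 b.
  move: bb; rewrite ler_norml; set be := rnorm b in b0 b1 *.
  set p := complex.Re b; set q := complex.Im b => /andP[p1 p2] H2.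
  have -> : x ^+ 2 * ((1 + p) ^+ 2 + q ^+ 2) = x ^+ 2 * (1 + 2 * p + be ^+ 2) by rewrite H2; ring.
  have -> : (1 + (2 * x - 1) * p) ^+ 2 + ((2 * x - 1) * q) ^+ 2 =
    1 + 2 * (2 * x - 1) * p + (2 * x - 1) ^+ 2 * be ^+ 2 by rewrite H2; ring.
  rewrite -subr_ge0.
  (* A factor 1 - x splits off because the two moduli agree at x = 1; the cofactor is arranged into
     nonnegative terms, using p = Re b <= be = |b| <= 1. *)
  have -> : 1 + 2 * (2 * x - 1) * p + (2 * x - 1) ^+ 2 * be ^+ 2 - x ^+ 2 * (1 + 2 * p + be ^+ 2) =
    (1 - x) * ((1 - x) * (1 - be) ^+ 2 + 2 * x * (1 - be ^+ 2) + 2 * (1 - x) * (be - p)) by ring.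
  have H3 : be ^+ 2 <= 1 by rewrite expr_le1// ltW.
  rewrite mulr_ge0 ?subr_ge0// addr_ge0//; last by rewrite !mulr_ge0 ?subr_ge0.
  rewrite addr_ge0//; first by rewrite mulr_ge0 ?subr_ge0 ?sqr_ge0.
  by rewrite !mulr_ge0 ?subr_ge0// ltW.
- move=> x z x0 x1 z1; rewrite hP.
  have -> : (fun c => Psi c z 0 l) =
    (fun c => z 0 l * (1 + z 0 j) / (1 + (2 * c - 1) * z 0 j)) by apply/funext.
  have nzx := nz x z x0 x1 z1; set b : C := z 0 j in nzx *; set a : C := z 0 l.
  pose q (c : C) : C := - (2 * (a * b) * (1 + b))
     / ((1 + (2 * x%:C - 1) * b) * (1 + (2 * c - 1) * b)).
  have -> : - (2 * (a * b) * (1 + b)) / (1 + (2 * x%:C - 1) * b) ^+ 2 = q x%:C.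
    by rewrite /q expr2.
  apply: has_derivative_quotient; last first.
    by apply: contc_diff; rewrite /q; diffc; rewrite mulf_neq0.
  have : differentiable (fun c : C => 1 + (2 * c - 1) * b) x%:C by diffc.
  move=> /near_neq0 /(_ nzx); apply: filterS => c hc; rewrite /q; field.
  by apply/andP; split; [exact: hc | exact: nzx].
- move=> x z x0 x1 z1; rewrite hG !mxE hj hPsi hP.
  have h1 := nz x z (ltW x0) x1 z1; have h2 := nz' x z (ltW x0) x1 z1.
  by field; apply/andP; split; [exact: h1 | exact: h2].
- move=> r r1; exists (4 * (1 - r)^-1 ^+ 2).
    by rewrite mulr_ge0// exprn_ge0// invr_ge0; lra.
  move=> x z x0 x1 zr; rewrite hP; apply: rnorm_quadratic_fraction => //.
    by rewrite den; apply: rnorm1D_real; rewrite ?x11// (le_trans (rnorm_coord _ _)).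
  rewrite rnormN rnormM (rnormM 2) -(realc_nat (R := R) 2) rnormC ger0_norm//.
  have h1 := rnorm_coordM z l j; rewrite mul1r in h1.
  have h2 : rnorm (1 + z 0 j) <= 2.
    rewrite (le_trans (rnormD _ _))// rnorm1 -[leRHS]/(1 + 1 : R) lerD2l.
    by rewrite (le_trans (rnorm_coord _ _))// (le_trans zr)// ltW.
  have -> : 4 * rnorm z ^+ 2 = 2 * rnorm z ^+ 2 * 2 by ring.
  apply: ler_pM => //; rewrite ?mulr_ge0 ?rnorm_ge0//.
  by rewrite ler_wpM2l.
- by move=> z z1; rewrite EG; diffc; exact: nz1.
- by move=> z z1 _ z0; exact: Re_cayley_field (hG z) z1 z0.
Qed.

End Coordinate.
End FlowCoordinates.

(** * Square roots and the flow of the Koebe function *)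

Section SquareRoot.
Context {R : realType}.
Local Notation C := R[i].
Implicit Types (a b y z : C) (x r : R).

Lemma Re_sqrtc_ge0 z : 0 <= complex.Re (sqrtc z).
Proof. by case: z => a b /=; exact: sqrtr_ge0. Qed.

Lemma Re_gt0_neq0 y : 0 < complex.Re y -> y != 0.
Proof. by apply: contraTneq => ->; rewrite ltxx. Qed.

(** Since roots have nonnegative real part and Re s > 0, the sum sqrt(w) + s never vanishes, and
    sqrt(w) - s = (w - z) / (sqrt(w) + s) for every w. The same identity first gives continuity at
    z. *)
Lemma has_derivative_sqrtc z : 0 < complex.Re (sqrtc z) ->
  has_derivative (@sqrtc R) z (sqrtc z + sqrtc z)^-1.
Proof.
move=> z0; set s := sqrtc z in z0 *.
have nz w : sqrtc w + s != 0.
  by apply: Re_gt0_neq0; rewrite ReD ltr_wpDl// Re_sqrtc_ge0.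
have E w : sqrtc w - s = (w - z) / (sqrtc w + s).
  apply: (mulIf (nz w)); rewrite divfK ?nz//.
  have -> : (sqrtc w - s) * (sqrtc w + s) = sqrtc w ^+ 2 - s ^+ 2 by ring.
  by rewrite !sqr_sqrtc.
have cs : {for z, continuous (@sqrtc R)}.
  apply/continuous_rnormP => e e0; exists (e * complex.Re s); first by rewrite mulr_gt0.
  move=> w wz; rewrite -/s E rnormf_div ltr_pdivrMr ?rnorm_gt0//.
  apply: (lt_le_trans wz); rewrite ler_pM2l//.
  apply: le_trans (le_trans (ler_norm _) (Re_le_rnorm _)).
  by rewrite ReD lerDr Re_sqrtc_ge0.
apply: (has_derivative_quotient (q := fun w => (sqrtc w + s)^-1)).
  by apply/rnbhsP; exists 1 => // w _; exact: E.
apply: contc_inv; first exact: nz.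
by apply: contc_add; [exact: cs | exact: contc_cst].
Qed.

Lemma sqrtc_sqr y : 0 < complex.Re y -> sqrtc (y ^+ 2) = y.
Proof.
move=> y0; apply/eqP; rewrite -subr_eq0.
have nz : sqrtc (y ^+ 2) + y != 0.
  by apply: Re_gt0_neq0; rewrite ReD ltr_wpDl// Re_sqrtc_ge0.
rewrite -(mulIr_eq0 _ (mulIf nz)); apply/eqP.
have -> : (sqrtc (y ^+ 2) - y) * (sqrtc (y ^+ 2) + y) = sqrtc (y ^+ 2) ^+ 2 - y ^+ 2 by ring.
by rewrite sqr_sqrtc subrr.
Qed.

Definition halfplane a := (1 + a) / (1 - a).

(** With Y = (1 + a) / (1 - a), Y^2 - 1 is four times the Koebe function k(a) = a / (1 - a)^2.
    Multiplying k(a) by c thus amounts to replacing Y by this root. *)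
Definition koebe_root (c a : C) : C := sqrtc (1 + c * (halfplane a ^+ 2 - 1)).

Lemma neq0_1B a : rnorm a < 1 -> 1 - a != 0.
Proof. by move=> a1; apply: neq0_1D; rewrite rnormN. Qed.

Lemma halfplaneB1 a : rnorm a < 1 -> halfplane a ^+ 2 - 1 = 4 * a / (1 - a) ^+ 2.
Proof. by move=> /neq0_1B nz; rewrite /halfplane; field; exact: nz. Qed.

Lemma Re_halfplane a : rnorm a < 1 -> (1 - rnorm a) / 4 <= complex.Re (halfplane a).
Proof. by move=> a1; have := @Re_cayley_ge R (- a); rewrite rnormN opprK; apply. Qed.

Lemma halfplane_inj a b : rnorm a < 1 -> rnorm b < 1 -> halfplane a ^+ 2 = halfplane b ^+ 2 -> a = b.
Proof.
move=> a1 b1 /(congr1 (@sqrtc R)); rewrite !sqrtc_sqr; last 2 first.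
- by apply: lt_le_trans (Re_halfplane b1); rewrite divr_gt0 ?subr_gt0.
- by apply: lt_le_trans (Re_halfplane a1); rewrite divr_gt0 ?subr_gt0.
have na := neq0_1B a1; have nb := neq0_1B b1.
move=> /eqP; rewrite /halfplane eqr_div// => /eqP E.
have : 2 * (a - b) = 0 by rewrite -[RHS](subrr ((1 + b) * (1 - a))) -{1}E; ring.
by move=> /eqP; rewrite mulf_eq0 pnatr_eq0 /= subr_eq0 => /eqP.
Qed.

Lemma koebe_root_sqr c a : koebe_root c a ^+ 2 = 1 + c * (halfplane a ^+ 2 - 1).
Proof. exact: sqr_sqrtc. Qed.

Lemma koebe_root0 a : koebe_root 0 a = 1.
Proof. by rewrite /koebe_root mul0r addr0 sqrtc1. Qed.

Lemma koebe_root1 a : rnorm a < 1 -> koebe_root 1 a = halfplane a.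
Proof.
move=> a1; rewrite /koebe_root mul1r subrKC sqrtc_sqr//.
by apply: lt_le_trans (Re_halfplane a1); rewrite divr_gt0 ?subr_gt0.
Qed.

(* Dividing 1 - x + x Y^2 by Y exhibits it as a convex combination of 1 / Y and Y, both of which
   lie in the right half-plane. *)
Lemma koebe_root_bounds x a : 0 <= x -> x <= 1 -> rnorm a < 1 ->
  0 < complex.Re (koebe_root x%:C a) /\ (1 - rnorm a) / 4 <= rnorm (koebe_root x%:C a).
Proof.
move=> x0 x1 a1; set k := (1 - rnorm a) / 4.
have k0 : 0 < k by rewrite divr_gt0 ?subr_gt0.
have k0' := ltW k0.
set Y := halfplane a.
have ReY : k <= complex.Re Y by exact: Re_halfplane.
have ReYV : k <= complex.Re Y^-1 by rewrite invf_div; exact: Re_cayley_ge.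
have Y0 : Y != 0 by apply: Re_gt0_neq0; exact: lt_le_trans ReY.
have E : koebe_root x%:C a ^+ 2 / Y = (1 - x)%:C * Y^-1 + x%:C * Y.
  by rewrite koebe_root_sqr -/Y realcB realc1; field; exact: Y0.
have K : k <= complex.Re (koebe_root x%:C a ^+ 2 / Y).
  rewrite E ReD !Re_cst_mul.
  have -> : k = (1 - x) * k + x * k by ring.
  by apply: lerD; rewrite ler_wpM2l ?subr_ge0.
set y := koebe_root x%:C a in E K *; split.
  (* A purely imaginary y would have y^2 <= 0, and then Re (y^2 / Y) <= 0, against [K]. *)
  rewrite lt_neqAle Re_sqrtc_ge0 andbT; apply/negP => /eqP y0.
  have yE : y ^+ 2 = (- (complex.Im y ^+ 2))%:C.
    by apply/eqP; rewrite eq_complex expr2 ReM ImM -y0 /= !mul0r mulr0 sub0r addr0 expr2 !eqxx.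
  move: K; rewrite yE Re_cst_mul mulNr; apply/negP; rewrite -ltNge.
  apply: le_lt_trans k0; rewrite oppr_le0 mulr_ge0 ?sqr_ge0//.
  exact: le_trans k0' ReYV.
have h1 : k * k <= rnorm y ^+ 2.
  have : k <= rnorm (y ^+ 2 / Y) by apply: le_trans K (le_trans (ler_norm _) (Re_le_rnorm _)).
  rewrite rnormf_div rnormX ler_pdivlMr ?rnorm_gt0//; apply: le_trans.
  rewrite ler_pM2l//; exact: le_trans ReY (le_trans (ler_norm _) (Re_le_rnorm _)).
by rewrite -(@ler_pXn2r _ 2) ?nnegrE ?rnorm_ge0 ?(ltW k0)// expr2.
Qed.

End SquareRoot.

Section KoebeCoordinate.
Context {R : realType} {n : nat}.
Local Notation C := R[i].
Local Notation Cn := 'rV[R[i]]_n.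
Implicit Types (z : Cn) (x r : R) (l : 'I_n).
Variables (Psi : C -> Cn -> Cn) (P : R -> Cn -> Cn) (G : Cn -> Cn) (l : 'I_n).

(** For y = [koebe_root c a], k^-1(c k(a)) = (y - 1) / (y + 1) = (y^2 - 1) / (y + 1)^2. Its quotient
    by c is this formula, which is regular at c = 0. *)
Definition koebe_flow (c a : C) : C := 4 * a / (1 - a) ^+ 2 / (koebe_root c a + 1) ^+ 2.

Lemma koebe_root1D_neq0 (c a : C) : koebe_root c a + 1 != 0.
Proof. by apply: Re_gt0_neq0; rewrite ReD ltr_wpDl ?Re_sqrtc_ge0//= ltr01. Qed.

(** Dividing y^2 - 1 = x p (y + 1)^2 by y + 1 determines the root y from the common value p by a
    linear equation; then p (y + 1)^2 recovers the square of the half-plane coordinate. Nothing has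
    to be divided by x, which may be 0. *)
Lemma koebe_flow_inj x (a b : C) : rnorm a < 1 -> rnorm b < 1 ->
  koebe_flow x%:C a = koebe_flow x%:C b -> a = b.
Proof.
move=> a1 b1; set p := koebe_flow x%:C b => E.
have root c : rnorm c < 1 -> koebe_flow x%:C c = p ->
    koebe_root x%:C c * (1 - x%:C * p) = 1 + x%:C * p /\
    halfplane c ^+ 2 - 1 = p * (koebe_root x%:C c + 1) ^+ 2.
  move=> c1 cp; have nz := koebe_root1D_neq0 x%:C c.
  have W : halfplane c ^+ 2 - 1 = p * (koebe_root x%:C c + 1) ^+ 2.
    by rewrite -cp /koebe_flow halfplaneB1// divfK// expf_neq0.
  split=> //; apply: (mulfI nz); apply/eqP; rewrite -subr_eq0; apply/eqP.
  have := koebe_root_sqr x%:C c; rewrite W.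
  set y := koebe_root _ _ => Y.
  have -> : (y + 1) * (y * (1 - x%:C * p)) - (y + 1) * (1 + x%:C * p) =
    y ^+ 2 - (1 + x%:C * (p * (y + 1) ^+ 2)) by ring.
  by rewrite Y subrr.
have [Ea Wa] := root a a1 E; have [Eb Wb] := root b b1 (erefl _).
have nz : 1 - x%:C * p != 0.
  apply/eqP => h; move: Ea; rewrite h mulr0 => h'.
  have : 2 = 0 :> C.
    have -> : 2 = (1 + x%:C * p) + (1 - x%:C * p) :> C by ring.
    by rewrite h -h' addr0.
  by move/eqP; rewrite pnatr_eq0.
apply: halfplane_inj => //; rewrite -[LHS](subrK 1) -[RHS](subrK 1) Wa Wb.
by congr (_ * (_ + 1) ^+ 2 + 1); apply: (mulIf nz); rewrite Ea Eb.
Qed.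

Lemma flow_coord_koebe : (forall c z, Psi c z 0 l = koebe_flow c (z 0 l)) ->
  (forall x z, P x z 0 l = - ((halfplane (z 0 l) ^+ 2 - 1) ^+ 2 /
     ((koebe_root x%:C (z 0 l) + 1) ^+ 3 * koebe_root x%:C (z 0 l)))) ->
  (forall z, G z 0 l = - (z 0 l * ((1 - z 0 l) / (1 + z 0 l)))) -> flow_coord Psi P G l.
Proof.
move=> hPsi hP hG.
have EG : (fun z => G z 0 l) = (fun z => - (z 0 l * ((1 - z 0 l) / (1 + z 0 l)))) by apply/funext.
have zl1 z : rnorm z < 1 -> rnorm (z 0 l) < 1 by apply: le_lt_trans; exact: rnorm_coord.
have nz1 z : rnorm z < 1 -> 1 + z 0 l != 0 by move=> /zl1; exact: neq0_1D.
split.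
- move=> x z x0 x1 z1.
  have -> : (fun z => Psi x%:C z 0 l) = (fun z => 4 * z 0 l / (1 - z 0 l) ^+ 2 /
      (koebe_root x%:C (z 0 l) + 1) ^+ 2) by apply/funext.
  have nz := neq0_1B (zl1 z z1).
  have dh : differentiable (fun z => halfplane (z 0 l)) z by rewrite /halfplane; diffc; exact: nz.
  have dk : differentiable (fun z => koebe_root x%:C (z 0 l)) z.
    apply: (@diffc_comp _ _ _ (fun z => 1 + x%:C * (halfplane (z 0 l) ^+ 2 - 1)) (@sqrtc R)).
      by diffc.
    apply: has_derivative_differentiable; apply: has_derivative_sqrtc.
    by have [] := koebe_root_bounds x0 x1 (zl1 z z1).
  by diffc; rewrite expf_neq0// koebe_root1D_neq0.
- move=> z /zl1 z1; rewrite hPsi /koebe_flow koebe_root1//; have nz := neq0_1B z1.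
  rewrite /halfplane; field; apply/andP; split; first exact: nz.
  have -> : 1 + z 0 l + (1 - z 0 l) = 2 by ring.
  by rewrite pnatr_eq0.
- move=> x z x0 x1 /zl1 z1; rewrite hPsi /koebe_flow -halfplaneB1//.
  have [k1 _] := koebe_root_bounds (ltW x0) x1 z1.
  have := koebe_root1D_neq0 x%:C (z 0 l); have := koebe_root_sqr x%:C (z 0 l).
  move: k1; set y := koebe_root _ _ => k1 yE nz.
  (* This Cayley transform of y has modulus less than 1 because Re y > 0. *)
  have -> : x%:C * ((halfplane (z 0 l) ^+ 2 - 1) / (y + 1) ^+ 2) = (y - 1) / (y + 1).
    have -> : (y - 1) / (y + 1) = (y ^+ 2 - 1) / (y + 1) ^+ 2 by field; exact: nz.
    by rewrite yE; ring.
  rewrite rnormf_div ltr_pdivrMr ?rnorm_gt0// mul1r.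
  rewrite -(@ltr_pXn2r _ 2) ?nnegrE ?rnorm_ge0// !rnorm_sqr !ReD !ImD ReN ImN /=; lra.
- move=> x z x0 x1 z1; rewrite hP.
  have -> : (fun c => Psi c z 0 l) = (fun c => koebe_flow c (z 0 l)) by apply/funext.
  have [k1 _] := koebe_root_bounds x0 x1 (zl1 z z1); have a1 := zl1 z z1.
  set a : C := z 0 l in k1 a1 *; set y := koebe_root x%:C a in k1 *.
  set W := halfplane a ^+ 2 - 1.
  have ny := koebe_root1D_neq0 x%:C a; rewrite -/y in ny.
  have y0 := Re_gt0_neq0 k1.
  pose q (c : C) : C := - (W ^+ 2 * (koebe_root c a + y + 2)) /
    ((koebe_root c a + 1) ^+ 2 * (y + 1) ^+ 2 * (koebe_root c a + y)).
  have ns c : koebe_root c a + y != 0.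
    by apply: Re_gt0_neq0; rewrite ReD ltr_wpDl// Re_sqrtc_ge0.
  have -> : - (W ^+ 2 / ((y + 1) ^+ 3 * y)) = q x%:C.
    by rewrite /q -/y; field; apply/and3P; split; [exact: ns | exact: ny | exact: y0].
  apply: has_derivative_quotient; last first.
    apply: contc_diff.
    have dk : differentiable (fun c => koebe_root c a) x%:C.
      apply: (@diffc_comp _ _ _ (fun c : C => 1 + c * W) (@sqrtc R)); first by diffc.
      by apply: has_derivative_differentiable; apply: has_derivative_sqrtc.
    by rewrite /q; diffc; rewrite !mulf_neq0 ?expf_neq0// koebe_root1D_neq0.
  apply/rnbhsP; exists 1 => // c _.
  have D : (c - x%:C) * W = koebe_root c a ^+ 2 - y ^+ 2 by rewrite !koebe_root_sqr -/W; ring.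
  have nc := koebe_root1D_neq0 c a; have nsc := ns c.
  have -> : (c - x%:C) * q c = ((c - x%:C) * W) * (- (W * (koebe_root c a + y + 2)) /
    ((koebe_root c a + 1) ^+ 2 * (y + 1) ^+ 2 * (koebe_root c a + y))) by rewrite /q; ring.
  rewrite D /koebe_flow -halfplaneB1// -/y -/W; field.
  by apply/and3P; split; [exact: nsc | exact: ny | exact: nc].
- move=> x z x0 x1 /zl1 z1; rewrite hG !mxE hPsi hP /koebe_flow -halfplaneB1//.
  have [k1 _] := koebe_root_bounds (ltW x0) x1 z1.
  have := koebe_root1D_neq0 x%:C (z 0 l); have := koebe_root_sqr x%:C (z 0 l).
  move: k1; set y := koebe_root _ _ => k1 yE nz; have y0 := Re_gt0_neq0 k1.
  set W := _ - 1 in yE *.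
  have -> : x%:C * (W / (y + 1) ^+ 2) = (y - 1) / (y + 1).
    have -> : (y - 1) / (y + 1) = (y ^+ 2 - 1) / (y + 1) ^+ 2 by field; exact: nz.
    by rewrite yE; ring.
  have -> : x%:C * (W / (y + 1) ^+ 2 + x%:C * - (W ^+ 2 / ((y + 1) ^+ 3 * y))) =
    (x%:C * W) / (y + 1) ^+ 2 - (x%:C * W) ^+ 2 / ((y + 1) ^+ 3 * y) by ring.
  have -> : x%:C * W = y ^+ 2 - 1 by rewrite yE; ring.
  field; apply/and3P; split; [exact: y0 | exact: nz | ].
  have -> : y + 1 + (y - 1) = y + y by ring.
  by apply: Re_gt0_neq0; rewrite ReD addr_gt0.
- move=> r r1; have [r0|r0] := ltP r 0.
    by exists 0 => // x z _ _ zr; have := rnorm_ge0 z; lra.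
  have rV : 0 < (1 - r)^-1 by rewrite invr_gt0 subr_gt0.
  (* 64 = 16 * 4: the factor 16 comes from the square of 4 a, and 4 / (1 - r) from the lower bound
     on the root; the remaining fourth power is that of 1 - a. *)
  exists (64 * (1 - r)^-1 ^+ 5); first by rewrite mulr_ge0// exprn_ge0// ltW.
  move=> x z x0 x1 zr; have z1 := le_lt_trans zr r1.
  have a1 := zl1 z z1; have ar := le_trans (rnorm_coord z l) zr.
  have [k1 k2] := koebe_root_bounds x0 x1 a1.
  have nz := neq0_1B a1.
  rewrite hP rnormN halfplaneB1//; set a := z 0 l in a1 ar k1 k2 nz *; set y := koebe_root _ _ in k1 k2 *.
  set yy := (y + 1) ^+ 3 * y.
  have -> : (4 * a / (1 - a) ^+ 2) ^+ 2 / yy = (16 * a ^+ 2 / yy) / (1 - a) ^+ 4.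
    by rewrite exprMn exprVn -exprM; ring.
  have rd : 1 - r <= rnorm (1 - a) by apply: le_trans (rnorm1B_ge _); rewrite lerD2l lerN2.
  have K4 : 0 <= 64 * (1 - r)^-1 by rewrite mulr_ge0// ltW.
  have -> : 64 * (1 - r)^-1 ^+ 5 = 64 * (1 - r)^-1 * (1 - r)^-1 ^+ 4 by ring.
  apply: rnorm_quadratic_fraction => //.
  rewrite rnormf_div rnormM rnormX -(realc_nat (R := R) 16) rnormC ger0_norm//.
  have y1 : 1 <= rnorm (y + 1).
    apply: le_trans (le_trans (ler_norm _) (Re_le_rnorm _)).
    by rewrite ReD /= lerDr ltW.
  have yV : (rnorm yy)^-1 <= 4 * (1 - r)^-1.
    have -> : 4 * (1 - r)^-1 = ((1 - r) / 4)^-1 by field; rewrite gt_eqF// subr_gt0.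
    rewrite lef_pV2 ?posrE ?divr_gt0 ?subr_gt0//; last first.
      by rewrite rnorm_gt0 mulf_neq0 ?expf_neq0 ?(Re_gt0_neq0 k1)// koebe_root1D_neq0.
    rewrite rnormM rnormX -[leLHS]mul1r; apply: ler_pM => //.
    - by rewrite divr_ge0// subr_ge0 ltW.
    - by rewrite exprn_ege1.
    - by apply: le_trans k2; rewrite ler_wpM2r// lerD2l lerN2.
  have -> : 64 * (1 - r)^-1 * rnorm z ^+ 2 = 16 * rnorm z ^+ 2 * (4 * (1 - r)^-1) by ring.
  apply: ler_pM => //; rewrite ?invr_ge0 ?mulr_ge0 ?exprn_ge0 ?rnorm_ge0//.
  by rewrite ler_wpM2l// lerXn2r ?nnegrE ?rnorm_ge0 ?rnorm_coord.
- by move=> z z1; rewrite EG; diffc; exact: nz1.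
- by move=> z z1 _ z0; exact: Re_cayley_field (hG z) z1 z0.
Qed.

End KoebeCoordinate.

(** * Rules for complex derivatives and mean values on segments *)

Section DerivativeRules.
Context {R : realType}.
Local Notation C := R[i].
Implicit Types (f g : C -> C) (u v w z l : C).

Lemma has_derivative_add f g z l m : has_derivative f z l -> has_derivative g z m ->
  has_derivative (fun w => f w + g w) z (l + m).
Proof.
move=> fl gm e e0; have e2 : 0 < e / 2 by rewrite divr_gt0.
have [d1 d10 h1] := fl _ e2; have [d2 d20 h2] := gm _ e2.
exists (Num.min d1 d2); first by rewrite lt_min d10.
move=> w; rewrite lt_min => /andP[/h1 k1 /h2 k2].
have -> : f w + g w - (f z + g z) - (l + m) * (w - z) =
  (f w - f z - l * (w - z)) + (g w - g z - m * (w - z)) by ring.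
by rewrite (le_trans (rnormD _ _))// (splitr e) mulrDl lerD.
Qed.

Lemma has_derivative_scale f z l (k : C) : has_derivative f z l ->
  has_derivative (fun w => k * f w) z (k * l).
Proof.
move=> fl e e0; have k0 : 0 < rnorm k + 1 by rewrite ltr_wpDl ?rnorm_ge0.
have [d d0 hd] := fl _ (divr_gt0 e0 k0); exists d => // w /hd H.
have -> : k * f w - k * f z - k * l * (w - z) = k * (f w - f z - l * (w - z)) by ring.
rewrite rnormM; apply: (@le_trans _ _ ((rnorm k + 1) * (e / (rnorm k + 1) * rnorm (w - z)))).
  by apply: ler_pM; rewrite ?rnorm_ge0// lerDl.
by rewrite mulrA mulrCA divff ?mulr1// gt_eqF.
Qed.

Lemma has_derivative_affine f (u v c l : C) : has_derivative f (u + c * v) l ->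
  has_derivative (fun c => f (u + c * v)) c (l * v).
Proof.
move=> fl e e0; have k0 : 0 < rnorm v + 1 by rewrite ltr_wpDl ?rnorm_ge0.
have [d d0 hd] := fl _ (divr_gt0 e0 k0); exists (d / (rnorm v + 1)); first by rewrite divr_gt0.
move=> w; rewrite ltr_pdivlMr// => wd.
have E : u + w * v - (u + c * v) = (w - c) * v by ring.
have wv : rnorm ((w - c) * v) <= rnorm (w - c) * (rnorm v + 1).
  by rewrite rnormM ler_wpM2l ?rnorm_ge0// lerDl.
have := hd (u + w * v); rewrite E => /(_ (le_lt_trans wv wd)).
have -> : l * ((w - c) * v) = l * v * (w - c) by ring.
move=> /le_trans; apply.
apply: (@le_trans _ _ (e / (rnorm v + 1) * (rnorm (w - c) * (rnorm v + 1)))).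
  by rewrite ler_wpM2l// ltW// divr_gt0.
have -> : e / (rnorm v + 1) * (rnorm (w - c) * (rnorm v + 1)) = e * rnorm (w - c) by field; rewrite gt_eqF.
exact: lexx.
Qed.

Lemma diffc_sum (V : normedModType C) (m : nat) (F : 'I_m -> V -> C) (v : V) :
  (forall i, differentiable (F i) v) -> differentiable (fun w : V => \sum_i F i w) v.
Proof.
move=> dF; have -> : (fun w : V => \sum_i F i w) = \sum_i F i.
  by apply/funext => w; rewrite fct_sumE.
exact: differentiable_sum.
Qed.

Lemma has_derivative_expn (m : nat) z : has_derivative (fun w => w ^+ m.+1) z (m.+1%:R * z ^+ m).
Proof.
pose q w := \sum_(i < m.+1) w ^+ (m - i) * z ^+ i.
have -> : m.+1%:R * z ^+ m = q z.
  rewrite /q (eq_bigr (fun=> z ^+ m)) => [|i _]; last by rewrite -exprD subnK// -ltnS.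
  by rewrite sumr_const card_ord mulr_natl.
apply: has_derivative_quotient.
  by apply/rnbhsP; exists 1 => // w _; rewrite subrXX; congr (_ * _); apply: eq_bigr => i _; rewrite subSS.
by apply: contc_diff; apply: diffc_sum => i; diffc.
Qed.

Lemma segment_mean_value f (df : C -> C) u v (M : R) :
  (forall t : R, 0 <= t -> t <= 1 -> has_derivative f (u + t%:C * (v - u)) (df (u + t%:C * (v - u))) /\
    rnorm (df (u + t%:C * (v - u))) <= M) ->
  rnorm (f v - f u) <= M * rnorm (v - u).
Proof.
move=> h; pose k := M * rnorm (v - u).
have := @mean_value_path _ _ (fun t : R => f (u + t%:C * (v - u)))
  (fun t => df (u + t%:C * (v - u)) * (v - u)) (fun s => k * s) (fun=> k) 0 1 ler01.
rewrite realc1 realc0 mul1r mul0r addr0 subrKC mulr1 mulr0 subr0; apply.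
- move=> t t0 t1; apply: (@has_derivative_path _ (fun c => f (u + c * (v - u)))).
  by apply: has_derivative_affine; case: (h t t0 t1).
- by move=> t _ _; apply: is_derive_eq; rewrite /GRing.scale /= mulr1.
- by move=> t t0 t1; rewrite rnormM ler_wpM2r ?rnorm_ge0//; case: (h t t0 t1).
Qed.

Lemma differentiable_lipschitz (V : normedModType C) (g : V -> C) (v : V) : differentiable g v ->
  exists K d : R, [/\ 0 <= K, 0 < d & forall w : V, rnorm (w - v) < d -> rnorm (g w - g v) <= K * rnorm (w - v)].
Proof.
move=> dg; have : {for 0, continuous ('d g v)} by exact: (diff_continuous dg).
move=> /continuous_rnormP /(_ 1 ltr01)[d1 d10 h1].
have [d d0 hd] := diff_rnorm dg ltr01.
exists (2 / d1 + 1), d; split=> // [|w wd]; first by rewrite addr_ge0// divr_ge0// ltW.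
have -> : g w - g v = (g w - g v - 'd g v (w - v)) + 'd g v (w - v) by ring.
rewrite (le_trans (rnormD _ _))// mulrDl addrC lerD//; last exact: hd.
have [->|wv] := eqVneq (w - v) 0; first by rewrite linear0 !rnorm0 mulr0.
have n0 : 0 < rnorm (w - v) by rewrite rnorm_gt0.
pose s := d1 / 2 / rnorm (w - v); have s0 : 0 < s by rewrite !divr_gt0.
have := h1 (s%:C *: (w - v)); rewrite subr0 linear0 subr0 linearZ !rnormZ rnormC gtr0_norm//.
rewrite /s divfK ?gt_eqF// => /(_ _)/ltW H.
have hh : d1 / 2 < d1 by lra.
have := H hh; rewrite mulrC mulrA ler_pdivrMr// mul1r mulrC => H'.
rewrite -(@ler_pM2l _ (d1 / 2)) ?divr_gt0// (le_trans H')//.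
have -> : d1 / 2 * (2 / d1 * rnorm (w - v)) = rnorm (w - v) by field; rewrite gt_eqF.
exact: lexx.
Qed.

Lemma differentiable_near (V : normedModType C) (g h : V -> C) (v : V) :
  (\forall w \near v, h w = g w) -> differentiable g v -> differentiable h v.
Proof.
move=> /rnbhsP[d d0 hd] dg.
have hv : h v = g v by apply: hd; rewrite subrr rnorm0.
have -> : h = (fun w : V => g w + (h w - g w)) by apply/funext => w; rewrite subrKC.
apply: (diffc_add dg); apply: differentiable_littleo => e e0; exists d => // w wd.
by rewrite hd// hv !subrr rnorm0 mulr_ge0 ?rnorm_ge0// ltW.
Qed.

End DerivativeRules.

(** * The principal logarithm on the right half-plane *)

Section Logarithm.
Context {R : realType}.
Local Notation C := R[i].
Implicit Types (u v w z : C) (r : R).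

Lemma clog_trig w : w != 0 -> cos (carg w) = complex.Re w / rnorm w /\
  sin (carg w) = complex.Im w / rnorm w.
Proof.
move=> w0; have n0 : 0 < rnorm w by rewrite rnorm_gt0.
have t1 : -1 <= complex.Re w / rnorm w <= 1.
  by rewrite -ler_norml normrM normfV (gtr0_norm n0) ler_pdivrMr// mul1r Re_le_rnorm.
have C1 : cos (acos (complex.Re w / rnorm w)) = complex.Re w / rnorm w by rewrite acosK.
have S1 : sin (acos (complex.Re w / rnorm w)) = `|complex.Im w| / rnorm w.
  rewrite sin_acos// -[RHS]ger0_norm ?divr_ge0 ?rnorm_ge0// -sqrtr_sqr; congr Num.sqrt.
  rewrite !expr_div_n real_normK ?num_real//.
  have -> : complex.Im w ^+ 2 = rnorm w ^+ 2 - complex.Re w ^+ 2 by rewrite rnorm_sqr; ring.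
  by field; rewrite gt_eqF.
rewrite /carg -/(rnorm w); case: ifP => Im0; first by rewrite C1 S1 ger0_norm.
by rewrite cosN sinN C1 S1 ltr0_norm ?ltNge ?Im0// mulNr opprK.
Qed.

Lemma cexp_clog w : w != 0 -> cexp (ln (rnorm w)) (carg w) = w.
Proof.
move=> w0; have n0 : 0 < rnorm w by rewrite rnorm_gt0.
rewrite /cexp /cis lnK ?posrE//; have [-> ->] := clog_trig w0.
case: w w0 n0 => a b w0 n0; apply/eqP; rewrite eq_complex /= !mul0r subr0 addr0.
have E t : rnorm (a +i* b) * (t / rnorm (a +i* b)) = t by field; rewrite gt_eqF.
by rewrite !E !eqxx.
Qed.

Lemma carg_atan w : 0 < complex.Re w -> carg w = atan (complex.Im w / complex.Re w).
Proof.
move=> w0; have wn0 : w != 0 by apply: Re_gt0_neq0.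
have n0 : 0 < rnorm w by rewrite rnorm_gt0.
have [Cw Sw] := clog_trig wn0.
have := tanK; move=> /(_ R (carg w)) <-; first by rewrite /tan Cw Sw; congr atan; field; rewrite !gt_eqF.
have t1 : -1 <= complex.Re w / rnorm w <= 1.
  by rewrite -ler_norml normrM normfV (gtr0_norm n0) ler_pdivrMr// mul1r Re_le_rnorm.
have A : acos (complex.Re w / rnorm w) < pi / 2.
  rewrite -ltr_cos ?in_itv/= ?acos_ge0 ?acos_lepi ?divr_ge0 ?pi_ge0//; last first.
    by rewrite ler_pdivrMr// ler_peMr ?pi_ge0// ler1n.
  by rewrite cos_pihalf acosK// divr_gt0.
have A0 := acos_ge0 t1; have p0 := pi_gt0 R.
rewrite in_itv /= /carg -/(rnorm w); case: ifP => _; apply/andP; split; lra.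
Qed.

Lemma continuous_clog w : 0 < complex.Re w -> {for w, continuous (@clog R)}.
Proof.
move=> w0; have wn0 : 0 < rnorm w by rewrite rnorm_gt0; apply: Re_gt0_neq0.
have cn : {for w, continuous (fun w => ln (rnorm w))}.
  apply: (@continuous_comp _ _ _ (@rnorm R C) (@ln R)); last exact: continuous_ln.
  move=> A /= /nbhs_normP[e /= e0 he]; apply/rnbhsP; exists e => // v hv; apply: he.
  have T1 := rnormD (w - v) v; have T2 := rnormD (v - w) w.
  rewrite !subrK in T1 T2; rewrite rdistC in T1.
  by rewrite /ball_ /= ltr_norml; lra.
have c1 : {for w, continuous (fun v => atan (complex.Im v / complex.Re v))}.
  apply: (@continuous_comp _ _ _ (fun v : C => complex.Im v / complex.Re v) (@atan R)); last exact: continuous_atan.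
  have nz : complex.Re w != 0 by rewrite gt_eqF.
  exact: (cvgM (@Im_continuous R w) (cvgV nz (@Re_continuous R w))).
have ca : carg v @[v --> w] --> carg w.
  have near_atan : \forall v \near w, atan (complex.Im v / complex.Re v) = carg v.
    apply/rnbhsP; exists (complex.Re w) => // v vw; rewrite carg_atan//.
    by have := le_lt_trans (Re_le_rnorm (v - w)) vw; rewrite ltr_norml ReD ReN; lra.
  by rewrite carg_atan//; exact: (cvg_trans (near_eq_cvg near_atan) c1).
exact: complex_cvg cn ca.
Qed.

(** The exponential is inverted: with D = log v - log w, its expansion at log w gives v - w = w D +
    o(D), and continuity of the logarithm makes D small. *)
Lemma has_derivative_clog w : 0 < complex.Re w -> has_derivative (@clog R) w w^-1.
Proof.
move=> w0 e e0; have wn0 := Re_gt0_neq0 w0.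
have n0 : 0 < rnorm w by rewrite rnorm_gt0.
(* Two demands are met: 2 e1 <= |w| / 2, which yields |D| <= 2 |v - w| / |w|, and 2 e1 (2 / |w|) <=
   e |w|, which is the final error. *)
pose e1 := Num.min (1 / 2) (e * rnorm w / 2) * rnorm w / 2.
have e10 : 0 < e1 by rewrite !divr_gt0// !mulr_gt0// lt_min !divr_gt0// mulr_gt0.
have [d1 d10 h1] := cexp_expansion (ln (rnorm w)) (carg w) e10.
have /continuous_rnormP/(_ d1 d10)[d2 d20 h2] := continuous_clog w0.
exists (Num.min d2 (complex.Re w)); first by rewrite lt_min d20.
move=> v; rewrite lt_min => /andP[vd2 vw].
have v0 : 0 < complex.Re v.
  have := le_lt_trans (Re_le_rnorm (v - w)) vw; rewrite ltr_norml ReD ReN; lra.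
have L := h2 v vd2; set D := clog v - clog w in L *.
have DE : D = (ln (rnorm v) - ln (rnorm w)) +i* (carg v - carg w) by [].
have L1 := le_lt_trans (Re_le_rnorm D) L; have L2 := le_lt_trans (Im_le_rnorm D) L.
have := h1 _ _ L1 L2; rewrite !cexp_clog ?(Re_gt0_neq0 v0)// -DE => H.
have H1 : rnorm (v - w - w * D) <= 2 * e1 * rnorm D.
  apply: (le_trans H); have -> : 2 * e1 * rnorm D = e1 * (rnorm D + rnorm D) by ring.
  by rewrite ler_wpM2l ?(ltW e10)// lerD//; [exact: (Re_le_rnorm D) | exact: (Im_le_rnorm D)].
have E1 : 2 * e1 <= rnorm w / 2.
  have -> : 2 * e1 = Num.min (1 / 2) (e * rnorm w / 2) * rnorm w by rewrite /e1; field.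
  by rewrite mulrC ler_pM2l// ge_min div1r lexx.
have E2 : 2 * e1 * (2 / rnorm w) <= e * rnorm w.
  have -> : 2 * e1 * (2 / rnorm w) = Num.min (1 / 2) (e * rnorm w / 2) * 2.
    by rewrite /e1; field; rewrite gt_eqF.
  by rewrite -ler_pdivlMr// ge_min lexx orbT.
have H2 : rnorm D <= 2 / rnorm w * rnorm (v - w).
  have : rnorm (w * D) <= rnorm (v - w) + 2 * e1 * rnorm D.
    have -> : w * D = (v - w) - (v - w - w * D) by ring.
    by rewrite (le_trans (rnormB _ _))// lerD2l.
  rewrite rnormM => H3; have : rnorm w / 2 * rnorm D <= rnorm (v - w).
    have := ler_wpM2r (rnorm_ge0 D) E1; lra.
  move=> H4; rewrite -(@ler_pM2l _ (rnorm w / 2)) ?divr_gt0// (le_trans H4)//.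
  have -> : rnorm w / 2 * (2 / rnorm w * rnorm (v - w)) = rnorm (v - w) by field; rewrite gt_eqF.
  exact: lexx.
have -> : D - w^-1 * (v - w) = - (w^-1 * (v - w - w * D)) by field.
rewrite rnormN rnormM rnormV mulrC ler_pdivrMr// (le_trans H1)//.
apply: (@le_trans _ _ (2 * e1 * (2 / rnorm w * rnorm (v - w)))).
  by rewrite ler_wpM2l// mulr_ge0// ltW.
by rewrite mulrA [leRHS]mulrAC ler_wpM2r ?rnorm_ge0.
Qed.

End Logarithm.

(** * The divided difference of log(1 + w) *)

Section LogQuotient.
Context {R : realType}.
Local Notation C := R[i].
Implicit Types (u v w a : C) (r M : R).

Lemma rnorm_segment (u v a : C) (t r : R) : 0 <= t -> t <= 1 -> rnorm (u - a) <= r ->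
  rnorm (v - a) <= r -> rnorm (u + t%:C * (v - u) - a) <= r.
Proof.
move=> t0 t1 ur vr.
have -> : u + t%:C * (v - u) - a = (1 - t)%:C * (u - a) + t%:C * (v - a).
  by rewrite realcB realc1; ring.
rewrite (le_trans (rnormD _ _))// !rnormM !rnormC !ger0_norm ?subr_ge0//.
have -> : r = (1 - t) * r + t * r by ring.
by apply: lerD; rewrite ler_wpM2l ?subr_ge0.
Qed.

Lemma has_derivative_log1p w : rnorm w < 1 ->
  has_derivative (fun w : C => clog (1 + w)) w (1 + w)^-1.
Proof.
move=> w1; have w0 : 0 < complex.Re (1 + w * 1).
  rewrite mulr1 ReD /=; have := le_lt_trans (Re_le_rnorm w) w1.
  by rewrite ltr_norml; lra.
have := has_derivative_affine (has_derivative_clog w0); rewrite !mulr1.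
by under eq_fun do rewrite mulr1.
Qed.

(** The difference to be estimated is the divided difference of log(1 + w) - g, bounded by the
    derivative of that function on the segment from v to u. Taking for g zero, a Taylor polynomial
    at a (up to a constant) or a partial sum of the series gives the three estimates that follow. *)
Lemma log_quotient_approx (g dg : C -> C) (D u v : C) r M : r < 1 -> rnorm u <= r -> rnorm v <= r ->
  (forall w, has_derivative g w (dg w)) ->
  (forall t : R, 0 <= t -> t <= 1 ->
     rnorm ((1 + (v + t%:C * (u - v)))^-1 - dg (v + t%:C * (u - v))) <= M) ->
  g u - g v = (u - v) * D -> (u = v -> D = dg u) -> rnorm (log_quotient u v - D) <= M.
Proof.
move=> r1 ur vr hg hM gD uvD; rewrite /log_quotient; case: eqVneq => [uv|uv].
  by rewrite uvD//; have := hM 0 (lexx _) ler01; rewrite realc0 mul0r addr0 -uv.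
have uv0 : 0 < rnorm (u - v) by rewrite rnorm_gt0 subr_eq0.
have nz : u - v != 0 by rewrite subr_eq0.
have -> : (clog (1 + u) - clog (1 + v)) / (u - v) - D =
    ((clog (1 + u) + - 1 * g u) - (clog (1 + v) + - 1 * g v)) / (u - v).
  have -> : g u = g v + (u - v) * D by rewrite -gD subrKC.
  by field; exact: nz.
rewrite rnormf_div ler_pdivrMr//.
apply: (@segment_mean_value _ (fun w => clog (1 + w) + - 1 * g w) (fun w => (1 + w)^-1 + - 1 * dg w)).
move=> t t0 t1; split; last by rewrite mulN1r; exact: hM.
apply: has_derivative_add; last exact: has_derivative_scale.
apply: has_derivative_log1p; apply: le_lt_trans r1; rewrite -[X in rnorm X]subr0.
by apply: rnorm_segment; rewrite ?subr0.
Qed.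

Lemma log_quotient_bound u v r : r < 1 -> rnorm u <= r -> rnorm v <= r ->
  rnorm (log_quotient u v) <= (1 - r)^-1.
Proof.
move=> r1 ur vr; rewrite -[X in rnorm X]subr0.
apply: (@log_quotient_approx (fun=> 0) (fun=> 0) _ _ _ r) => //.
- by move=> w; exact: has_derivative_cst.
- move=> t t0 t1; rewrite subr0 rnormV; apply: rnormV_le => //.
  have : rnorm (v + t%:C * (u - v)) <= r.
    by rewrite -[X in rnorm X]subr0; apply: rnorm_segment; rewrite ?subr0.
  by move=> H; apply: le_trans (rnorm1D_ge _); rewrite lerD2l lerN2.
- by rewrite subrr mulr0.
Qed.

(* Second-order Taylor expansion of the divided difference of log (1 + w) around (a, a). *)
Lemma log_quotient_diagonal a u v (m r : R) : r < 1 -> rnorm a <= r -> rnorm u <= r -> rnorm v <= r ->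
  rnorm (u - a) <= m -> rnorm (v - a) <= m ->
  rnorm (log_quotient u v - ((1 + a)^-1 - (1 + a)^-1 ^+ 2 * ((u - a) + (v - a)) / 2)) <=
    (1 - r)^-1 ^+ 3 * m ^+ 2.
Proof.
move=> r1 ar ur vr um vm; set p := (1 + a)^-1.
have rV : 0 <= (1 - r)^-1 by rewrite invr_ge0 subr_ge0 ltW.
have small w : rnorm w <= r -> 1 - r <= rnorm (1 + w).
  by move=> H; apply: le_trans (rnorm1D_ge _); rewrite lerD2l lerN2.
have nz w : rnorm w <= r -> 1 + w != 0 by move=> H; apply: neq0_1D; exact: le_lt_trans r1.
pose dg w := p - p ^+ 2 * (w - a).
apply: (@log_quotient_approx (fun w => p * w - p ^+ 2 * (w - a) ^+ 2 / 2) dg _ _ _ r) => //.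
- move=> w; pose q c := p - p ^+ 2 * ((c - a) + (w - a)) / 2.
  have -> : dg w = q w by rewrite /q /dg; field.
  apply: has_derivative_quotient; last by apply: contc_diff; rewrite /q; diffc.
  by apply/rnbhsP; exists 1 => // c _; rewrite /q; field.
- move=> t t0 t1; set w := v + t%:C * (u - v).
  have wr : rnorm w <= r by rewrite -[X in rnorm X]subr0; apply: rnorm_segment; rewrite ?subr0.
  have wm : rnorm (w - a) <= m by exact: rnorm_segment.
  have nw := nz w wr; have na := nz a ar.
  have -> : (1 + w)^-1 - dg w = p ^+ 2 * (w - a) ^+ 2 / (1 + w) by rewrite /dg /p; field; rewrite nw na.
  rewrite rnormf_div rnormM !rnormX /p rnormV.
  have -> : (1 - r)^-1 ^+ 3 * m ^+ 2 = (1 - r)^-1 ^+ 2 * m ^+ 2 * (1 - r)^-1 by ring.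
  apply: ler_pM; rewrite ?mulr_ge0 ?exprn_ge0 ?invr_ge0 ?rnorm_ge0//; last first.
    by apply: rnormV_le => //; exact: small.
  apply: ler_pM; rewrite ?exprn_ge0 ?invr_ge0 ?rnorm_ge0//; apply: lerXn2r; rewrite ?nnegrE ?invr_ge0 ?rnorm_ge0//.
  + by rewrite subr_ge0 ltW.
  + by apply: rnormV_le => //; exact: small.
  + exact: le_trans (rnorm_ge0 _) wm.
- by field.
- by move=> ->; rewrite /dg; field.
Qed.

(** If g y and h y differ, the function is near y a quotient of differentiable ones. If they agree,
    the second-order estimate leaves an error quadratic in w - y, because g and h are Lipschitz at
    y. *)
Lemma differentiable_log_quotient (V : normedModType C) (g h : V -> C) (y : V) :
  differentiable g y -> differentiable h y -> rnorm (g y) < 1 -> rnorm (h y) < 1 ->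
  differentiable (fun w : V => log_quotient (g w) (h w)) y.
Proof.
move=> dg dh g1 h1; have [gh|gh] := eqVneq (g y) (h y); last first.
  pose k (w : V) := (clog (1 + g w) - clog (1 + h w)) / (g w - h w).
  apply: (differentiable_near (g := k)).
    have dd : differentiable (fun w : V => g w - h w) y by diffc.
    have nz : g y - h y != 0 by rewrite subr_eq0.
    apply: filterS (near_neq0 dd nz) => w; rewrite subr_eq0 => /negbTE nw.
    by rewrite /log_quotient nw.
  have dg' : differentiable (fun w : V => clog (1 + g w)) y.
    exact: (@diffc_comp _ _ _ g (fun w => clog (1 + w)) y dg
      (has_derivative_differentiable (has_derivative_log1p g1))).
  have dh' : differentiable (fun w : V => clog (1 + h w)) y.
    exact: (@diffc_comp _ _ _ h (fun w => clog (1 + w)) y dh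
      (has_derivative_differentiable (has_derivative_log1p h1))).
  by rewrite /k; diffc; rewrite subr_eq0.
set a := g y in gh g1; pose r := (1 + rnorm a) / 2.
have r1 : r < 1 by rewrite /r; lra.
have ar : rnorm a < r by rewrite /r; lra.
pose T (w : V) := (1 + a)^-1 - (1 + a)^-1 ^+ 2 * ((g w - a) + (h w - a)) / 2.
have -> : (fun w : V => log_quotient (g w) (h w)) = (fun w : V => T w + (log_quotient (g w) (h w) - T w)).
  by apply/funext => w; rewrite subrKC.
have dT : differentiable T y by rewrite /T; diffc.
apply: (diffc_add dT); apply: differentiable_littleo => e e0.
have [K1 [d1 [K10 d10 hg]]] := differentiable_lipschitz dg.
have [K2 [d2 [K20 d20 hh]]] := differentiable_lipschitz dh.
pose K := K1 + K2 + 1; have K0 : 0 < K by rewrite /K; lra.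
pose B := (1 - r)^-1 ^+ 3 * K ^+ 2.
have B0 : 0 < B by rewrite mulr_gt0 ?exprn_gt0// invr_gt0 subr_gt0.
exists (Num.min (Num.min d1 d2) (Num.min ((r - rnorm a) / K) (e / B))).
  by rewrite !lt_min d10 d20 !divr_gt0// subr_gt0.
move=> w; rewrite !lt_min => /andP[/andP[w1 w2] /andP[]].
rewrite !ltr_pdivlMr// => w3 w4.
have n0 := rnorm_ge0 (w - y).
have ga : rnorm (g w - a) <= K * rnorm (w - y).
  by apply: (le_trans (hg w w1)); rewrite ler_wpM2r// /K; lra.
have ha : rnorm (h w - a) <= K * rnorm (w - y).
  by rewrite gh; apply: (le_trans (hh w w2)); rewrite ler_wpM2r// /K; lra.
have near_r b : rnorm (b - a) <= K * rnorm (w - y) -> rnorm b <= r.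
  by move=> ba; have := rnormD (b - a) a; rewrite subrK; lra.
have Ty : log_quotient (g y) (h y) - T y = 0.
  by rewrite /log_quotient /T -/a -gh eqxx subrr addr0 mulr0 mul0r subr0 subrr.
rewrite Ty subr0.
have := log_quotient_diagonal r1 (ltW ar) (near_r _ ga) (near_r _ ha) ga ha.
move=> /le_trans; apply; rewrite exprMn mulrA -/B expr2 mulrA ler_wpM2r// mulrC ltW//.
Qed.

Definition log_coef (m : nat) : C := (- 1) ^+ m / m.+1%:R.

(** The divided difference of a partial sum of log(1 + w), with terms [log_coef m] w^(m + 1); the
    inner sum is (u^(m + 1) - v^(m + 1)) / (u - v), written so that it covers u = v. *)
Definition log_quotient_sum (N : nat) u v : C :=
  \sum_(m < N) log_coef m * \sum_(p < m.+1) u ^+ (m - p) * v ^+ p.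

Lemma log_quotient_series (N : nat) u v r : r < 1 -> rnorm u <= r -> rnorm v <= r ->
  rnorm (log_quotient u v - log_quotient_sum N u v) <= r ^+ N / (1 - r).
Proof.
move=> r1 ur vr; have r0 := le_trans (rnorm_ge0 _) ur.
pose g w := \sum_(m < N) log_coef m * w ^+ m.+1.
pose dg w := \sum_(m < N) (- w) ^+ m.
have coefE m w : log_coef m * (m.+1%:R * w ^+ m) = (- w) ^+ m.
  have -> : - w = -1 * w by rewrite mulN1r.
  by rewrite /log_coef mulrA divfK ?pnatr_eq0// exprMn.
apply: (@log_quotient_approx g dg _ _ _ r) => //.
- move=> w; rewrite /g /dg; elim: N {g dg} => [|N ih].
    have -> : (fun c : C => \sum_(m < 0) log_coef m * c ^+ m.+1) = (fun=> 0).
      by apply/funext => c; rewrite big_ord0.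
    by rewrite big_ord0; exact: has_derivative_cst.
  have -> : (fun c : C => \sum_(m < N.+1) log_coef m * c ^+ m.+1) =
      (fun c => \sum_(m < N) log_coef m * c ^+ m.+1 + log_coef N * c ^+ N.+1).
    by apply/funext => c; rewrite big_ord_recr.
  rewrite big_ord_recr /= -coefE; apply: (has_derivative_add ih).
  by apply: has_derivative_scale; exact: has_derivative_expn.
- move=> t t0 t1; set w := v + t%:C * (u - v).
  have wr : rnorm w <= r by rewrite -[X in rnorm X]subr0; apply: rnorm_segment; rewrite ?subr0.
  have nz : 1 + w != 0 by apply: neq0_1D; exact: le_lt_trans r1.
  have -> : (1 + w)^-1 - dg w = (- w) ^+ N / (1 + w).
    have := subrX1 (- w) N; rewrite -/(dg w) => H.
    have -> : (- w) ^+ N = 1 - (1 + w) * dg w by rewrite -[LHS](subrK 1) H; ring.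
    by field; exact: nz.
  rewrite rnormf_div rnormX rnormN; apply: ler_pM; rewrite ?exprn_ge0 ?invr_ge0 ?rnorm_ge0//.
    by apply: lerXn2r; rewrite ?nnegrE ?rnorm_ge0.
  by apply: rnormV_le => //; apply: le_trans (rnorm1D_ge _); rewrite lerD2l lerN2.
- rewrite /g /log_quotient_sum -sumrB mulr_sumr; apply: eq_bigr => m _.
  by rewrite -mulrBr subrXX mulrCA.
- move=> <-; rewrite /log_quotient_sum; apply: eq_bigr => m _; rewrite -coefE; congr (_ * _).
  rewrite (eq_bigr (fun=> u ^+ m)) => [|p _]; last by rewrite -exprD subnK// -ltnS.
  by rewrite sumr_const card_ord mulr_natl.
Qed.

End LogQuotient.

Section LogCoordinate.
Context {R : realType} {n : nat}.
Local Notation C := R[i].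
Local Notation Cn := 'rV[R[i]]_n.
Implicit Types (z : Cn) (x r : R) (l : 'I_n).
Variables (Psi : C -> Cn -> Cn) (P : R -> Cn -> Cn) (G : Cn -> Cn) (l : 'I_n).

(** For u = x z_j / (1 + (1 - x) z_j), one has log(1 + u) = log(1 + z_j) - log(1 + (1 - x) z_j). In
    f^-1(x f(z)) the logarithms of 1 + z_j and 1 + z_k therefore cancel, and only the quotient at
    the scaled points remains. *)
Lemma flow_coord_log j k : (forall c z, Psi c z 0 j = z 0 j / (1 + (1 - c) * z 0 j)) ->
  (forall c z, Psi c z 0 k = z 0 k / (1 + (1 - c) * z 0 k)) ->
  (forall c z, Psi c z 0 l = z 0 l + z 0 j * z 0 k *
     ((1 - c) * log_quotient ((1 - c) * z 0 j) ((1 - c) * z 0 k))) ->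
  (forall x z, P x z 0 l =
     - (z 0 j * z 0 k / ((1 + (1 - x%:C) * z 0 j) * (1 + (1 - x%:C) * z 0 k)))) ->
  (forall z, G z 0 l = - z 0 l + z 0 j * z 0 k) -> flow_coord Psi P G l.
Proof.
move=> hj hk hPsi hP hG.
have EG : (fun z => G z 0 l) = (fun z => - z 0 l + z 0 j * z 0 k) by apply/funext.
have small x z i r : 0 <= x -> x <= 1 -> rnorm z <= r ->
    rnorm ((1 - x%:C) * z 0 i) <= (1 - x) * r.
  move=> x0 x1 zr; rewrite rnormM -realc1 -realcB rnormC ger0_norm ?subr_ge0//.
  by rewrite ler_wpM2l ?subr_ge0// (le_trans (rnorm_coord _ _)).
have small1 x z i : 0 <= x -> x <= 1 -> rnorm z < 1 -> rnorm ((1 - x%:C) * z 0 i) < 1.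
  move=> x0 x1 z1; apply: (le_lt_trans (small x z i _ x0 x1 (lexx _))).
  have := rnorm_ge0 z; nra.
have nz x z i : 0 <= x -> x <= 1 -> rnorm z < 1 -> 1 + (1 - x%:C) * z 0 i != 0.
  by move=> x0 x1 z1; apply: neq0_1D; exact: small1.
split.
- move=> x z x0 x1 z1.
  have -> : (fun z => Psi x%:C z 0 l) = (fun z => z 0 l + z 0 j * z 0 k *
     ((1 - x%:C) * log_quotient ((1 - x%:C) * z 0 j) ((1 - x%:C) * z 0 k))) by apply/funext.
  have dL : differentiable (fun z => log_quotient ((1 - x%:C) * z 0 j) ((1 - x%:C) * z 0 k)) z.
    apply: differentiable_log_quotient; [by diffc | by diffc | exact: small1 | exact: small1].
  by diffc.
- by move=> z _; rewrite hPsi subrr mul0r mulr0 addr0.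
- move=> x z x0 x1 z1; rewrite hPsi rnormM rnormC gtr0_norm//.
  have r0 := rnorm_ge0 z; set r := rnorm z in z1 r0 *.
  have cr1 : (1 - x) * r < 1 by nra.
  have L := log_quotient_bound cr1 (small x z j r (ltW x0) x1 (lexx _)) (small x z k r (ltW x0) x1 (lexx _)).
  set LQ := log_quotient _ _ in L *.
  have h1 : rnorm (z 0 j * z 0 k * ((1 - x%:C) * LQ)) * x <= (1 - x) * r ^+ 2.
    rewrite rnormM (rnormM (1 - _)) -realc1 -realcB rnormC ger0_norm ?subr_ge0//.
    (* The bound 1 / (1 - (1 - x) r) on the quotient is compensated by x <= 1 - (1 - x) r. *)
    have LX : rnorm LQ * x <= 1.
      rewrite -(@mulVf _ (1 - (1 - x) * r)); last by rewrite gt_eqF// subr_gt0.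
      by apply: ler_pM; rewrite ?rnorm_ge0 ?(ltW x0)//; nra.
    have := rnorm_coordM z j k; rewrite mul1r -/r => H.
    have -> : rnorm (z 0 j * z 0 k) * ((1 - x) * rnorm LQ) * x =
      ((1 - x) * rnorm (z 0 j * z 0 k)) * (rnorm LQ * x) by ring.
    rewrite -[leRHS]mulr1; apply: ler_pM; rewrite ?mulr_ge0 ?subr_ge0 ?rnorm_ge0 ?(ltW x0)//.
    by rewrite ler_wpM2l ?subr_ge0.
  apply: (@le_lt_trans _ _ r) => //.
  apply: (@le_trans _ _ (x * r + (1 - x) * r ^+ 2)); last first.
    have -> : x * r + (1 - x) * r ^+ 2 = r - (1 - x) * r * (1 - r) by ring.
    by rewrite lerBlDr lerDl !mulr_ge0// subr_ge0// ltW.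
  apply: (@le_trans _ _ (x * rnorm (z 0 l) + x * rnorm (z 0 j * z 0 k * ((1 - x%:C) * LQ)))).
    by rewrite -mulrDr ler_wpM2l ?(ltW x0) ?rnormD.
  by apply: lerD; [rewrite ler_wpM2l ?(ltW x0) ?rnorm_coord | rewrite mulrC].
- move=> x z x0 x1 z1; rewrite hP.
  have -> : (fun c => Psi c z 0 l) = (fun c => z 0 l + z 0 j * z 0 k *
     ((1 - c) * log_quotient ((1 - c) * z 0 j) ((1 - c) * z 0 k))) by apply/funext.
  have na := nz x z j x0 x1 z1; have nb := nz x z k x0 x1 z1.
  have a1 := small1 x z j x0 x1 z1; have b1 := small1 x z k x0 x1 z1.
  set a : C := z 0 j in na a1 *; set b : C := z 0 k in nb b1 *.
  set A := 1 + (1 - x%:C) * a in na *; set B := 1 + (1 - x%:C) * b in nb *.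
  have -> : - (a * b / (A * B)) = 0 + a * b * (- (A * B)^-1) by ring.
  apply: has_derivative_add; first exact: has_derivative_cst.
  apply: has_derivative_scale; have [ab|ab] := eqVneq a b.
    have -> : (fun c : C => (1 - c) * log_quotient ((1 - c) * a) ((1 - c) * b)) =
        (fun c => (1 - c) / (1 + (1 - c) * a)).
      by apply/funext => c; rewrite /log_quotient -ab eqxx.
    pose q (c : C) : C := - (A * (1 + (1 - c) * a))^-1.
    have -> : - (A * B)^-1 = q x%:C by rewrite /q /A /B -ab.
    apply: has_derivative_quotient; last by apply: contc_diff; rewrite /q; diffc; rewrite mulf_neq0.
    have : differentiable (fun c : C => 1 + (1 - c) * a) x%:C by diffc.
    move=> /near_neq0 /(_ na); apply: filterS => c hc; rewrite /q /A; field.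
    by apply/andP; split; [exact: hc | exact: na].
  have nab : a - b != 0 by rewrite subr_eq0.
  (* The factor 1 - c cancels the one in the denominator. A difference of logarithms remains, and
     the formula persists at c = 1, where both sides vanish. *)
  have -> : (fun c : C => (1 - c) * log_quotient ((1 - c) * a) ((1 - c) * b)) =
      (fun c => (a - b)^-1 * (clog (1 + (a + c * - a)) + - 1 * clog (1 + (b + c * - b)))).
    apply/funext => c; have -> : a + c * - a = (1 - c) * a by ring.
    have -> : b + c * - b = (1 - c) * b by ring.
    have [->|c1] := eqVneq c 1; first by rewrite subrr !mul0r addr0 mulN1r subrr mulr0.
    have c0 : 1 - c != 0 by rewrite subr_eq0 eq_sym.
    rewrite /log_quotient (inj_eq (mulfI c0)) (negbTE ab) -mulrBr.
    by field; rewrite c0 nab.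
  have da e : rnorm ((1 - x%:C) * e) < 1 ->
      has_derivative (fun c => clog (1 + (e + c * - e))) x%:C ((1 + (1 - x%:C) * e)^-1 * - e).
    move=> e1; have E : e + x%:C * - e = (1 - x%:C) * e by ring.
    rewrite -E; apply: (@has_derivative_affine _ (fun w => clog (1 + w))).
    by apply: has_derivative_log1p; rewrite E.
  have -> : - (A * B)^-1 = (a - b)^-1 * (A^-1 * - a + - 1 * (B^-1 * - b)).
    move: na nb; rewrite /A /B => na nb; field.
    by apply/and3P; split; [exact: nb | exact: na | exact: nab].
  apply: has_derivative_scale; apply: has_derivative_add; first exact: da.
  by apply: has_derivative_scale; exact: da.
- move=> x z x0 x1 z1; rewrite hG !mxE hj hk hPsi hP.
  have na := nz x z j (ltW x0) x1 z1; have nb := nz x z k (ltW x0) x1 z1.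
  by field; apply/andP; split; [exact: nb | exact: na].
- move=> r r1; have [r0|r0] := ltP r 0.
    by exists 0 => // x z _ _ zr; have := rnorm_ge0 z; lra.
  have rV : 0 < (1 - r)^-1 by rewrite invr_gt0 subr_gt0.
  have V0 : 0 <= 1 * (1 - r)^-1 by rewrite mul1r ltW.
  exists (1 * (1 - r)^-1 * (1 - r)^-1); first by rewrite mulr_ge0// ltW.
  move=> x z x0 x1 zr; have z1 := le_lt_trans zr r1.
  have den i : 1 - r <= rnorm (1 + (1 - x%:C) * z 0 i).
    apply: le_trans (rnorm1D_ge _); rewrite lerD2l lerN2.
    apply: (le_trans (small x z i r x0 x1 zr)); rewrite ler_piMl//; lra.
  have H1 := rnorm_quadratic_fraction 1 r1 ler01 (den j) (rnorm_coordM z j k).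
  have H2 := rnorm_quadratic_fraction 1 r1 V0 (den k) H1.
  by rewrite !expr1 in H2; rewrite hP rnormN invfM mulrA.
- by move=> z _; rewrite EG; diffc.
- move=> z z1 zl z0; rewrite hG; apply: Re_le_rnorm1 => //.
  rewrite -zl; apply: (le_trans (rnorm_coordM _ _ _)); rewrite mul1r expr2 ler_piMl ?rnorm_ge0//.
  exact: ltW.
Qed.

End LogCoordinate.

(** * Extremal mappings *)

Section UnconditionalSums.
Context {R : realType} {T : eqType}.
Local Notation C := R[i].
Variables (g : T -> C) (valid : pred T) (s : nat -> seq T) (l : C) (B : R).
Hypotheses (s_uniq : forall m, uniq (s m)) (s_sub : forall m, {subset s m <= s m.+1}).
Hypotheses (s_valid : forall t, valid t -> exists m, t \in s m).
Hypothesis g_bound : forall m, \sum_(t <- s m) rnorm (g t) <= B.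
Hypothesis g_lim : forall e : R, 0 < e -> exists M, forall m, (M <= m)%N ->
  rnorm (\sum_(t <- s m) g t - l) < e.

Let s_mono m p : (m <= p)%N -> {subset s m <= s p}.
Proof.
elim: p => [|p ih]; first by rewrite leqn0 => /eqP ->.
by rewrite leq_eqVlt ltnS => /predU1P[->//|/ih H] t /H /s_sub.
Qed.

Let sum_sub (V : zmodType) (h : T -> V) (L S : seq T) : uniq L -> uniq S -> {subset L <= S} ->
  \sum_(t <- S) h t = \sum_(t <- L) h t + \sum_(t <- S | t \notin L) h t.
Proof.
move=> uL uS LS; rewrite (bigID (fun t => t \in L)) /=; congr (_ + _).
rewrite -big_filter; apply: perm_big; apply: uniq_perm; rewrite ?filter_uniq// => t.
by rewrite mem_filter; case tL: (t \in L) => //=; exact: LS.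
Qed.

Let s_large (L : seq T) : {in L, forall t, valid t} -> exists m, {subset L <= s m}.
Proof.
elim: L => [|t L ih] hL; first by exists 0%N.
have [|m hm] := ih; first by move=> u uL; apply: hL; rewrite inE uL orbT.
have [|p hp] := @s_valid t; first by apply: hL; rewrite inE eqxx.
exists (maxn m p) => u; rewrite inE => /predU1P[->|/hm um].
  exact: (s_mono (leq_maxr m p) hp).
exact: (s_mono (leq_maxl m p) um).
Qed.

(** Some list [s M] carries the supremum of the absolute sums up to e / 2, so valid indices outside
    it contribute at most e / 2 to any finite sum. *)
Lemma unconditional_sum (e : R) : 0 < e -> exists M, forall L : seq T, uniq L ->
  {in L, forall t, valid t} -> {subset s M <= L} -> rnorm (\sum_(t <- L) g t - l) < e.
Proof.
move=> e0; have e2 : 0 < e / 2 by rewrite divr_gt0.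
pose S m := \sum_(t <- s m) rnorm (g t).
have S_mono m p : (m <= p)%N -> S m <= S p.
  move=> mp; rewrite /S (sum_sub _ (s_uniq m) (s_uniq p) (s_mono mp)) lerDl.
  by apply: sumr_ge0 => t _; exact: rnorm_ge0.
have hS : has_sup (range S).
  by split; [exists (S 0%N), 0%N | exists B => _ [m _ <-]; exact: g_bound].
have [_ [M0 _ <-] hM0] := sup_adherent e2 hS.
have [M1 hM1] := g_lim e2.
pose M := maxn M0 M1; exists M => L uL vL sL.
have [m hm] := s_large vL.
have Mm : S (maxn m M) <= S M + e / 2.
  have H1 : S (maxn m M) <= sup (range S) by apply: sup_upper_bound => //; exists (maxn m M).
  have H2 := S_mono _ _ (leq_maxl M0 M1); rewrite -/M in H2; lra.
have Lm : {subset L <= s (maxn m M)} by move=> t /hm; apply: s_mono; exact: leq_maxl.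
rewrite (sum_sub g (s_uniq M) uL sL).
have -> : \sum_(t <- s M) g t + \sum_(t <- L | t \notin s M) g t - l =
  (\sum_(t <- s M) g t - l) + \sum_(t <- L | t \notin s M) g t by ring.
rewrite (le_lt_trans (rnormD _ _))// (splitr e) ltr_leD//; first by apply: hM1; exact: leq_maxr.
rewrite (le_trans (rnorm_sum _ _ _))//.
have H1 : S (maxn m M) = \sum_(t <- L) rnorm (g t) + \sum_(t <- s (maxn m M) | t \notin L) rnorm (g t).
  exact: sum_sub.
have H2 : \sum_(t <- L) rnorm (g t) = S M + \sum_(t <- L | t \notin s M) rnorm (g t).
  exact: sum_sub.
have H3 : 0 <= \sum_(t <- s (maxn m M) | t \notin L) rnorm (g t).
  by apply: sumr_ge0 => t _; exact: rnorm_ge0.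
lra.
Qed.

End UnconditionalSums.

(** * Power series expansions of explicit maps *)

Section Expansions.
#[local] Existing Instance totally_filter.
Context {R : realType} {n : nat}.
Local Notation C := R[i].
Local Notation Cn := 'rV[R[i]]_n.
Local Notation mindex_t := {ffun 'I_n -> nat}.

(** The multiindex p e_i + q e_j. As i = j is allowed, [bimonom i 1 j 1] covers every multiindex of
    degree 2. *)
Definition bimonom (i : 'I_n) (p : nat) (j : 'I_n) (q : nat) : mindex_t :=
  [ffun l => (l == i) * p + (l == j) * q]%N.

Lemma sum_delta (i : 'I_n) p : (\sum_l (l == i) * p = p)%N.
Proof.
by rewrite (bigD1 i)//= eqxx mul1n big1 ?addn0// => l /negbTE ->.
Qed.

Lemma mdeg_bimonom i p j q : mdeg (bimonom i p j q) = (p + q)%N.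
Proof.
rewrite /mdeg (eq_bigr (fun l => (l == i) * p + (l == j) * q)%N) => [|l _]; last by rewrite ffunE.
by rewrite big_split /= !sum_delta.
Qed.

Lemma monom_bimonom (z : Cn) i p j q : monom z (bimonom i p j q) = z 0 i ^+ p * z 0 j ^+ q.
Proof.
have delta k r : \prod_l z 0 l ^+ ((l == k) * r) = z 0 k ^+ r.
  by rewrite (bigD1 k)//= eqxx mul1n big1 ?mulr1// => l /negbTE ->.
rewrite /monom (eq_bigr (fun l => z 0 l ^+ ((l == i) * p) * z 0 l ^+ ((l == j) * q))) => [|l _].
  by rewrite big_split /= !delta.
by rewrite ffunE exprD.
Qed.

Lemma mdeg1_delta (a : mindex_t) : mdeg a = 1%N -> exists j, forall l, a l = (l == j).
Proof.
move=> /eqP/sum_nat_eq1[j [_ aj h]]; exists j => l.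
by have [->|lj] := eqVneq l j; [rewrite aj | rewrite h].
Qed.

Lemma mdeg2_bimonom (a : mindex_t) i : mdeg a = 2%N -> a i <> 0%N ->
  exists j, a = bimonom i 1 j 1.
Proof.
move=> a2 ai; pose b : mindex_t := [ffun l => a l - (l == i)]%N.
have ab l : a l = ((l == i) + b l)%N.
  by rewrite ffunE subnKC//; case: eqP => // ->; rewrite lt0n; apply/eqP.
have : mdeg b = 1%N.
  apply/eqP; rewrite -(eqn_add2l 1) -[(1 + 1)%N]a2 /mdeg.
  rewrite [X in _ == X](eq_bigr (fun l => (l == i) * 1 + b l)%N) => [|l _]; last by rewrite muln1.
  by rewrite big_split /= sum_delta.
move=> /mdeg1_delta[j bj]; exists j; apply/ffunP => l.
by rewrite ffunE ab bj !muln1.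
Qed.

Section Series.
Context {T : eqType}.
Variables (e : T -> mindex_t) (d : mindex_t -> T) (c : T -> C) (valid : pred T) (s : nat -> seq T).
Hypotheses (s_uniq : forall m, uniq (s m)) (s_sub : forall m, {subset s m <= s m.+1}).
Hypotheses (s_valid : forall t, valid t -> exists m, t \in s m).
Hypotheses (valid_s : forall m t, t \in s m -> valid t).
Hypotheses (eK : forall t, valid t -> d (e t) = t) (e2 : forall t, valid t -> (2 <= mdeg (e t))%N).

(** The series is indexed by T: e sends a valid index to its multiindex, and d decodes it.
    Multiindices outside the image of e get the coefficient 0. *)
Definition series_coef (a : mindex_t) : C :=
  if valid (d a) && (e (d a) == a) then c (d a) else 0.

Lemma series_coefE t : valid t -> series_coef (e t) = c t.
Proof. by move=> vt; rewrite /series_coef eK// vt eqxx. Qed.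

(** Decoding the multiindices with nonzero contribution turns a finite sum over J into one over
    valid indices, to which unconditional summation applies. *)
Lemma expansion_series (i : 'I_n) (f : Cn -> Cn) :
  (forall z, rnorm z < 1 -> exists B : R, forall m, \sum_(t <- s m) rnorm (c t * monom z (e t)) <= B) ->
  (forall z, rnorm z < 1 -> forall eps : R, 0 < eps -> exists M, forall m, (M <= m)%N ->
     rnorm (\sum_(t <- s m) c t * monom z (e t) - (f z 0 i - z 0 i)) < eps) ->
  expansion i f series_coef.
Proof.
move=> hB hl z; rewrite polydiscE => z1; have [B hB1] := hB z z1.
move=> A /= /rnbhsP[eps eps0 hA].
have [M hM] := @unconditional_sum R T (fun t => c t * monom z (e t)) valid s _ B
  s_uniq s_sub s_valid hB1 (hl z z1) eps eps0.
exists [fset a in map e (s M)]%fset => // J /= /fsubsetP JM; apply: hA.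
pose good a := valid (d a) && (e (d a) == a).
have -> : \sum_(a <- enum_fset J | (2 <= mdeg a)%N) series_coef a * monom z a =
    \sum_(t <- [seq d a | a <- enum_fset J & good a]) c t * monom z (e t).
  rewrite big_map big_filter (bigID good) /= [X in _ + X]big1 ?addr0; last first.
    by move=> a /andP[_ /negbTE ga]; rewrite /series_coef -/(good a) ga mul0r.
  apply: eq_big => [a|a /andP[_ ga]].
    by rewrite andb_idl// => /andP[va /eqP <-]; exact: e2.
  by rewrite /series_coef -/(good a) ga; move: ga => /andP[_ /eqP ->].
apply: hM.
- rewrite map_inj_in_uniq ?filter_uniq ?fset_uniq// => a b.
  rewrite !mem_filter => /andP[/andP[_ /eqP ga] _] /andP[/andP[_ /eqP gb] _] dab.
  by rewrite -ga -gb dab.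
- by move=> t /mapP[a]; rewrite mem_filter => /andP[/andP[va _] _] ->.
- move=> t tM; apply/mapP; exists (e t); last by rewrite eK// (valid_s tM).
  rewrite mem_filter /good eK ?(valid_s tM)// eqxx /=; apply: JM.
  by rewrite !inE; apply/mapP; exists t.
Qed.

End Series.

Lemma attained_finite (T : eqType) (ts : seq T) (e : T -> mindex_t) (c : T -> C) (i : 'I_n)
    (f : Cn -> Cn) (t : T) :
  classS0 f -> uniq ts -> t \in ts -> {in ts &, injective e} -> (forall t, (2 <= mdeg (e t))%N) ->
  (forall z, rnorm z < 1 -> f z 0 i - z 0 i = \sum_(t <- ts) c t * monom z (e t)) ->
  attained i f (e t) `|c t|.
Proof.
move=> fS uts tts einj e2 hf; split=> //.
pose d a := nth t ts (index a (map e ts)).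
have dK u : u \in ts -> d (e u) = u.
  move=> uu; have iu : (index (e u) (map e ts) < size ts)%N by rewrite -(size_map e) index_mem map_f.
  apply: einj => //; first exact: mem_nth.
  by rewrite /d -(nth_map t (e t))// nth_index// map_f.
exists (series_coef e d c (mem ts)); last first.
  by rewrite series_coefE.
apply: (@expansion_series _ e d c (mem ts) (fun=> ts)) => //.
- by move=> m u.
- by move=> z z1; exists (\sum_(t <- ts) rnorm (c t * monom z (e t))).
- by move=> z z1 eps eps0; exists 0%N => m _; rewrite hf// subrr rnorm0.
Qed.

Lemma attained_series (e : nat -> mindex_t) (d : mindex_t -> nat) (c : nat -> C) (i : 'I_n)
    (f : Cn -> Cn) (t : nat) :
  classS0 f -> (forall t, d (e t) = t) -> (forall t, (2 <= mdeg (e t))%N) ->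
  (forall z, rnorm z < 1 -> exists B : R, forall m, \sum_(t < m) rnorm (c t * monom z (e t)) <= B) ->
  (forall z, rnorm z < 1 -> forall eps : R, 0 < eps -> exists M, forall m, (M <= m)%N ->
     rnorm (\sum_(t < m) c t * monom z (e t) - (f z 0 i - z 0 i)) < eps) ->
  attained i f (e t) `|c t|.
Proof.
move=> fS eK e2 hB hl; split=> //.
have iotaE (V : nmodType) (F : nat -> V) m : \sum_(t <- iota 0 m) F t = \sum_(t < m) F t.
  by rewrite -(big_mkord predT) /index_iota subn0.
exists (series_coef e d c predT); last by rewrite series_coefE.
apply: (@expansion_series _ e d c predT (iota 0)) => //.
- exact: iota_uniq.
- by move=> m u; rewrite !mem_iota !add0n => /ltnW.
- by move=> u _; exists u.+1; rewrite mem_iota add0n ltnSn.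
- by move=> z /hB[B hB1]; exists B => m; rewrite iotaE.
- by move=> z z1 eps /(hl z z1 eps)[M hM]; exists M => m; rewrite iotaE; exact: hM.
Qed.

End Expansions.

(** * Geometric series and their derivatives *)

Section PowerSums.
Context {R : realType}.
Local Notation C := R[i].
Implicit Types (a : C) (r : R).

Lemma geometric_small (K r : R) : 0 <= r -> r < 1 -> forall eps : R, 0 < eps ->
  exists M, forall m, (M <= m)%N -> K * r ^+ m < eps.
Proof.
move=> r0 r1 eps eps0; have K1 : 0 < `|K| + 1 by rewrite ltr_wpDl.
have /cvg_expr/cvgrPdist_lt/(_ _ (divr_gt0 eps0 K1))[M _ hM] : `|r| < 1 by rewrite ger0_norm.
exists M => m /hM /=; rewrite sub0r normrN ger0_norm ?exprn_ge0// ltr_pdivlMr// mulrC.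
by apply: le_lt_trans; rewrite ler_wpM2r ?exprn_ge0// (le_trans (ler_norm _))// lerDl.
Qed.

Lemma geometric_sum (a : C) m : a != 1 -> \sum_(t < m) a ^+ t = (1 - a ^+ m) / (1 - a).
Proof.
move=> a1; have nz : 1 - a != 0 by rewrite subr_eq0 eq_sym.
apply: (mulIf nz); rewrite divfK// mulrC -[RHS]opprB subrX1; ring.
Qed.

Lemma geometric_bound r m : 0 <= r -> r < 1 -> \sum_(t < m) r ^+ t <= (1 - r)^-1.
Proof.
move=> r0 r1; have r1' : 0 < 1 - r by rewrite subr_gt0.
rewrite -[leRHS]mul1r ler_pdivlMr// mulrC.
have -> : (1 - r) * \sum_(t < m) r ^+ t = 1 - r ^+ m by rewrite -[RHS]opprB subrX1; ring.
by rewrite lerBlDr lerDl exprn_ge0.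
Qed.

Lemma derived_geometric_sum (S : comNzRingType) (a : S) m :
  (1 - a) ^+ 2 * \sum_(t < m) t.+1%:R * a ^+ t = 1 - m.+1%:R * a ^+ m + m%:R * a ^+ m.+1.
Proof.
elim: m => [|m ih]; first by rewrite big_ord0 mulr0 expr0 mulr1 mul0r addr0 subrr.
rewrite big_ord_recr /= mulrDr ih -[m.+2]addn2 -[m.+1]addn1 !natrD !exprD; ring.
Qed.

Lemma derived_geometric_bound r m : 0 <= r -> r < 1 ->
  \sum_(t < m) t.+1%:R * r ^+ t <= (1 - r)^-1 ^+ 2.
Proof.
move=> r0 r1; have r1' : 0 < 1 - r by rewrite subr_gt0.
rewrite exprVn -[leRHS]mul1r ler_pdivlMr ?exprn_gt0// mulrC derived_geometric_sum.
have -> : 1 - m.+1%:R * r ^+ m + m%:R * r ^+ m.+1 = 1 - r ^+ m * (1 + m%:R * (1 - r)).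
  by rewrite -[m.+1 in X in _ - X]addn1 natrD exprS; ring.
by rewrite lerBlDr lerDl mulr_ge0 ?exprn_ge0// addr_ge0// mulr_ge0// ltW.
Qed.

(** Write r = p^2: then (m + 1) p^m is one term of a bounded sum, and the other factor p^m tends to
    0. *)
Lemma derived_geometric_small (K r : R) : 0 <= r -> r < 1 -> forall eps : R, 0 < eps ->
  exists M, forall m, (M <= m)%N -> K * (m.+1%:R * r ^+ m) < eps.
Proof.
move=> r0 r1 eps eps0; pose p := Num.sqrt r.
have p0 : 0 <= p by exact: sqrtr_ge0.
have pr : p ^+ 2 = r by rewrite sqr_sqrtr.
have p1 : p < 1 by rewrite -(@ltr_pXn2r _ 2) ?nnegrE// expr1n pr.
have [M hM] := geometric_small (`|K| * (1 - p)^-1 ^+ 2) p0 p1 eps0.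
exists M => m /hM; apply: le_lt_trans; rewrite -pr -exprM mulnC exprM expr2.
have : m.+1%:R * p ^+ m <= (1 - p)^-1 ^+ 2.
  apply: le_trans (derived_geometric_bound m.+1 p0 p1); rewrite big_ord_recr /= lerDr.
  by apply: sumr_ge0 => t _; rewrite mulr_ge0// exprn_ge0.
move=> H; rewrite mulrA mulrA; apply: ler_wpM2r; first by rewrite exprn_ge0.
rewrite -mulrA; apply: (@le_trans _ _ (`|K| * (m.+1%:R * p ^+ m))).
  by rewrite ler_wpM2r ?ler_norm// mulr_ge0// exprn_ge0.
by rewrite ler_wpM2l.
Qed.

End PowerSums.

(** * Families of extremal mappings in arbitrary coordinates *)

Section ExtremalMappings.
Context {R : realType} {n : nat}.
Local Notation C := R[i].
Local Notation Cn := 'rV[R[i]]_n.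
Implicit Types (z w : Cn) (i j k l : 'I_n) (x r : R).

Lemma moebius_inj (s a b : C) : 1 + s * a != 0 -> 1 + s * b != 0 ->
  a / (1 + s * a) = b / (1 + s * b) -> a = b.
Proof.
move=> na nb /eqP; rewrite eqr_div// => /eqP E; apply/eqP; rewrite -subr_eq0; apply/eqP.
have -> : a - b = a * (1 + s * b) - b * (1 + s * a) by ring.
by rewrite E subrr.
Qed.

Lemma neq0_moebius (s : C) x (a : C) : rnorm s = 1 -> 0 <= x -> x <= 1 -> rnorm a < 1 ->
  1 + s * (1 - x%:C) * a != 0.
Proof.
move=> s1 x0 x1 a1; apply: neq0_1D; rewrite !rnormM s1 mul1r -realc1 -realcB rnormC.
by rewrite ger0_norm ?subr_ge0// (le_lt_trans _ a1)// ler_piMl ?rnorm_ge0// lerBlDr lerDl.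
Qed.

Lemma coord_lt1 z l : rnorm z < 1 -> rnorm (z 0 l) < 1.
Proof. by apply: le_lt_trans; exact: rnorm_coord. Qed.

Lemma rnormN1 : rnorm (- 1 : C) = 1.
Proof. by rewrite rnormN rnorm1. Qed.

(** The maps are defined for arbitrary coordinates i, j, k: sharpness concerns every multiindex of
    degree 2, and the named examples are special cases. *)
Definition koebe_map i z : Cn := \row_l (if l == i then z 0 i / (1 - z 0 i) ^+ 2 else z 0 l).

Definition quadratic_map i j z : Cn :=
  \row_l (if l == i then z 0 i * (1 + z 0 j) ^+ 2 else z 0 l).

Definition cayley_map i j z : Cn :=
  \row_l (if l == i then z 0 i * (1 + z 0 j) / (1 - z 0 j)
          else if l == j then z 0 j / (1 - z 0 j) else z 0 l).

Definition shear_map i j k z : Cn := \row_l (if l == i then z 0 i + z 0 j * z 0 k else z 0 l).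

Definition koebe_shear_map i j z : Cn :=
  \row_l (if l == i then (z 0 i - z 0 i * z 0 j + z 0 j ^+ 2) / (1 - z 0 j)
          else if l == j then z 0 j / (1 - z 0 j) else z 0 l).

Definition log_map i j k z : Cn :=
  \row_l (if l == i then z 0 i + z 0 j * z 0 k * log_quotient (z 0 j) (z 0 k)
          else if l == j then z 0 j / (1 + z 0 j)
          else if l == k then z 0 k / (1 + z 0 k) else z 0 l).

Lemma classS0_koebe i : classS0 (koebe_map i).
Proof.
pose Psi (c : C) z : Cn := \row_l (if l == i then koebe_flow c (z 0 i) else z 0 l).
pose P x z : Cn := \row_l (if l == i then - ((halfplane (z 0 i) ^+ 2 - 1) ^+ 2 /
   ((koebe_root x%:C (z 0 i) + 1) ^+ 3 * koebe_root x%:C (z 0 i))) else 0).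
pose G z : Cn := \row_l (if l == i then - (z 0 i * ((1 - z 0 i) / (1 + z 0 i))) else - z 0 l).
have -> : koebe_map i = Psi 0.
  apply/funext => z; apply/rowP => l; rewrite !mxE; case: eqP => // _.
  rewrite /koebe_flow koebe_root0; set v := (_ ^+ 2)^-1.
  by field.
apply: (@flow_classS0 _ _ Psi P G) => [l|x z w x0 x1 z1 w1 E].
  have [->|/negbTE li] := eqVneq l i.
    by apply: flow_coord_koebe => *; rewrite mxE eqxx.
  by apply: flow_coord_id => *; rewrite mxE li.
apply/rowP => l; have := congr1 (fun v : Cn => v 0 l) E; rewrite !mxE.
by case: eqP => // ->; apply: koebe_flow_inj; exact: coord_lt1.
Qed.

Lemma classS0_quadratic i j : j != i -> classS0 (quadratic_map i j).
Proof.
move=> /negbTE ji.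
pose Psi (c : C) z : Cn :=
  \row_l (if l == i then z 0 i * (1 + z 0 j) ^+ 2 / (1 + c * z 0 j) ^+ 2 else z 0 l).
pose P x z : Cn := \row_l (if l == i then
  - (2 * (z 0 i * z 0 j) * (1 + z 0 j) ^+ 2) / (1 + x%:C * z 0 j) ^+ 3 else 0).
pose G z : Cn := \row_l (if l == i then - (z 0 i * ((1 - z 0 j) / (1 + z 0 j))) else - z 0 l).
have -> : quadratic_map i j = Psi 0.
  by apply/funext => z; apply/rowP => l; rewrite !mxE mul0r addr0 expr1n divr1.
apply: (@flow_classS0 _ _ Psi P G) => [l|x z w x0 x1 z1 w1 E].
  have [->|/negbTE li] := eqVneq l i.
    by apply: (flow_coord_quadratic (j := j)) => *; rewrite mxE ?eqxx ?ji.
  by apply: flow_coord_id => *; rewrite mxE li.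
have Ej l : l != i -> z 0 l = w 0 l.
  by move=> /negbTE li; have := congr1 (fun v : Cn => v 0 l) E; rewrite !mxE li.
apply/rowP => l; have [->|/Ej//] := eqVneq l i.
have := congr1 (fun v : Cn => v 0 i) E; rewrite !mxE eqxx -(Ej j) ?ji//.
rewrite -(mulrA (z 0 i)) -(mulrA (w 0 i)); apply: mulIf; rewrite mulf_neq0 ?invr_eq0 ?expf_neq0//.
  by apply: neq0_1D; exact: coord_lt1.
by apply: neq0_1D_real; [rewrite ger0_norm | exact: coord_lt1].
Qed.

Lemma classS0_cayley i j : j != i -> classS0 (cayley_map i j).
Proof.
move=> /negbTE ji.
pose Psi (c : C) z : Cn :=
  \row_l (if l == i then z 0 i * (1 + z 0 j) / (1 + (2 * c - 1) * z 0 j)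
          else if l == j then z 0 j / (1 - (1 - c) * z 0 j) else z 0 l).
pose P x z : Cn := \row_l (if l == i then
    - (2 * (z 0 i * z 0 j) * (1 + z 0 j)) / (1 + (2 * x%:C - 1) * z 0 j) ^+ 2
  else if l == j then -1 * z 0 j ^+ 2 / (1 + -1 * (1 - x%:C) * z 0 j) ^+ 2 else 0).
pose G z : Cn := \row_l (if l == i then - (z 0 i * ((1 - z 0 j) / (1 + z 0 j)))
  else if l == j then - (z 0 j * (1 + -1 * z 0 j)) else - z 0 l).
have -> : cayley_map i j = Psi 0.
  apply/funext => z; apply/rowP => l; rewrite !mxE mulr0 sub0r mulN1r subr0 mul1r//.
apply: (@flow_classS0 _ _ Psi P G) => [l|x z w x0 x1 z1 w1 E].
  have [->|/negbTE li] := eqVneq l i.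
    by apply: (flow_coord_cayley (j := j)) => *; rewrite mxE ?eqxx ?ji.
  have [->|/negbTE lj] := eqVneq l j.
    by apply: (flow_coord_moebius rnormN1) => *; rewrite mxE ?ji eqxx ?mulN1r ?mulNr.
  by apply: flow_coord_id => *; rewrite mxE li lj.
have Ej : z 0 j = w 0 j.
  have := congr1 (fun v : Cn => v 0 j) E; rewrite !mxE ji eqxx -![_ - (1 - _) * _]/(_ + - (_ * _)) -!mulNr.
  apply: moebius_inj; rewrite -mulN1r; apply: neq0_moebius => //; try exact: rnormN1; exact: coord_lt1.
apply/rowP => l; have := congr1 (fun v : Cn => v 0 l) E; rewrite !mxE -Ej.
have [->|_] := eqVneq l i; last by case: eqP => [->|].
rewrite -!mulrA; apply: mulIf; rewrite mulf_neq0 ?invr_eq0//.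
  by apply: neq0_1D; exact: coord_lt1.
have -> : 2 * x%:C - 1 = (2 * x - 1)%:C by rewrite realcB realcM realc1 realc_nat.
by apply: neq0_1D_real; [rewrite ler_norml; lra | exact: coord_lt1].
Qed.

Lemma classS0_shear i j k : j != i -> k != i -> classS0 (shear_map i j k).
Proof.
move=> /negbTE ji /negbTE ki.
pose Psi (c : C) z : Cn := \row_l (if l == i then z 0 i + (1 - c) * (z 0 j * z 0 k) else z 0 l).
pose P (x : R) z : Cn := \row_l (if l == i then - (z 0 j * z 0 k) else 0).
pose G z : Cn := \row_l (if l == i then - z 0 i + z 0 j * z 0 k else - z 0 l).
have -> : shear_map i j k = Psi 0.
  by apply/funext => z; apply/rowP => l; rewrite !mxE subr0 mul1r.
apply: (@flow_classS0 _ _ Psi P G) => [l|x z w x0 x1 z1 w1 E].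
  have [->|/negbTE li] := eqVneq l i.
    by apply: (flow_coord_shear (j := j) (k := k)) => *; rewrite mxE ?eqxx ?ji ?ki.
  by apply: flow_coord_id => *; rewrite mxE li.
have Ej l : l != i -> z 0 l = w 0 l.
  by move=> /negbTE li; have := congr1 (fun v : Cn => v 0 l) E; rewrite !mxE li.
apply/rowP => l; have [->|/Ej//] := eqVneq l i.
have := congr1 (fun v : Cn => v 0 i) E; rewrite !mxE eqxx -(Ej j) ?ji// -(Ej k) ?ki//.
exact: addIr.
Qed.

Lemma classS0_koebe_shear i j : j != i -> classS0 (koebe_shear_map i j).
Proof.
move=> /negbTE ji.
pose Psi (c : C) z : Cn :=
  \row_l (if l == i then (z 0 i * (1 - (1 - c) * z 0 j) + (1 - c) * z 0 j ^+ 2) / (1 - (1 - c) * z 0 j)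
          else if l == j then z 0 j / (1 - (1 - c) * z 0 j) else z 0 l).
pose P x z : Cn := \row_l (if l == i then - (z 0 j ^+ 2 / (1 - (1 - x%:C) * z 0 j) ^+ 2)
  else if l == j then -1 * z 0 j ^+ 2 / (1 + -1 * (1 - x%:C) * z 0 j) ^+ 2 else 0).
pose G z : Cn := \row_l (if l == i then - z 0 i + z 0 j ^+ 2
  else if l == j then - (z 0 j * (1 + -1 * z 0 j)) else - z 0 l).
have -> : koebe_shear_map i j = Psi 0.
  by apply/funext => z; apply/rowP => l; rewrite !mxE subr0 !mul1r mulrBr mulr1.
apply: (@flow_classS0 _ _ Psi P G) => [l|x z w x0 x1 z1 w1 E].
  have [->|/negbTE li] := eqVneq l i.
    by apply: (flow_coord_koebe_shear (j := j)) => *; rewrite mxE ?eqxx ?ji.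
  have [->|/negbTE lj] := eqVneq l j.
    by apply: (flow_coord_moebius rnormN1) => *; rewrite mxE ?ji eqxx ?mulN1r ?mulNr.
  by apply: flow_coord_id => *; rewrite mxE li lj.
have nz (v : Cn) : rnorm v < 1 -> 1 - (1 - x%:C) * v 0 j != 0.
  by move=> v1; have := neq0_moebius rnormN1 x0 x1 (coord_lt1 j v1); rewrite mulN1r mulNr.
have Ej : z 0 j = w 0 j.
  have := congr1 (fun v : Cn => v 0 j) E; rewrite !mxE ji eqxx -!mulNr.
  by apply: moebius_inj; rewrite mulNr nz.
apply/rowP => l; have := congr1 (fun v : Cn => v 0 l) E; rewrite !mxE -Ej.
have [->|_] := eqVneq l i; last by case: eqP => [->|].
move=> /(mulIf (_ : _ != 0))/addIr H; apply: (mulIf (nz z z1)); apply: H.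
by rewrite invr_eq0 nz.
Qed.

Lemma classS0_log i j k : j != i -> k != i -> k != j -> classS0 (log_map i j k).
Proof.
move=> /negbTE ji /negbTE ki /negbTE kj.
pose Psi (c : C) z : Cn :=
  \row_l (if l == i then z 0 i + z 0 j * z 0 k *
            ((1 - c) * log_quotient ((1 - c) * z 0 j) ((1 - c) * z 0 k))
          else if l == j then z 0 j / (1 + (1 - c) * z 0 j)
          else if l == k then z 0 k / (1 + (1 - c) * z 0 k) else z 0 l).
pose P x z : Cn := \row_l (if l == i then
    - (z 0 j * z 0 k / ((1 + (1 - x%:C) * z 0 j) * (1 + (1 - x%:C) * z 0 k)))
  else if l == j then 1 * z 0 j ^+ 2 / (1 + 1 * (1 - x%:C) * z 0 j) ^+ 2
  else if l == k then 1 * z 0 k ^+ 2 / (1 + 1 * (1 - x%:C) * z 0 k) ^+ 2 else 0).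
pose G z : Cn := \row_l (if l == i then - z 0 i + z 0 j * z 0 k
  else if l == j then - (z 0 j * (1 + 1 * z 0 j))
  else if l == k then - (z 0 k * (1 + 1 * z 0 k)) else - z 0 l).
have -> : log_map i j k = Psi 0.
  by apply/funext => z; apply/rowP => l; rewrite !mxE subr0 !mul1r.
apply: (@flow_classS0 _ _ Psi P G) => [l|x z w x0 x1 z1 w1 E].
  have [->|/negbTE li] := eqVneq l i.
    by apply: (flow_coord_log (j := j) (k := k)) => *; rewrite mxE ?eqxx ?ji ?ki ?kj.
  have [->|/negbTE lj] := eqVneq l j.
    by apply: (flow_coord_moebius (@rnorm1 R)) => *; rewrite mxE ?ji eqxx ?mul1r.
  have [->|/negbTE lk] := eqVneq l k.
    by apply: (flow_coord_moebius (@rnorm1 R)) => *; rewrite mxE ?ki ?kj eqxx ?mul1r.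
  by apply: flow_coord_id => *; rewrite mxE li lj lk.
have nz (v : Cn) m : rnorm v < 1 -> 1 + (1 - x%:C) * v 0 m != 0.
  by move=> v1; have := neq0_moebius (@rnorm1 R) x0 x1 (coord_lt1 m v1); rewrite mul1r.
have Ej : z 0 j = w 0 j.
  have := congr1 (fun v : Cn => v 0 j) E; rewrite !mxE ji eqxx.
  by apply: moebius_inj; exact: nz.
have Ek : z 0 k = w 0 k.
  have := congr1 (fun v : Cn => v 0 k) E; rewrite !mxE ki kj eqxx.
  by apply: moebius_inj; exact: nz.
apply/rowP => l; have := congr1 (fun v : Cn => v 0 l) E; rewrite !mxE -Ej -Ek.
have [->|_] := eqVneq l i; first exact: addIr.
by case: eqP => [->//|_]; case: eqP => [->|].
Qed.

(** The Koebe function is the sum of m a^m over m >= 1. The index t stands for the degree t + 2, so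
    t = 0 is the extremal term, with coefficient 2. *)
Lemma attained_koebe i : attained i (koebe_map i) (bimonom i 1 i 1) 2.
Proof.
have := @attained_series R n (fun t => bimonom i t.+1 i 1) (fun a => a i - 2)%N (fun t => t.+2%:R)
  i (koebe_map i) 0 (classS0_koebe i).
rewrite normr_nat; apply.
- by move=> t; rewrite ffunE eqxx !mul1n addn1 !subSS subn0.
- by move=> t; rewrite mdeg_bimonom addn1.
- move=> z /(coord_lt1 i) z1; set r := rnorm (z 0 i) in z1.
  have r0 : 0 <= r by exact: rnorm_ge0.
  exists ((1 - r)^-1 ^+ 2) => m; apply: le_trans (derived_geometric_bound m.+1 r0 z1).
  rewrite big_ord_recl /= expr0 mulr1 -[leLHS]add0r lerD//; apply: ler_sum => t _.
  rewrite monom_bimonom rnormM -(realc_nat (R := R)) rnormC ger0_norm// ler_wpM2l// expr1 rnormM rnormX.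
  by rewrite ler_piMr ?exprn_ge0// ltW.
- move=> z /(coord_lt1 i) z1 eps eps0; set a := z 0 i in z1; set r := rnorm a in z1.
  have r0 : 0 <= r by exact: rnorm_ge0.
  have nz : 1 - a != 0 by exact: neq0_1B.
  have [M hM] := derived_geometric_small (2 / rnorm (1 - a) ^+ 2) r0 z1 eps0.
  exists M => m mM; have := hM m.+1 (leqW mM); apply: le_lt_trans.
  have D := derived_geometric_sum a m.+1; rewrite big_ord_recl /= expr0 mulr1 in D.
  have -> : \sum_(t < m) t.+2%:R * monom z (bimonom i t.+1 i 1) =
      a * (\sum_(t < m) (bump 0 t).+1%:R * a ^+ bump 0 t).
    by rewrite mulr_sumr; apply: eq_bigr => t _; rewrite monom_bimonom expr1 -/a /bump /= add1n; ring.
  set S := \sum_(t < m) _ in D *; rewrite mxE eqxx -/a.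
  have -> : a * S - (a / (1 - a) ^+ 2 - a) = a * ((1 - a) ^+ 2 * (1 + S) - 1) / (1 - a) ^+ 2.
    by field; exact: nz.
  rewrite D rnormf_div rnormX mulrAC ler_pM2r ?invr_gt0 ?exprn_gt0 ?rnorm_gt0//.
  have -> : a * (1 - m.+2%:R * a ^+ m.+1 + m.+1%:R * a ^+ m.+2 - 1) =
     (m.+1%:R * a - m.+2%:R) * a ^+ m.+1 * a by rewrite [a ^+ m.+2]exprSr; ring.
  rewrite !rnormM rnormX -/r mulrA.
  apply: (@le_trans _ _ (2 * m.+2%:R * r ^+ m.+1 * 1)); last by rewrite mulr1.
  apply: ler_pM; rewrite ?mulr_ge0 ?exprn_ge0 ?rnorm_ge0 ?(ltW z1)//.
  apply: ler_wpM2r; first exact: exprn_ge0.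
  rewrite (le_trans (rnormB _ _))// rnormM -!(realc_nat (R := R)) !rnormC !ger0_norm//.
  rewrite mulr2n mulrDl mul1r lerD2r -/r.
  by rewrite (@le_trans _ _ (m.+1%:R * 1))// ?ler_wpM2l ?(ltW z1)// mulr1 ler_nat.
Qed.

Lemma attained_quadratic i j : j != i -> attained i (quadratic_map i j) (bimonom i 1 j 1) 2.
Proof.
(* z_i (1 + z_j)^2 - z_i = 2 z_i z_j + z_i z_j^2: [true] marks the extremal term, [false] the cubic
   one. *)
move=> ji; pose e (b : bool) := bimonom i 1 j (if b then 1 else 2)%N.
pose c (b : bool) : C := if b then 2 else 1.
have := @attained_finite R n bool [:: true; false] e c i _ true (classS0_quadratic ji).
rewrite /c normr_nat; apply=> //.
- move=> [] [] _ _ //= /(congr1 (fun a : {ffun 'I_n -> nat} => a j)).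
  + by rewrite !ffunE eqxx (negbTE ji).
  + by rewrite !ffunE eqxx (negbTE ji).
- by case; rewrite mdeg_bimonom.
- move=> z _; rewrite !big_cons big_nil !monom_bimonom mxE eqxx; ring.
Qed.

Lemma attained_shear i j k : j != i -> k != i -> attained i (shear_map i j k) (bimonom j 1 k 1) 1.
Proof.
move=> ji ki.
have := @attained_finite R n unit [:: tt] (fun=> bimonom j 1 k 1) (fun=> 1) i _ tt (classS0_shear ji ki).
rewrite normr1; apply=> //.
- by move=> [] [].
- by move=> _; rewrite mdeg_bimonom.
- move=> z _; rewrite big_seq1 monom_bimonom mxE eqxx; ring.
Qed.

(** (1 + b) / (1 - b) - 1 is the sum of 2 b^(t + 1) over t >= 0, so every coefficient equals 2 and t
    = 0 gives the requested one. *)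
Lemma attained_cayley i j : j != i -> attained i (cayley_map i j) (bimonom i 1 j 1) 2.
Proof.
move=> ji.
have := @attained_series R n (fun t => bimonom i 1 j t.+1) (fun a => a j - 1)%N (fun=> 2)
  i (cayley_map i j) 0 (classS0_cayley ji).
rewrite normr_nat; apply.
- by move=> t; rewrite ffunE eqxx (negbTE ji) mul0n mul1n add0n subn1.
- by move=> t; rewrite mdeg_bimonom.
- move=> z z1; have a1 := coord_lt1 i z1; have b1 := coord_lt1 j z1.
  have b0 := rnorm_ge0 (z 0 j).
  exists (2 * (1 - rnorm (z 0 j))^-1) => m.
  apply: le_trans (ler_wpM2l _ (geometric_bound m b0 b1)) => //.
  rewrite mulr_sumr; apply: ler_sum => t _.
  rewrite monom_bimonom rnormM -(realc_nat (R := R)) rnormC ger0_norm// ler_wpM2l//.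
  rewrite expr1 rnormM rnormX exprS mulrA -[leRHS]mul1r ler_wpM2r ?exprn_ge0//.
  by rewrite mulr_ile1 ?rnorm_ge0// ltW.
- move=> z z1 eps eps0; have a1 := coord_lt1 i z1; have b1 := coord_lt1 j z1.
  have nz := neq0_1B b1.
  set a := z 0 i in a1; set b := z 0 j in b1 nz.
  have [M hM] := geometric_small (2 / rnorm (1 - b)) (rnorm_ge0 b) b1 eps0.
  exists M => m /hM; apply: le_lt_trans.
  have -> : \sum_(t < m) 2 * monom z (bimonom i 1 j t.+1) = 2 * a * b * \sum_(t < m) b ^+ t.
    by rewrite mulr_sumr; apply: eq_bigr => t _; rewrite monom_bimonom expr1 exprS -/a -/b; ring.
  rewrite geometric_sum; last by apply: contra nz => /eqP ->; rewrite subrr.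
  rewrite mxE eqxx -/a -/b.
  have -> : 2 * a * b * ((1 - b ^+ m) / (1 - b)) - (a * (1 + b) / (1 - b) - a) =
    - (a * b * (2 / (1 - b) * b ^+ m)) by field; exact: nz.
  rewrite rnormN rnormM -[leRHS]mul1r; apply: ler_pM; rewrite ?rnorm_ge0//.
    by rewrite rnormM mulr_ile1 ?rnorm_ge0// ltW.
  by rewrite rnormM rnormf_div rnormX -(realc_nat (R := R) 2) rnormC ger0_norm.
Qed.

(** The first coordinate is a + b^2 / (1 - b), that is a plus the sum of b^(t + 2), with all
    coefficients 1. *)
Lemma attained_koebe_shear i j : j != i ->
  attained i (koebe_shear_map i j) (bimonom j 1 j 1) 1.
Proof.
move=> ji.
have := @attained_series R n (fun t => bimonom j t.+1 j 1) (fun a => a j - 2)%N (fun=> 1)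
  i (koebe_shear_map i j) 0 (classS0_koebe_shear ji).
rewrite normr1; apply.
- by move=> t; rewrite ffunE eqxx !mul1n addn1 !subSS subn0.
- by move=> t; rewrite mdeg_bimonom addn1.
- move=> z z1; have b1 := coord_lt1 j z1.
  have b0 := rnorm_ge0 (z 0 j).
  exists ((1 - rnorm (z 0 j))^-1) => m.
  apply: le_trans (geometric_bound m b0 b1); apply: ler_sum => t _.
  rewrite monom_bimonom mul1r expr1 rnormM rnormX exprSr -mulrA ler_piMr ?exprn_ge0//.
  by rewrite mulr_ile1// ltW.
- move=> z z1 eps eps0; have b1 := coord_lt1 j z1.
  have nz := neq0_1B b1.
  set b := z 0 j in b1 nz.
  have [M hM] := geometric_small (1 / rnorm (1 - b)) (rnorm_ge0 b) b1 eps0.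
  exists M => m /hM; apply: le_lt_trans.
  have -> : \sum_(t < m) 1 * monom z (bimonom j t.+1 j 1) = b * b * \sum_(t < m) b ^+ t.
    by rewrite mulr_sumr; apply: eq_bigr => t _; rewrite monom_bimonom expr1 exprS -/b; ring.
  rewrite geometric_sum; last by apply: contra nz => /eqP ->; rewrite subrr.
  rewrite mxE eqxx -/b; set a := z 0 i.
  have -> : b * b * ((1 - b ^+ m) / (1 - b)) - ((a - a * b + b ^+ 2) / (1 - b) - a) =
    - (b * b * (1 / (1 - b) * b ^+ m)) by field; exact: nz.
  rewrite rnormN rnormM -[leRHS]mul1r; apply: ler_pM; rewrite ?rnorm_ge0//.
    by rewrite rnormM mulr_ile1 ?rnorm_ge0// ltW.
  by rewrite rnormM rnormf_div rnormX rnorm1.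
Qed.

(** The series is double: [(N, p)] with p <= N indexes z_j^(N - p + 1) z_k^(p + 1), with coefficient
    (-1)^N / (N + 1). The N + 1 terms of a row have modulus at most |z|^N / (N + 1) each, so the
    rows are dominated by a geometric series. *)
Lemma attained_log i j k : j != i -> k != i -> k != j ->
  attained i (log_map i j k) (bimonom j 1 k 1) 1.
Proof.
move=> ji ki kj; split; first exact: classS0_log.
pose e (t : nat * nat) := bimonom j (t.1 - t.2).+1 k t.2.+1.
pose d (a : {ffun 'I_n -> nat}) := (a j + a k - 2, a k - 1)%N.
pose c (t : nat * nat) : C := log_coef t.1.
pose valid (t : nat * nat) := (t.2 <= t.1)%N.
pose s m := [seq (N, p) | N <- iota 0 m, p <- iota 0 N.+1].
have sE m t : (t \in s m) = (t.1 < m)%N && valid t.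
  apply/allpairsPdep/andP => [[N [q [hN hq ->]]]|[tm vt]].
    by move: hN hq; rewrite !mem_iota /= !add0n ltnS.
  by exists t.1, t.2; rewrite !mem_iota !add0n ltnS -surjective_pairing.
have eK t : valid t -> d (e t) = t.
  case: t => N q; rewrite /valid /d /e !ffunE !eqxx (negbTE kj) [j == k]eq_sym (negbTE kj) /= => qN.
  by rewrite !mul1n !mul0n addn0 add0n addSn addnS subnK// !subSS !subn0.
have sumE (V : zmodType) (F : nat * nat -> V) m :
    \sum_(t <- s m) F t = \sum_(N < m) \sum_(p < N.+1) F (N : nat, p : nat).
  have iotaE (G : nat -> V) q : \sum_(t <- iota 0 q) G t = \sum_(t < q) G t.
    by rewrite -(big_mkord predT) /index_iota subn0.
  by rewrite big_allpairs_dep iotaE; apply: eq_bigr => N _; rewrite iotaE.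
exists (series_coef e d c valid); last first.
  have -> : bimonom j 1 k 1 = e (0, 0)%N by [].
  by rewrite series_coefE// /c /log_coef expr0 divr1 normr1.
apply: (@expansion_series _ _ _ e d c valid s) => //.
- move=> m; apply: allpairs_uniq_dep; [exact: iota_uniq | by move=> N _; exact: iota_uniq |].
  by move=> [N p] [N' p'] _ _ /= [-> ->].
- by move=> m t; rewrite !sE => /andP[tm ->]; rewrite andbT ltnS ltnW.
- by move=> t vt; exists t.1.+1; rewrite sE ltnSn.
- by move=> m t; rewrite sE => /andP[].
- by move=> t vt; rewrite mdeg_bimonom addSn addnS.
- move=> z z1; have r0 := rnorm_ge0 z; exists ((1 - rnorm z)^-1) => m.
  apply: le_trans (geometric_bound m r0 z1); rewrite sumE; apply: ler_sum => N _.
  apply: (@le_trans _ _ (\sum_(p < N.+1) (N.+1%:R)^-1 * rnorm z ^+ N)); last first.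
    by rewrite sumr_const card_ord -[leLHS]mulr_natl mulrA divff ?mul1r// pnatr_eq0.
  apply: ler_sum => p _; rewrite /c /= rnormM; apply: ler_pM; rewrite ?rnorm_ge0//.
    by rewrite /log_coef rnormf_div rnormX rnormN1 expr1n -(realc_nat (R := R)) rnormC ger0_norm// div1r.
  have pN : (p <= N)%N by rewrite -ltnS.
  rewrite monom_bimonom /= -[X in _ <= _ ^+ X](subnK pN) exprD rnormM !rnormX !exprS.
  have b l q : 0 <= rnorm (z 0 l) * rnorm (z 0 l) ^+ q <= rnorm z ^+ q.
    rewrite -exprS exprn_ge0 ?rnorm_ge0//= exprS -[leRHS]mul1r.
    apply: ler_pM; rewrite ?exprn_ge0 ?rnorm_ge0 ?(ltW (coord_lt1 l z1))//.
    by apply: lerXn2r; rewrite ?nnegrE ?rnorm_ge0 ?rnorm_coord.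
  by have /andP[b1 b2] := b j (N - p)%N; have /andP[b3 b4] := b k p; exact: ler_pM.
- move=> z z1 eps eps0.
  have j1 := rnorm_coord z j; have k1 := rnorm_coord z k.
  have [M hM] := geometric_small (1 - rnorm z)^-1 (rnorm_ge0 z) z1 eps0.
  exists M => m /hM; apply: le_lt_trans; rewrite sumE mxE eqxx.
  have -> : \sum_(N < m) \sum_(p < N.+1) c (N : nat, p : nat) * monom z (e (N : nat, p : nat)) =
      z 0 j * z 0 k * log_quotient_sum m (z 0 j) (z 0 k).
    rewrite /log_quotient_sum mulr_sumr; apply: eq_bigr => N _; rewrite !mulr_sumr.
    by apply: eq_bigr => p _; rewrite /c /e monom_bimonom /= !exprS; ring.
  have -> : z 0 j * z 0 k * log_quotient_sum m (z 0 j) (z 0 k) -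
      (z 0 i + z 0 j * z 0 k * log_quotient (z 0 j) (z 0 k) - z 0 i) =
    - (z 0 j * z 0 k * (log_quotient (z 0 j) (z 0 k) - log_quotient_sum m (z 0 j) (z 0 k))) by ring.
  rewrite rnormN rnormM -[leRHS]mul1r; apply: ler_pM; rewrite ?rnorm_ge0//.
    by rewrite rnormM mulr_ile1 ?rnorm_ge0// ltW// coord_lt1.
  by rewrite mulrC; exact: log_quotient_series.
Qed.

End ExtremalMappings.

(** * The seven named mappings and the conclusion *)

Section NamedExamples.
Context {R : realType} {n : nat}.
Local Notation C := R[i].

Lemma F1E (hn : (2 <= n)%N) : @F1 R n hn = koebe_map (Ordinal (ltnW hn)).
Proof.
apply/funext => z; apply/rowP => l; rewrite !mxE -!val_eqE.
by case: l => [[|l] hl] //=; rewrite nth_nil.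
Qed.

Lemma F2E (hn : (2 <= n)%N) : @F2 R n hn = quadratic_map (Ordinal (ltnW hn)) (Ordinal hn).
Proof.
apply/funext => z; apply/rowP => l; rewrite !mxE -!val_eqE.
by case: l => [[|l] hl] //=; rewrite nth_nil.
Qed.

Lemma F3E (hn : (2 <= n)%N) : @F3 R n hn = cayley_map (Ordinal (ltnW hn)) (Ordinal hn).
Proof.
apply/funext => z; apply/rowP => l; rewrite !mxE -!val_eqE.
by case: l => [[|[|l]] hl] //=; rewrite nth_nil.
Qed.

Lemma F4E (hn : (2 <= n)%N) :
  @F4 R n hn = shear_map (Ordinal (ltnW hn)) (Ordinal hn) (Ordinal hn).
Proof.
apply/funext => z; apply/rowP => l; rewrite !mxE -!val_eqE.
by case: l => [[|l] hl] //=; rewrite nth_nil.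
Qed.

Lemma F5E (hn : (2 <= n)%N) : @F5 R n hn = koebe_shear_map (Ordinal (ltnW hn)) (Ordinal hn).
Proof.
apply/funext => z; apply/rowP => l; rewrite !mxE -!val_eqE.
by case: l => [[|[|l]] hl] //=; rewrite nth_nil.
Qed.

Lemma F6E (hn : (3 <= n)%N) :
  @F6 R n hn = shear_map (Ordinal (ltnW (ltnW hn))) (Ordinal (ltnW hn)) (Ordinal hn).
Proof.
apply/funext => z; apply/rowP => l; rewrite !mxE -!val_eqE.
by case: l => [[|l] hl] //=; rewrite nth_nil.
Qed.

Lemma F7E (hn : (3 <= n)%N) :
  @F7 R n hn = log_map (Ordinal (ltnW (ltnW hn))) (Ordinal (ltnW hn)) (Ordinal hn).
Proof.
apply/funext => z; apply/rowP => l; rewrite !mxE -!val_eqE.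
by case: l => [[|[|[|l]]] hl] //=; rewrite nth_nil.
Qed.

Lemma mindex_bimonom (s : seq nat) (i j : 'I_n) :
  (forall l, nth 0 s l = (l == i) + (l == j))%N -> mindex n s = bimonom i 1 j 1.
Proof.
move=> h; apply/ffunP => l; rewrite !ffunE !muln1 -!val_eqE.
exact: h.
Qed.

End NamedExamples.

Local Close Scope complex_scope.
Local Close Scope classical_set_scope.

Theorem theorem4p3 (R : realType) (n : nat) (hn : (2 <= n)%N) :
  let i1 : 'I_n := Ordinal (ltnW hn) in
  ((forall (f : 'rV[R[i]]_n -> 'rV[R[i]]_n) (A : {ffun 'I_n -> nat} -> R[i]),
      classS0 f -> expansion i1 f A ->
      forall a, mdeg a = 2%N -> a i1 <> 0%N -> `|A a| <= 2) /\
   (forall a : {ffun 'I_n -> nat}, mdeg a = 2%N -> a i1 <> 0%N ->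
      exists f : 'rV[R[i]]_n -> 'rV[R[i]]_n, attained i1 f a 2) /\
   attained i1 (@F1 R n hn) (mindex n [:: 2%N]) 2 /\
   attained i1 (@F2 R n hn) (mindex n [:: 1%N; 1%N]) 2 /\
   attained i1 (@F3 R n hn) (mindex n [:: 1%N; 1%N]) 2) /\
  ((forall (f : 'rV[R[i]]_n -> 'rV[R[i]]_n) (A : {ffun 'I_n -> nat} -> R[i]),
      classS0 f -> expansion i1 f A ->
      forall a, mdeg a = 2%N -> a i1 = 0%N -> `|A a| <= 1) /\
   (forall a : {ffun 'I_n -> nat}, mdeg a = 2%N -> a i1 = 0%N ->
      exists f : 'rV[R[i]]_n -> 'rV[R[i]]_n, attained i1 f a 1) /\
   attained i1 (@F4 R n hn) (mindex n [:: 0%N; 2%N]) 1 /\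
   attained i1 (@F5 R n hn) (mindex n [:: 0%N; 2%N]) 1 /\
   (forall h3 : (3 <= n)%N,
      attained i1 (@F6 R n h3) (mindex n [:: 0%N; 1%N; 1%N]) 1 /\
      attained i1 (@F7 R n h3) (mindex n [:: 0%N; 1%N; 1%N]) 1)).
Proof.
move=> i1; pose i2 : 'I_n := Ordinal hn.
have i21 : i2 != i1 by [].
have two_real : 2 = (2 : R)%:C%C by rewrite realc_nat.
split; split.
- move=> f A fS hA a a2 ai; rewrite two_real normle; exact: coefficient_bound2 fS hA a2 ai.
- split=> [a a2 ai|].
    have [j ->] := mdeg2_bimonom a2 ai.
    have [->|ji] := eqVneq j i1; first by exists (koebe_map i1); exact: attained_koebe.
    by exists (quadratic_map i1 j); exact: attained_quadratic.
  split; first by rewrite F1E (@mindex_bimonom _ _ i1 i1) => [|[|[|l]]]//; exact: attained_koebe.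
  split.
    rewrite F2E (@mindex_bimonom _ _ i1 i2) => [|[|[|[|l]]]]//; exact: attained_quadratic.
  rewrite F3E (@mindex_bimonom _ _ i1 i2) => [|[|[|[|l]]]]//; exact: attained_cayley.
- move=> f A fS hA a a2 ai; have -> : 1 = (1 : R)%:C%C by [].
  rewrite normle; exact: coefficient_bound1 fS hA a2 ai.
- split=> [a a2 ai|].
    (* Any j in the support of alpha gives alpha = e_j + e_k; as alpha_1 = 0, neither index is the
       first, and the shear z_1 + z_j z_k is extremal. *)
    have [j aj] : exists j, a j <> 0%N.
      have [j /eqP aj|a0] := pickP (fun j => a j != 0%N); first by exists j.
      by move: a2; rewrite /mdeg big1// => j _; apply/eqP; rewrite -[_ == _]negbK a0.
    have [k ajk] := mdeg2_bimonom a2 aj.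
    have ji : j != i1 by apply/eqP => ji; apply: aj; rewrite ji.
    have ki : k != i1.
      by apply/eqP => ki; move: ai; rewrite ajk ki ffunE eqxx eq_sym (negbTE ji).
    by exists (shear_map i1 j k); rewrite ajk; exact: attained_shear.
  split; first by rewrite F4E (@mindex_bimonom _ _ i2 i2) => [|[|[|[|l]]]]//; exact: attained_shear.
  split.
    by rewrite F5E (@mindex_bimonom _ _ i2 i2) => [|[|[|[|l]]]]//; exact: attained_koebe_shear.
  move=> h3; pose i3 : 'I_n := Ordinal h3.
  have E1 : Ordinal (ltnW (ltnW h3)) = i1 by apply: val_inj.
  have E2 : Ordinal (ltnW h3) = i2 by apply: val_inj.
  rewrite F6E F7E E1 E2 (@mindex_bimonom _ _ i2 i3) => [|[|[|[|[|l]]]]]//.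
  by split; [exact: attained_shear | exact: attained_log].
Qed.
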